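(* Let $\beta>0$, let $n\ge2$ be an integer, and let $\kappa$ be a partition with $l(\kappa)<n$. For every real diagonal matrix $\Lambda=\mathrm{diag}(\lambda_1,\ldots,\lambda_n)$, $$C_\kappa^{(\beta)}(\Lambda)=\frac{C_\kappa^{(\beta)}(I_n)}{C_\kappa^{(\beta)}(I_{n-1})}\cdot\frac{2^{n-1}\Gamma(n\beta/2)}{\Gamma(\beta/2)^n}\cdot\int\prod_{i=1}^{n}q_i^{\beta-1}\,C_\kappa^{(\beta)}\big((I-qq^t)\Lambda\big)\,dq,$$ where the integral is over unit vectors $q\in\mathbb{R}^n$ with positive entries and $dq$ is the surface area element on the sphere. Equivalently, $C_\kappa^{(\beta)}(\Lambda)$ is a constant (independent of $\Lambda$) times $E_q\big[C_\kappa^{(\beta)}(\mathrm{Proj}_{q^\perp}\Lambda)\big]$, where $\mathrm{Proj}_{q^\perp}\Lambda=(I-qq^t)\Lambda$ and the expectation is over the random unit vector $q$ obtained by normalizing a length-$n$ vector of independent $\chi_\beta$ random variables to have norm $1$.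
   Context: $\chi_\beta$ denotes a positive random variable with density $\frac{2^{1-\beta/2}}{\Gamma(\beta/2)}x^{\beta-1}e^{-x^2/2}$ on $x>0$. Vectors are column vectors. Jack polynomials. A partition $\kappa\vdash k$ is a non-increasing sequence $\kappa_1\ge\kappa_2\ge\cdots\ge0$ of integers with sum $|\kappa|=k$; $l(\kappa)$ is the number of nonzero parts. Put $\rho_\kappa=\sum_i\kappa_i(\kappa_i-1-\beta(i-1))$. For partitions of $k$, $\mu\le\kappa$ (dominance) means $\mu_1+\cdots+\mu_j\le\kappa_1+\cdots+\kappa_j$ for all $j$; $m_\mu$ is the monomial symmetric polynomial. For $\kappa\vdash k$ with $l(\kappa)\le n$, the Jack polynomial in the $C$-normalization $C_\kappa^{(\beta)}(x_1,\ldots,x_n)$ is the homogeneous symmetric polynomial of degree $k$ of the form $\sum_{\mu\le\kappa}a_{\kappa\mu}m_\mu$, $a_{\kappa\kappa}\ne0$, which is an eigenfunction of $D_n^*=\sum_{i=1}^n x_i^2\frac{\partial^2}{\partial x_i^2}+\beta\sum_{i\ne j}\frac{x_i^2}{x_i-x_j}\frac{\partial}{\partial x_i}$ with eigenvalue $\rho_\kappa+\beta k(n-1)$, the scalings being fixed by $\sum_{\kappa\vdash k,\,l(\kappa)\le n}C_\kappa^{(\beta)}(x_1,\ldots,x_n)=(x_1+\cdots+x_n)^k$ for every $k$. For an $n\times n$ matrix $X$ with eigenvalues $x_1,\ldots,x_n$ (not necessarily symmetric), $C_\kappa^{(\beta)}(X)=C_\kappa^{(\beta)}(x_1,\ldots,x_n)$;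 the number of variables is the size of the matrix. *)

(* Defs.v *)
From HB Require Import structures.
From mathcomp Require Import all_boot all_order all_algebra.
(* The notations of mpoly and of mathcomp-analysis cannot be loaded together;
   mpoly n R is {mpoly R[n]}, bmultinom n k is the type of monomials in n
   variables of degree < k. *)
From mathcomp.multinomials Require Import -(notations) mpoly.
From mathcomp Require Import all_classical all_reals all_analysis.
From mathcomp.real_closed Require Import complex.

Set Implicit Arguments.
Unset Strict Implicit.
Unset Printing Implicit Defensive.

Import Order.TTheory GRing.Theory Num.Theory.
Import numFieldNormedType.Exports.

Local Open Scope ring_scope.
Local Open Scope classical_set_scope.

(* A partition is the sequence of its nonzero parts, so l(kappa) is its size,
   |kappa| is sumn kappa and kappa_(i+1) is nth 0 kappa i. *)
Definition is_partition (kappa : seq nat) : bool :=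
  sorted geq kappa && (0%N \notin kappa).

Definition dominates (kappa mu : seq nat) : Prop :=
  forall j, (sumn (take j mu) <= sumn (take j kappa))%N.

Definition nonzero_parts (s : seq nat) : seq nat := [seq i <- s | i != 0%N].

(* Partitions of k with at most n parts, obtained by padding with zeros. *)
Definition partitions (k n : nat) : seq (seq nat) :=
  [seq nonzero_parts s | s <- [seq map val (tval t) | t : n.-tuple 'I_k.+1]
     & sorted geq s && (sumn s == k)].

Lemma geq_trans : transitive geq.
Proof. by move=> a b c /= ba /leq_trans; apply. Qed.

Lemma sumn_nonzero_parts s : sumn (nonzero_parts s) = sumn s.
Proof. by elim: s => //= -[|i] s IH /=; rewrite IH. Qed.

Lemma sorted_nonzero_parts s : sorted geq s ->
  s = nonzero_parts s ++ nseq (size s - size (nonzero_parts s)) 0%N.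
Proof.
elim: s => // -[|i] s IH ss; last first.
  by rewrite [nonzero_parts _]/= cat_cons subSS -IH// (path_sorted ss).
have -> : 0%N :: s = nseq (size s).+1 0%N.
  congr cons; apply/all_pred1P.
  move: (ss); rewrite /= path_sortedE; last exact: geq_trans.
  by move=> /andP[/allP s0 _]; apply/allP => j /s0; rewrite /= leqn0.
suff -> : nonzero_parts (nseq (size s).+1 0%N) = [::] by rewrite subn0 size_nseq.
by elim: (size s).+1.
Qed.

Lemma mem_partitions k n kappa : (kappa \in partitions k n) =
  [&& is_partition kappa, sumn kappa == k & (size kappa <= n)%N].
Proof.
apply/mapP/and3P => [[s]|[/andP[skap kap0] /eqP sk kn]].
  rewrite mem_filter => /andP[/andP[ss /eqP sums] /mapP[t _ st]] ->; split.
  - by rewrite /is_partition sorted_filter ?mem_filter//; exact: geq_trans.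
  - by rewrite sumn_nonzero_parts sums.
  - by rewrite size_filter (leq_trans (count_size _ _))// st size_map size_tuple.
set s := kappa ++ nseq (n - size kappa) 0%N.
have sz : size s = n by rewrite size_cat size_nseq subnKC.
have sums : sumn s = k by rewrite sumn_cat sk sumn_nseq mul0n addn0.
have le_s i : i \in s -> (i < k.+1)%N.
  by rewrite ltnS -sums => /perm_to_rem/perm_sumn->; rewrite /= leq_addr.
have szm : size [seq (inord i : 'I_k.+1) | i <- s] == n by rewrite size_map sz.
exists s.
  rewrite mem_filter sums eqxx andbT; apply/andP; split.
    apply/(sortedP 0%N) => i; rewrite sz => i1n.
    rewrite !nth_cat !nth_nseq /=.
    case: (ltnP i.+1) => [i1k|ki]; last by case: ifP.
    by rewrite (ltn_trans _ i1k)//; move/(sortedP 0%N): skap => /(_ _ i1k).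
  apply/mapP; exists (Tuple szm); rewrite ?mem_enum//=.
  rewrite -map_comp -[LHS]map_id; apply/eq_in_map => i /le_s ik.
  by rewrite /= inordK.
rewrite /nonzero_parts filter_cat.
have /all_filterP -> : all (fun i => i != 0%N) kappa.
  by apply/allP => i; apply: contraTneq => ->.
suff -> : [seq i <- nseq (n - size kappa) 0%N | i != 0%N] = [::] by rewrite cats0.
by elim: (_ - _)%N.
Qed.

Lemma partitions_uniq k n : uniq (partitions k n).
Proof.
rewrite map_inj_in_uniq.
  rewrite filter_uniq// map_inj_uniq ?enum_uniq//.
  exact: inj_comp (inj_map val_inj) val_inj.
move=> s t; rewrite !mem_filter => /andP[/andP[ss _] /mapP[x _ sx]].
move=> /andP[/andP[st _] /mapP[y _ ty]] eq_st.
rewrite (sorted_nonzero_parts ss) (sorted_nonzero_parts st) eq_st.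
by rewrite [in size s]sx [in size t]ty !size_map !size_tuple.
Qed.

Section Jack.
Variable R : realType.

Definition monomial_sym n (mu : seq nat) : mpoly n R :=
  \sum_(m : bmultinom n (sumn mu).+1
        | perm_eq (nonzero_parts [seq (m : multinom n) i | i <- enum 'I_n]) mu)
    mpolyX R m.

(* (D_n^* p)(x), meaningful at points x with pairwise distinct coordinates. *)
Definition jack_op (beta : R) n (p : mpoly n R) (x : 'I_n -> R) : R :=
  \sum_i x i ^+ 2 * meval x (mderiv i (mderiv i p)) +
  beta * \sum_i \sum_(j | j != i)
           x i ^+ 2 / (x i - x j) * meval x (mderiv i p).

Definition jack_rho (beta : R) (kappa : seq nat) : R :=
  \sum_(i < size kappa)
    (nth 0%N kappa i)%:R * ((nth 0%N kappa i)%:R - 1 - beta * i%:R).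

(* C n kappa is the C-normalized Jack polynomial in n variables, for every n and
   every partition kappa with at most n parts. Both sides of the eigenvalue
   equation are rational functions, hence it suffices to compare their values
   off the diagonals x_i = x_j. *)
Record jack_family (beta : R) (C : forall n, seq nat -> mpoly n R) : Prop := {
  jack_triangular : forall n kappa, is_partition kappa -> (size kappa <= n)%N ->
    exists a : seq nat -> R,
      [/\ a kappa != 0,
          forall mu, ~ dominates kappa mu -> a mu = 0 &
          C n kappa =
            \sum_(mu <- partitions (sumn kappa) n) a mu *: monomial_sym n mu] ;
  jack_eigen : forall n kappa, is_partition kappa -> (size kappa <= n)%N ->
    forall x : 'I_n -> R, injective x ->
      jack_op beta (C n kappa) x =
      (jack_rho beta kappa + beta * (sumn kappa)%:R * (n%:R - 1)) *
      meval x (C n kappa) ;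
  jack_sum : forall n k,
    \sum_(kappa <- partitions k n) C n kappa =
    (\sum_(i < n) mpolyX R (mnm1 i)) ^+ k }.

(* The eigenvalues of X, with multiplicity, in some order. *)
Definition mx_eigenvalues n (X : 'M[R]_n) : seq R[i] :=
  sval (closed_field_poly_normal (char_poly (map_mx (real_complex R) X))).

(* p(X) for p symmetric. The eigenvalues of a real matrix may be nonreal, but
   they come in conjugate pairs, so the value of p is real. *)
Definition meval_mx n (p : mpoly n R) (X : 'M[R]_n) : R :=
  complex.Re (meval (fun i : 'I_n => (mx_eigenvalues X)`_i)
                    (map_mpoly (real_complex R) p)).

End Jack.

Section LebesgueTuple.
Variable R : realType.
Local Open Scope ereal_scope.

Section step.
Variables (n : nat) (mu : {sigma_finite_measure set (n.-tuple R) -> \bar R}).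

Let cons (p : measurableTypeR R * n.-tuple R) : n.+1.-tuple R :=
  [tuple of p.1 :: p.2].

Let mcons : measurable_fun setT cons.
Proof. exact: (measurable_cons (T2 := R) measurable_fst measurable_snd). Qed.

Definition lebesgue_cons : set (n.+1.-tuple R) -> \bar R :=
  pushforward (@lebesgue_measure R \x mu) cons.

Let push : {measure set (n.+1.-tuple R) -> \bar R} :=
  measure_function_pushforward__canonical__measure_function_Measure
    (@lebesgue_measure R \x mu) mcons.

HB.instance Definition _ := isMeasure.Build _ _ _ lebesgue_cons
  (measure0 push) (measure_ge0 push) (@measure_semi_sigma_additive _ _ _ push).

Let sigma_finite_cons : sigma_finite setT lebesgue_cons.
Proof.
have /sigma_finiteP[F [TF ndF Foo]] := sigma_finiteT (@lebesgue_measure R).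
have /sigma_finiteP[G [TG ndG Goo]] := sigma_finiteT mu.
have mthead : measurable_fun [set: n.+1.-tuple R]
    (fun t => thead t : measurableTypeR R).
  exact: (measurable_tnth (T := R) ord0).
have mbehead := @measurable_behead _ R n.
exists (fun k => [set t : n.+1.-tuple R | F k (thead t) /\ G k [tuple of behead t]]).
  apply/esym/seteqP; split=> // t _.
  have [k _ Fk] : (\bigcup_k F k) (thead t) by rewrite -TF.
  have [l _ Gl] : (\bigcup_k G k) [tuple of behead t] by rewrite -TG.
  exists (maxn k l) => //; split.
    by move: Fk; exact/subsetPset/ndF/leq_maxl.
  by move: Gl; exact/subsetPset/ndG/leq_maxr.
move=> k; have [mFk Fk] := Foo k; have [mGk Gk] := Goo k; split.
  apply: measurableI.
    by rewrite -[X in measurable X]setTI; exact: mthead.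
  by rewrite -[X in measurable X]setTI; exact: mbehead.
rewrite /lebesgue_cons /pushforward.
rewrite (_ : _ @^-1` _ = F k `*` G k).
  by rewrite product_measure1E// lte_mul_pinfty// ge0_fin_numE.
have consE (x : R) (t : n.-tuple R) : [tuple of behead [tuple of x :: t]] = t.
  exact: val_inj.
by apply/seteqP; split=> -[x t]; rewrite /setX /preimage /mkset /cons consE theadE.
Qed.

HB.instance Definition _ :=
  Measure_isSigmaFinite.Build _ _ _ lebesgue_cons sigma_finite_cons.

End step.

(* n-dimensional Lebesgue measure. *)
Fixpoint lebesgue_tuple n : {sigma_finite_measure set (n.-tuple R) -> \bar R} :=
  match n with
  | 0%N => \d_[tuple]
  | n'.+1 => lebesgue_cons (lebesgue_tuple n')
  end.

Lemma lebesgue_tuple_box n (A : 'I_n -> set R) : (forall i, measurable (A i)) ->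
  lebesgue_tuple n [set t | forall i, A i (tnth t i)] =
  \prod_(i < n) @lebesgue_measure R (A i).
Proof.
elim: n A => [|n IH] A mA /=.
  by rewrite big_ord0 diracE mem_set// => -[].
rewrite big_ord_recl -IH => [|i]; last exact: mA.
rewrite -product_measure1E.
- apply: (congr1 (@lebesgue_measure R \x lebesgue_tuple n)).
  apply/seteqP; split=> -[x t] /=.
    move=> xtA; split; first exact: (xtA ord0).
    by move=> i; have := xtA (lift ord0 i); rewrite tnthS.
  move=> [Ax At] i; case: (unliftP ord0 i) => [j|] ->; last exact: Ax.
  by rewrite tnthS; exact: At.
- exact: mA.
- rewrite (_ : mkset _ = \bigcap_(i in [set: 'I_n])
      ((fun t : n.-tuple R => tnth t i) @^-1` A (lift ord0 i))).
    apply: fin_bigcap_measurable => // i _; rewrite -[X in measurable X]setTI.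
    exact: (measurable_tnth (T := R) i _ (mA _)).
  by apply/seteqP; split=> t tA i; [move=> _; exact: tA|exact: (tA i I)].
Qed.

End LebesgueTuple.

Section Sphere.
Variable R : realType.

(* The graph of h over a subset D of R^m, whose surface area element over the
   point y is sqrt(1 + |grad h(y)|^2) dy. *)
Definition partial_derivative m (h : m.-tuple R -> R) (i : 'I_m) (y : m.-tuple R) : R :=
  derive1 (fun t : R => h [tuple if j == i then t else tnth y j | j < m])
    (tnth y i).

Definition area_element m (h : m.-tuple R -> R) (y : m.-tuple R) : R :=
  Num.sqrt (1 + \sum_(i < m) partial_derivative h i y ^+ 2).

(* The unit vectors of R^n with positive entries form the graph of hemisphere
   over orthant_ball; sphere_point y is the one with first coordinates y. *)
Definition hemisphere m (y : m.-tuple R) : R :=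
  Num.sqrt (1 - \sum_(i < m) tnth y i ^+ 2).

Definition orthant_ball m : set (m.-tuple R) :=
  [set y | (forall i, 0 < tnth y i) /\ \sum_(i < m) tnth y i ^+ 2 < 1].

Definition sphere_point n (y : n.-1.-tuple R) : 'cV[R]_n :=
  \col_(i < n) nth (hemisphere y) y i.

Lemma sphere_pointP m (q : 'cV[R]_m.+1) :
  (forall i, 0 < q i ord0) /\ \sum_i q i ord0 ^+ 2 = 1 <->
  exists2 y, orthant_ball y & q = sphere_point y.
Proof.
have widenE (y : m.-tuple R) i :
    nth (hemisphere y) y (widen_ord (leqnSn m) i) = tnth y i.
  by rewrite (tnth_nth (hemisphere y)).
have maxE (y : m.-tuple R) : nth (hemisphere y) y (@ord_max m) = hemisphere y.
  by rewrite nth_default// size_tuple.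
split=> [[q0 q1]|[y [y0 y1] ->]].
  pose y := [tuple q (widen_ord (leqnSn m) i) ord0 | i < m].
  have yE : \sum_(i < m) tnth y i ^+ 2 = 1 - q ord_max ord0 ^+ 2.
    rewrite -q1 big_ord_recr /= addrK; apply: eq_bigr => i _.
    by rewrite tnth_mktuple.
  have hE : hemisphere y = q ord_max ord0.
    by rewrite /hemisphere yE subKr sqrtr_sqr gtr0_norm.
  exists y.
    split=> [i|]; first by rewrite tnth_mktuple.
    by rewrite yE gtrBl exprn_gt0.
  apply/colP => i; rewrite !mxE.
  case: (unliftP ord_max i) => [j|] ->; last by rewrite maxE hE.
  have -> : lift ord_max j = widen_ord (leqnSn m) j.
    by apply: val_inj; rewrite /= /bump leqNgt ltn_ord.
  by rewrite widenE tnth_mktuple.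
have h0 : 0 < hemisphere y by rewrite sqrtr_gt0 subr_gt0.
split=> [i|].
  rewrite mxE; case: (unliftP ord_max i) => [j|] ->; last by rewrite maxE.
  have -> : lift ord_max j = widen_ord (leqnSn m) j.
    by apply: val_inj; rewrite /= /bump leqNgt ltn_ord.
  by rewrite widenE.
rewrite big_ord_recr /= mxE maxE sqr_sqrtr ?subr_ge0 1?ltW//.
rewrite (eq_bigr (fun i => tnth y i ^+ 2)) ?[_ + (1 - _)]addrC ?subrK// => i _.
by rewrite mxE widenE.
Qed.

Local Open Scope ereal_scope.

Definition sphere_integrable n (f : 'cV[R]_n -> R) : Prop :=
  (lebesgue_tuple R n.-1).-integrable (@orthant_ball n.-1)
    (fun y => (f (sphere_point y) * area_element (@hemisphere n.-1) y)%:E).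

(* The integral of f over unit vectors with positive entries with respect to
   the surface area. *)
Definition sphere_integral n (f : 'cV[R]_n -> R) : \bar R :=
  \int[lebesgue_tuple R n.-1]_(y in @orthant_ball n.-1)
    (f (sphere_point y) * area_element (@hemisphere n.-1) y)%:E.

End Sphere.

Section Chi.
Variable R : realType.

Definition Gamma (s : R) : R :=
  \int[@lebesgue_measure R]_(x in `]0, +oo[) (x `^ (s - 1) * expR (- x)).

Definition chi_pdf (beta x : R) : R :=
  2 `^ (1 - beta / 2) / Gamma (beta / 2) *
  x `^ (beta - 1) * expR (- x ^+ 2 / 2).

Local Open Scope ereal_scope.

Definition chi_distributed (beta : R) d (T : measurableType d)
    (P : probability T R) (X : {RV P >-> R}) : Prop :=
  forall A : set R, measurable A ->
    distribution P X A =
    \int[@lebesgue_measure R]_(x in A `&` `]0%R, +oo[) (chi_pdf beta x)%:E.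

(* Subfamilies are covered by taking B i = setT. *)
Definition mutually_independent d (T : measurableType d) (P : probability T R)
    n (X : 'I_n -> {RV P >-> R}) : Prop :=
  forall B : 'I_n -> set R, (forall i, measurable (B i)) ->
    P [set w | forall i, B i (X i w)] = \prod_(i < n) P (X i @^-1` B i).

End Chi.

Definition normalize (R : realType) n (v : 'cV[R]_n) : 'cV[R]_n :=
  (Num.sqrt (\sum_(i < n) v i ord0 ^+ 2))^-1 *: v.

(* Main.v *)
(* Put w_i = q_i^2. On the simplex sum w_i = 1, the eigenvalues mu of
   (I - qq^t) diag(lambda) are the roots of y sum_i w_i prod_(j <> i) (y - lambda_j),
   so that e_k(mu) = eps_k(w, lambda) is linear in w. The uniform measure weighted by
   prod q_i^(beta-1) and the normalized chi vector both integrate polynomials in w by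
   a Dirichlet functional with parameter beta/2, a linear functional determined by
   the vanishing of the averages of w_i w_j (d_i - d_j) f + beta/2 (w_j - w_i) f.
   Writing C_kappa = F(e_1, ..., e_n), this integration by parts shows that the average
   of F(eps(w, lambda)) is an eigenfunction in lambda of the Jack operator, with the
   eigenvalue of C_kappa, whose monomials are dominated by kappa; hence it is a multiple
   of C_kappa(lambda). The constant follows by taking lambda = (1, ..., 1), where mu is
   (1, ..., 1, 0) and C_kappa(x, 0) is the Jack polynomial in n - 1 variables. *)

Require Import Defs.
From HB Require Import structures.
From mathcomp Require Import all_boot all_order all_algebra.
From mathcomp.multinomials Require Import -(notations) mpoly.
From mathcomp Require Import all_classical all_reals all_analysis measurable_realfun.
From mathcomp.real_closed Require Import complex.
From mathcomp Require Import perm ring lra zify.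

Set Implicit Arguments.
Unset Strict Implicit.
Unset Printing Implicit Defensive.

Import Order.TTheory GRing.Theory Num.Theory.
Import numFieldNormedType.Exports.

Local Open Scope ring_scope.

(** * Symmetric polynomials and dominance *)

(** The roots mu are only implicit functions of lambda, they may coincide and, for some w of sum 1,
    be nonreal, so C_kappa(mu) cannot be differentiated root by root. Hence the detour through F:
    eps_k(w, lambda) is polynomial in both arguments, and written in e_1, ..., e_n the eigenvalue
    equation of C_kappa loses its denominators and holds at every complex mu. Against the chain rule
    in lambda it leaves two errors, one with w_i w_j and second derivatives of F, one with w_j and
    first derivatives. They are the two halves of the Dirichlet flow of lambda_i lambda_j /
    (lambda_i - lambda_j) times the sum over k of d_i d_j e_(k+1)(lambda) (d_k F)(eps), where d_k F
    is the derivative in the variable of e_k. The identities behind this are checked on generating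
    functions in free variables.

    The functional stays abstract because it is also used to prove C_kappa(1, ..., 1) != 0 by
    induction on the number of variables, which gives a meaning to the quotient C_kappa(I_n) /
    C_kappa(I_(n-1)). The factor 2^(n-1) Gamma(n beta/2) / Gamma(beta/2)^n is the inverse of the
    weighted mass of the positive part of the sphere. *)

Lemma poly_vanish_nat (R : numDomainType) (q : {poly R}) (N : nat) :
  (forall t : nat, (N <= t)%N -> q.[t%:R] = 0) -> q = 0.
Proof.
move=> q0; apply/eqP/negPn/negP => qn0.
have := max_poly_roots (rs := [seq (i%:R : R) | i <- iota N (size q)]) qn0.
rewrite size_map size_iota ltnn; suff [-> ->] : all (root q) [seq i%:R | i <- iota N (size q)] /\ uniq [seq (i%:R : R) | i <- iota N (size q)] by move=> /(_ isT isT).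
split; last by rewrite map_inj_uniq ?iota_uniq// => i j /eqP; rewrite eqr_nat => /eqP.
by apply/allP => x /mapP[j]; rewrite mem_iota => /andP[/q0 qj _] ->; apply/rootP.
Qed.

(** Uniqueness of base-N digits; it makes the Kronecker encoding of exponent vectors injective. *)
Lemma digits_inj n N (f g : nat -> nat) :
  (forall i, (i < n)%N -> (f i < N)%N) -> (forall i, (i < n)%N -> (g i < N)%N) ->
  (\sum_(i < n) f i * N ^ i = \sum_(i < n) g i * N ^ i)%N ->
  forall i, (i < n)%N -> f i = g i.
Proof.
elim: n f g => // n IH f g fN gN.
have split_low (h : nat -> nat) : (\sum_(i < n.+1) h i * N ^ i =
    (\sum_(i < n) h i.+1 * N ^ i) * N + h 0)%N.
  rewrite big_ord_recl expn0 muln1 addnC; congr addn.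
  by rewrite big_distrl; apply: eq_bigr => i _; rewrite /= /bump /= expnS mulnCA mulnC.
rewrite !split_low => fg.
have N0 : (0 < N)%N by exact: leq_trans (fN 0%N _).
have f0 : f 0%N = g 0%N.
  by move: (congr1 (modn^~ N) fg); rewrite !modnMDl !modn_small ?fN ?gN.
move: fg; rewrite f0 => /addIn/eqP; rewrite eqn_pmul2r// => /eqP fg.
case=> [//|i] ilt; apply: (IH (fun i => f i.+1) (fun i => g i.+1)) => // j jn.
  exact: fN.
exact: gN.
Qed.

(* Kronecker substitution: the points x_i = t^(N^i) separate the monomials. *)
Lemma mpoly_vanish_generic (R : numDomainType) n (p : mpoly n R) :
  (forall x : 'I_n -> R, injective x -> (forall i, 0 < x i) -> meval x p = 0) ->
  p = 0.
Proof.
(* [N] exceeds every exponent occurring in [p], and it is at least 2, so that the points t^(N^i) are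
   pairwise distinct. *)
move=> p0; pose N := (msize p).+2; pose enc (m : multinom n) := (\sum_(i < n) m i * N ^ i)%N.
pose q : {poly R} := \sum_(m <- msupp p) mcoeff m p *: 'X^(enc m).
have q0 : q = 0.
  apply: (@poly_vanish_nat _ _ 2) => t t2.
  pose x (i : 'I_n) : R := (t ^ (N ^ i))%N%:R.
  have <- : meval x p = q.[t%:R].
    rewrite mevalE /q horner_sum; apply: eq_bigr => m _.
    rewrite hornerZ hornerXn; congr (_ * _).
    rewrite /enc -natrX expn_sum -[RHS]/((_ : nat)%:R) natr_prod.
    by apply: eq_bigr => i _; rewrite /x -natrX -expnM mulnC.
  apply: p0 => [i j /eqP|i]; last by rewrite ltr0n expn_gt0 (leq_trans _ t2).
  by rewrite eqr_nat eqn_exp2l// eqn_exp2l// => /eqP/val_inj.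
apply/mpolyP => m; rewrite mcoeff0; case: (boolP (m \in msupp p)) => [mp|/memN_msupp_eq0//].
have := congr1 (coefp (enc m)) q0; rewrite /= coef0 coef_sum (bigD1_seq m) ?msupp_uniq//=.
rewrite coefZ coefXn eqxx mulr1 big1_seq ?addr0// => m' /andP[m'm m'p].
rewrite coefZ coefXn; case: eqP => [e|_]; last by rewrite mulr0.
case/eqP: m'm; apply/mnmP => i; apply/esym; pose ex (m : multinom n) j := nth 0%N m j.
have small (k : multinom n) : k \in msupp p -> forall j, (j < n)%N -> (ex k j < N)%N.
  move=> kp j jn; rewrite -[j]/(val (Ordinal jn)) /ex -mnm_nth.
  apply: (@leq_ltn_trans (mdeg k)); last by rewrite (leq_trans (msize_mdeg_lt kp))// /N -addn2 leq_addr.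
  by rewrite mdegE (bigD1 (Ordinal jn))//= leq_addr.
have exE (k : multinom n) (j : 'I_n) : ex k j = k j by rewrite /ex -mnm_nth.
rewrite -!exE; apply: (digits_inj (small _ mp) (small _ m'p)) => //.
by move: e; rewrite /enc; under eq_bigr do rewrite -exE; under [RHS]eq_bigr do rewrite -exE.
Qed.

(** Both sides obey the Leibniz rule, so it suffices to check constants and variables. *)
Lemma mderiv_comp (R : comNzRingType) n k (t : n.-tuple (mpoly k R)) (p : mpoly n R) i :
  mderiv i (comp_mpoly t p) =
  \sum_(j < n) comp_mpoly t (mderiv j p) * mderiv i (tnth t j).
Proof.
pose D (p : mpoly n R) := mderiv i (comp_mpoly t p) =
  \sum_(j < n) comp_mpoly t (mderiv j p) * mderiv i (tnth t j).
have D1 (p1 p2 : mpoly n R) : D p1 -> D p2 -> D (p1 * p2).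
  rewrite /D => d1 d2; rewrite rmorphM mderivM d1 d2 mulr_suml mulr_sumr -big_split.
  by apply: eq_bigr => j _; rewrite mderivM rmorphD !rmorphM /=; ring.
have DC c : D (mpolyC n c).
  by rewrite /D comp_mpolyC mderivC big1// => j _; rewrite mderivC raddf0 mul0r.
have DX j : D (mpolyX R (mnm1 j)).
  rewrite /D comp_mpolyXU (bigD1 j)//= big1 ?addr0 => [|l lj].
    rewrite mderivX mnm1E eqxx scale1r (_ : mnm_sub _ _ = mnm0).
      by rewrite mpolyX0 rmorph1 mul1r -tnth_nth.
    by apply/mnmP => l; rewrite mnmBE mnm0E subnn.
  by rewrite mderivX mnm1E eq_sym (negbTE lj) scale0r rmorph0 mul0r.
have Dn j m : D (mpolyX R (mnm1 j) ^+ m).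
  by elim: m => [|m IH]; rewrite ?exprS; [rewrite expr0 -mpolyC1; exact: DC|exact: D1].
have DXm m : D (mpolyX R m).
  rewrite mpolyXE_id; apply: (big_ind D) => //; rewrite -mpolyC1; exact: DC.
rewrite -/(D p) [p]mpolyE; apply: (big_ind D).
- by rewrite /D !raddf0 big1// => j _; rewrite !raddf0 mul0r.
- move=> p1 p2; rewrite /D => d1 d2; rewrite !raddfD /= d1 d2 -big_split.
  by apply: eq_bigr => j _; rewrite !raddfD /= mulrDl.
- by move=> m _; rewrite -mul_mpolyC; exact: D1.
Qed.


Section DominatedSupport.
Variable R : comNzRingType.

(* For K j = kappa_1 + ... + kappa_j this says that the monomials of p are those
   of the monomial symmetric functions dominated by kappa. *)
Definition dom_supp n (K : nat -> nat) (p : mpoly n R) : Prop :=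
  forall m, m \in msupp p ->
    (forall J : {set 'I_n}, (\sum_(i in J) m i <= K #|J|)%N) /\
    (\sum_(i < n) m i = K n)%N.

Variable n : nat.
Implicit Types (p q : mpoly n R) (K : nat -> nat).

Lemma dom_supp0 K : dom_supp K (0 : mpoly n R).
Proof. by move=> m; rewrite mcoeff_msupp mcoeff0 eqxx. Qed.

Lemma dom_suppD K p q : dom_supp K p -> dom_supp K q -> dom_supp K (p + q).
Proof. by move=> Kp Kq m /msuppD_le; rewrite mem_cat => /orP[/Kp|/Kq]. Qed.

Lemma dom_suppZ K c p : dom_supp K p -> dom_supp K (c *: p).
Proof. by move=> Kp m /msuppZ_le/Kp. Qed.

Lemma dom_supp_sum (I : eqType) (r : seq I) (F : I -> mpoly n R) K :
  (forall i, i \in r -> dom_supp K (F i)) -> dom_supp K (\sum_(i <- r) F i).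
Proof.
by move=> KF; rewrite big_seq; apply: (big_ind (dom_supp K)) => //;
  [exact: dom_supp0|exact: dom_suppD].
Qed.

Lemma dom_suppM K L p q : dom_supp K p -> dom_supp L q ->
  dom_supp (fun j => K j + L j)%N (p * q).
Proof.
move=> Kp Lq m /msuppM_le/allpairsP[[m1 m2] /= [/Kp[J1 T1] /Lq[J2 T2] ->]]; split.
  by move=> J; under eq_bigr do rewrite mnmDE; rewrite big_split leq_add ?J1 ?J2.
by under eq_bigr do rewrite mnmDE; rewrite big_split /= T1 T2.
Qed.

Lemma dom_supp1 : dom_supp (fun=> 0%N) (1 : mpoly n R).
Proof.
move=> m; rewrite mcoeff_msupp mcoeff1; case: (m =P mnm0) => [-> _|]; last by rewrite eqxx.
by split=> [J|]; rewrite big1// => i _; rewrite mnm0E.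
Qed.

Lemma dom_suppX K p c : dom_supp K p -> dom_supp (fun j => c * K j)%N (p ^+ c).
Proof.
move=> Kp; elim: c => [|c IH]; first by rewrite expr0; exact: dom_supp1.
by rewrite exprS; exact: dom_suppM.
Qed.

Lemma dom_supp_prod k (F : 'I_k -> mpoly n R) (K : 'I_k -> nat -> nat) :
  (forall i, dom_supp (K i) (F i)) ->
  dom_supp (fun j => \sum_(i < k) K i j)%N (\prod_(i < k) F i).
Proof.
elim: k F K => [|k IH] F K KF.
  rewrite big_ord0 => m /dom_supp1[m1 m2].
  by split; [move=> J; rewrite big_ord0; exact: m1|rewrite big_ord0].
rewrite big_ord_recl => m /(dom_suppM (KF ord0) (IH _ _ (fun i => KF _)))[m1 m2].
by split=> [J|]; rewrite big_ord_recl; [exact: m1|exact: m2].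
Qed.

Lemma dom_supp_le K L p : (forall j, (j <= n)%N -> (K j <= L j)%N) -> K n = L n ->
  dom_supp K p -> dom_supp L p.
Proof.
move=> KL KLn Kp m /Kp[J1 T1]; split; last by rewrite T1.
move=> J; apply: leq_trans (J1 J) (KL _ _).
by rewrite -[leqRHS]card_ord max_card.
Qed.

(** [minn k] is the partial-sum function of the partition (1^k): e_k is square-free of degree k. *)
Lemma dom_supp_mesym k : (k <= n)%N -> dom_supp (minn k) (mesym n R k).
Proof.
move=> kn m; rewrite mem_msupp_mesym => /andP[/eqP mk /forallP m1]; split.
  move=> J; rewrite leq_min; apply/andP; split.
    by rewrite -mk mdegE [leqRHS](bigID (mem J))/= leq_addr.
  by rewrite -sum1_card leq_sum.
by rewrite -mdegE mk (minn_idPl kn).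
Qed.

(* The weights under which X_k stands for a polynomial of degree k + 1 that is
   linear in each variable. *)
Definition dom_weight K (p : mpoly n R) : Prop :=
  forall m, m \in msupp p ->
    (forall j, (j <= n)%N -> (\sum_(k < n) m k * minn k.+1 j <= K j)%N) /\
    (\sum_(k < n) m k * minn k.+1 n = K n)%N.

Lemma dom_supp_comp K p (t : n.-tuple (mpoly n R)) :
  (forall k : 'I_n, dom_supp (minn k.+1) (tnth t k)) -> dom_weight K p ->
  dom_supp K (comp_mpoly t p).
Proof.
move=> Kt Kp; rewrite comp_mpolyE; apply: dom_supp_sum => m /Kp[mK mKn].
apply/dom_suppZ/dom_supp_le; [exact: mK|exact: mKn|].
by apply: dom_supp_prod => i; exact: dom_suppX.
Qed.

End DominatedSupport.

Definition esyms n (R : comNzRingType) : n.-tuple (mpoly n R) :=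
  [tuple mesym n R i.+1 | i < n].

(** Boxes in the first j rows of the diagram with row lengths f, counted by columns: there are f k -
    f (k+1) columns of height k + 1, and each has min(k + 1, j) boxes in these rows. *)
Lemma sum_diff_min n (f : nat -> nat) j :
  (forall i, (i < n)%N -> (f i.+1 <= f i)%N) -> f n = 0%N -> (j <= n)%N ->
  (\sum_(k < n) (f k - f k.+1) * minn k.+1 j = \sum_(i < j) f i)%N.
Proof.
move=> fdec fn; have tail i : (i <= n)%N -> (\sum_(k < n) (f k - f k.+1) * (i <= k) + f n = f i)%N.
  elim: n fdec {fn} => [|n IH] fdec; first by rewrite leqn0 big_ord0 => /eqP ->.
  rewrite leq_eqVlt => /predU1P[->|].
    by rewrite big1 // => k _; rewrite leqNgt ltn_ord muln0.
  rewrite ltnS => le_in; rewrite big_ord_recr /= le_in muln1 -addnA subnK ?fdec//.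
  by apply: IH => // k kn; rewrite fdec// ltnW.
elim: j => [|j IH] jn; first by rewrite big_ord0 big1// => k _; rewrite minn0 muln0.
have jn' := ltnW jn; rewrite big_ord_recr /= -(IH jn') -[X in (_ + X)%N](tail j jn') fn addn0 -big_split /=.
by apply: eq_bigr => k _; rewrite -mulnDr; congr muln; rewrite /=; lia.
Qed.

(** Leading monomials multiply, and that of e_(k+1) is x_1 ... x_(k+1), so the exponents are again
    obtained by counting columns. *)
Lemma mlead_esym_mono n (R : idomainType) (m : multinom n) (f : nat -> nat) :
  (forall i : 'I_n, f i = m i) -> (forall i, (i < n)%N -> (f i.+1 <= f i)%N) -> f n = 0%N ->
  let p := \prod_(i < n) mesym n R i.+1 ^+ (f i - f i.+1) in
  mlead p = m /\ mcoeff m p = 1.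
Proof.
move=> fm fdec fn p.
have e0 (i : 'I_n) : mesym n R i.+1 != 0 by exact: mesym_neq0.
have E0 (i : 'I_n) : mesym n R i.+1 ^+ (f i - f i.+1) != 0 by rewrite expf_neq0.
have lm : mlead p = m.
  rewrite mlead_prod; last by move=> i _ _; exact: E0.
  apply/mnmP => j; rewrite mnm_sumE -fm.
  have -> : f j = (\sum_(i < j.+1) f i - \sum_(i < j) f i)%N by rewrite big_ord_recr /= addKn.
  rewrite -!(@sum_diff_min n)//; last exact: ltnW.
  rewrite -sumnB => [|k _]; last by rewrite leq_mul2l; apply/orP; right; lia.
  apply: eq_bigr => k _; rewrite mleadX// mulmnE mlead_mesym//.
  rewrite -mulnBr mulnC mnmE; congr muln; rewrite ltnS.
  by have := ltn_ord k; case: leqP; lia.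
split=> //; rewrite -lm mlead_prod => [|i _ _]; last exact: E0.
rewrite mleadc_prod; apply: big1 => i _.
by rewrite mleadX// mleadcX mleadc_mesym// expr1n.
Qed.

(** The fundamental theorem of symmetric polynomials with control of the support. The usual
    reduction subtracts a product of e_k with the same leading monomial; this product stays within
    the bounds [K] because the leading exponents of [p] do. The weight bound on F is what later
    allows e_k to be replaced by other polynomials of the same support type. *)
Lemma sym_dom_supp (n : nat) (R : idomainType) (K : nat -> nat) (p : mpoly n R) :
  symmetric_pred p -> dom_supp K p ->
  exists2 F, comp_mpoly (esyms n R) F = p & dom_weight K F.
Proof.
elim/mleadrect: p => p IH psym Kp.
have [-> |p0] := eqVneq p 0.
  by exists 0; [rewrite raddf0|move=> m; rewrite mcoeff_msupp mcoeff0 eqxx].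
pose m := mlead p; pose f i := nth 0%N m i.
have fm (i : 'I_n) : f i = m i by rewrite /f -mnm_nth.
have fn : f n = 0%N by rewrite /f nth_default// size_tuple.
have fdec i : (i < n)%N -> (f i.+1 <= f i)%N.
  move=> lt_in; have [jn|] := ltnP i.+1 n; last first.
    move=> ni; have -> : i.+1 = n by apply/eqP; rewrite eqn_leq lt_in ni.
    by rewrite fn.
  by have := mlead_msym_sorted psym (leqnSn (Ordinal lt_in) : (Ordinal lt_in <= Ordinal jn)%N); rewrite -!fm.
pose c : multinom n := Multinom [tuple (f i - f i.+1)%N | i < n].
have cE : comp_mpoly (esyms n R) (mpolyX R c) = \prod_(i < n) mesym n R i.+1 ^+ (f i - f i.+1).
  by rewrite comp_mpolyX; apply: eq_bigr => i _; rewrite tnth_mktuple mnmE.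
have [lm cm] := mlead_esym_mono R fm fdec fn; rewrite -cE in lm cm.
(* The weight of the new monomial at j is the sum of the first j leading exponents of [p], which
   [Kp] bounds on the index set {0, ..., j-1}. *)
have Kc : dom_weight K (mpolyX R c).
  move=> c'; rewrite msuppX inE => /eqP ->.
  have [Km Kmn] := Kp m (mlead_supp p0).
  have sumE j : (j <= n)%N -> (\sum_(k < n) c k * minn k.+1 j = \sum_(i < j) f i)%N.
    move=> jn; rewrite -(@sum_diff_min n)//.
    by apply: eq_bigr => i _; rewrite mnmE.
  split=> [j jn|]; last by rewrite sumE// -Kmn; apply: eq_bigr => i _.
  rewrite sumE//; have := Km [set i : 'I_n | (i < j)%N]%SET.
  have /eqP -> : #|[set i : 'I_n | (i < j)%N]%SET| == j.
    rewrite -sum1dep_card -(big_ord_widen _ (fun=> 1%N))// sum1_card card_ord//.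
  by rewrite (big_ord_widen _ f jn); under eq_bigl do rewrite inE; under eq_bigr do rewrite -fm.
pose q := p - mcoeff m p *: comp_mpoly (esyms n R) (mpolyX R c).
have [q0|qn0] := eqVneq q 0.
  exists (mcoeff m p *: mpolyX R c); first by rewrite comp_mpolyZ; apply/esym/eqP; rewrite -subr_eq0; apply/eqP.
  by move=> c' /msuppZ_le/Kc.
have lq : (mlead q < mlead p)%O.
  have /le_trans := mleadB_le p (mcoeff m p *: comp_mpoly (esyms n R) (mpolyX R c)).
  rewrite -/q mleadZ ?lm ?mleadc_eq0// joinxx => /(_ _ (lexx _)) le_q.
  rewrite lt_neqAle le_q andbT; apply: contraNneq qn0 => e.
  by rewrite -mleadc_eq0 e mcoeffB mcoeffZ cm mulr1 subrr.
have [||F FE KF] := IH q lq.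
- apply: rpredB => //; apply: rpredZ; apply: mcomp_sym => i.
  by rewrite -tnth_nth tnth_mktuple mesym_sym.
- apply: dom_suppD => //; rewrite -scaleNr; apply/dom_suppZ/dom_supp_comp => // k.
  by rewrite tnth_mktuple; exact: dom_supp_mesym.
exists (F + mcoeff m p *: mpolyX R c).
  by rewrite raddfD /= FE comp_mpolyZ subrK.
by move=> c' /msuppD_le; rewrite mem_cat => /orP[/KF|/msuppZ_le/Kc].
Qed.

(** * Generating functions of the elementary symmetric polynomials *)

Lemma mderiv_sum (K : nzRingType) n i I (r : seq I) (P : pred I) (F : I -> mpoly n K) :
  mderiv i (\sum_(j <- r | P j) F j) = \sum_(j <- r | P j) mderiv i (F j).
Proof. exact: raddf_sum. Qed.

Lemma meval_sum (K : comNzRingType) n (x : 'I_n -> K) I (r : seq I) (P : pred I) (F : I -> mpoly n K) :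
  meval x (\sum_(j <- r | P j) F j) = \sum_(j <- r | P j) meval x (F j).
Proof. exact: raddf_sum. Qed.

Definition linear_roots (K : comNzRingType) n (A : pred 'I_n) (y : K) : mpoly n K :=
  \prod_(i < n | A i) (mpolyC n y - mpolyX K (mnm1 i)).

Lemma meval_linear_roots (K : comNzRingType) n (A : pred 'I_n) (y : K) x :
  meval x (linear_roots A y) = \prod_(i < n | A i) (y - x i).
Proof.
by rewrite rmorph_prod; apply: eq_bigr => i _; rewrite raddfB /= mevalC mevalXU.
Qed.

Lemma mderiv_linear (K : comNzRingType) n (y : K) (i j : 'I_n) :
  mderiv i (mpolyC n y - mpolyX K (mnm1 j)) = - (i == j)%:R.
Proof.
rewrite raddfB /= mderivC sub0r mderivX mnm1E eq_sym.
case: eqVneq => [-> |_]; last by rewrite scale0r.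
rewrite scale1r (_ : mnm_sub _ _ = mnm0) ?mpolyX0//.
by apply/mnmP => l; rewrite mnmBE mnm0E subnn.
Qed.

Lemma mderiv_linear_roots (K : comNzRingType) n (A : pred 'I_n) (y : K) i :
  mderiv i (linear_roots A y) =
  if A i then - linear_roots [predD1 A & i] y else 0.
Proof.
have D0 (B : pred 'I_n) : ~~ B i -> mderiv i (linear_roots B y) = 0.
  move=> Bi; apply: (big_ind (fun p : mpoly n K => mderiv i p = 0)).
  - by rewrite -mpolyC1 mderivC.
  - by move=> p q p0 q0; rewrite mderivM p0 q0 mul0r mulr0 addr0.
  - by move=> j Bj; rewrite mderiv_linear (_ : i == j = false) ?oppr0//; apply: contraNF Bi => /eqP ->.
case: ifPn => Ai; last exact: D0.
rewrite {1}/linear_roots (bigD1 i)//= mderivM mderiv_linear eqxx mulN1r.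
rewrite (eq_bigl [predD1 A & i]) => [|j]; last by rewrite !inE andbC.
by rewrite -/(linear_roots _ y) D0 ?inE ?eqxx// mulr0 addr0.
Qed.

Section GeneratingFunction.
Variables (K : numFieldType) (n : nat).

(* The generating function of n numbers g 0, ..., g (n-1), with the signs and
   powers with which e_1, ..., e_n occur in -\prod_i (y - x_i). *)
Definition genf (g : 'I_n -> K) (y : K) : K :=
  \sum_(k < n) (-1) ^+ k * y ^+ (n - k.+1) * g k.

Definition genp (g : 'I_n -> K) : {poly K} :=
  \sum_(k < n) ((-1) ^+ k * g k) *: 'X^(n - k.+1).

Lemma horner_genp g y : (genp g).[y] = genf g y.
Proof.
rewrite horner_sum; apply: eq_bigr => k _.
by rewrite hornerZ hornerXn; ring.
Qed.

Lemma coef_genp g (k : 'I_n) : (genp g)`_(n - k.+1) = (-1) ^+ k * g k.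
Proof.
rewrite coef_sum (bigD1 k)//= coefZ coefXn eqxx mulr1 big1 ?addr0// => j jk.
rewrite coefZ coefXn; case: eqP; rewrite ?mulr0// => e; case/eqP: jk.
by apply: ord_inj; have := ltn_ord k; have := ltn_ord j; lia.
Qed.

Lemma genf_inj g h N : (forall t : nat, (N <= t)%N -> genf g t%:R = genf h t%:R) ->
  forall k, g k = h k.
Proof.
move=> gh k; have /eqP : genp g - genp h = 0.
  by apply: (@poly_vanish_nat _ _ N) => t /gh e; rewrite hornerD hornerN !horner_genp e subrr.
rewrite subr_eq0 => /eqP/(congr1 (coefp (n - k.+1))); rewrite /= !coef_genp => /(congr1 ( *%R ((-1) ^+ k))).
by rewrite !mulrA -exprMn mulrN1 opprK expr1n !mul1r.
Qed.

(** The diagonal s = t is left out because the identities tested in this way divide by the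
    difference of the two generating variables. *)
Lemma genf2_inj (g h : 'I_n -> 'I_n -> K) N :
  (forall s t : nat, (N <= s)%N -> (N <= t)%N -> s != t ->
    genf (fun k => genf (g k) t%:R) s%:R = genf (fun k => genf (h k) t%:R) s%:R) ->
  forall k l, g k l = h k l.
Proof.
move=> gh k; apply: (@genf_inj _ _ N) => t Nt; move: k.
apply: (@genf_inj _ _ (maxn N t.+1)) => s; rewrite geq_max => /andP[Ns ts].
by apply: gh => //; rewrite gtn_eqF.
Qed.

Lemma genfZ c g y : genf (fun k => c * g k) y = c * genf g y.
Proof. by rewrite /genf mulr_sumr; apply: eq_bigr => k _; ring. Qed.

Lemma genfD g h y : genf (fun k => g k + h k) y = genf g y + genf h y.
Proof. by rewrite /genf -big_split; apply: eq_bigr => k _; rewrite mulrDr. Qed.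

Lemma genf_sum I (r : seq I) (P : pred I) (g : I -> 'I_n -> K) y :
  genf (fun k => \sum_(i <- r | P i) g i k) y = \sum_(i <- r | P i) genf (g i) y.
Proof. by rewrite /genf exchange_big; apply: eq_bigr => k _; rewrite mulr_sumr. Qed.

Lemma eq_genf g h y : g =1 h -> genf g y = genf h y.
Proof. by move=> gh; apply: eq_bigr => k _; rewrite gh. Qed.

Definition mgenf (t : n.-tuple (mpoly n K)) (y : K) : mpoly n K :=
  \sum_(k < n) ((-1) ^+ k * y ^+ (n - k.+1)) *: tnth t k.

Lemma linear_mgenf (f : {linear mpoly n K -> K | *%R}) t y :
  f (mgenf t y) = genf (fun k => f (tnth t k)) y.
Proof. by rewrite linear_sum; apply: eq_bigr => k _; rewrite linearZ. Qed.

Lemma mderiv_mgenf i t y : mderiv i (mgenf t y) = mgenf [tuple mderiv i (tnth t k) | k < n] y.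
Proof. by rewrite [LHS]raddf_sum; apply: eq_bigr => k _; rewrite /= mderivZ tnth_mktuple. Qed.

(** Vieta's formula; subtracting from y^n drops e_0 and keeps exactly e_1, ..., e_n, the variables
    of F. *)
Lemma mgenf_esyms y : mgenf (esyms n K) y = mpolyC n (y ^+ n) - linear_roots xpredT y.
Proof.
have -> : linear_roots xpredT y = \sum_(k < n.+1) ((-1) ^+ k * y ^+ (n - k)) *: mesym n K k.
  apply/eqP; rewrite -subr_eq0; apply/eqP/mpoly_vanish_generic => x _ _.
  apply/eqP; rewrite raddfB /= subr_eq0 meval_linear_roots raddf_sum /=.
  pose q := \prod_(c <- [tuple x i | i < n]) ('X - c%:P).
  have qy : q.[y] = \prod_(i < n) (y - x i).
    rewrite /q big_tuple horner_prod; apply: eq_bigr => i _.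
    by rewrite hornerXsubC tnth_mktuple.
  rewrite -qy (@horner_coef_wide _ n.+1) ?size_prod_XsubC ?size_tuple//.
  apply/eqP; rewrite [LHS](reindex_inj rev_ord_inj) /=; apply: eq_bigr => k _.
  rewrite mevalZ subSS (mroots_coeff [tuple x i | i < n] k) mulrAC; congr (_ * _).
  by apply: meval_eq => i; rewrite tnth_mktuple.
rewrite big_ord_recl /= expr0 mul1r subn0 mesym0E opprD addrA -mul_mpolyC mulr1 subrr add0r.
rewrite /mgenf -sumrN; apply: eq_bigr => k _.
by rewrite tnth_mktuple -scaleNr /bump /= exprS; congr (_ *: _); ring.
Qed.

Lemma genf_esyms_roots (mu : 'I_n -> K) y :
  genf (fun k => meval mu (mesym n K k.+1)) y = y ^+ n - \prod_(i < n) (y - mu i).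
Proof.
rewrite -(meval_linear_roots xpredT) -(mevalC mu (y ^+ n)) -mevalB -mgenf_esyms.
by rewrite linear_mgenf; apply: eq_genf => k; rewrite tnth_mktuple.
Qed.

(** The k-th entry is e_(k+1) in the variables other than x_j; averaging over j with the weights w_j
    gives the coefficients of the projected matrix. *)
Definition deriv_esyms (j : 'I_n) : n.-tuple (mpoly n K) :=
  [tuple mderiv j (mesym n K k.+2) | k < n].

(** Omitting x_j from e_1, ..., e_n amounts to setting x_j = 0, so the factor y - x_j is replaced by
    y. *)
Lemma mgenf_deriv_esyms j y :
  mgenf (deriv_esyms j) y = mpolyC n (y ^+ n) - y *: linear_roots (predC1 j) y.
Proof.
have := congr1 (mderiv j) (mgenf_esyms y); rewrite mderiv_mgenf raddfB /= mderivC sub0r.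
rewrite mderiv_linear_roots opprK.
have -> : linear_roots [predD1 xpredT & j] y = linear_roots (predC1 j) y.
  by apply: eq_bigl => i; rewrite !inE andbT.
(* Up to sign, shifting k by one in [h] leads from y times the j-th derivative of the generating
   function of e_1, ..., e_n to that of [deriv_esyms]. The boundary terms come from d_j e_1 = 1 and
   e_(n+1) = 0. *)
move=> <-; pose h k : mpoly n K := ((-1) ^+ k * y ^+ (n - k)) *: mderiv j (mesym n K k.+1).
have -> : y *: mgenf [tuple mderiv j (tnth (esyms n K) k) | k < n] y = \sum_(k < n) h k.
  rewrite /mgenf scaler_sumr; apply: eq_bigr => k _; rewrite !tnth_mktuple scalerA.
  by congr (_ *: _); rewrite mulrCA -exprS subnSK.
have -> : mgenf (deriv_esyms j) y = - \sum_(k < n) h k.+1.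
  rewrite /mgenf -sumrN; apply: eq_bigr => k _; rewrite !tnth_mktuple -scaleNr /h.
  by rewrite exprS; congr (_ *: _); ring.
have hn : h n = 0 by rewrite /h mesym_geqnE// raddf0 scaler0.
have h0 : h 0%N = mpolyC n (y ^+ n).
  rewrite /h expr0 mul1r subn0 mesym1E (raddf_sum (mderiv j)) /= (bigD1 j)//= big1 => [|i ij].
    rewrite mderivX mnm1E eqxx scale1r addr0 -mul_mpolyC (_ : mnm_sub _ _ = mnm0) ?mpolyX0 ?mulr1//.
    by apply/mnmP => l; rewrite mnmBE mnm0E subnn.
  by rewrite mderivX mnm1E (negbTE ij) scale0r.
have e : \sum_(k < n.+1) h k = \sum_(k < n) h k + h n := big_ord_recr _ _.
rewrite big_ord_recl /= hn addr0 h0 in e; rewrite -e opprD addrA subrr add0r.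
by congr (- _); apply: eq_bigr.
Qed.

Lemma mgenf_deriv2_esyms i j y :
  mgenf [tuple mderiv i (tnth (deriv_esyms j) k) | k < n] y =
  if i == j then 0 else y *: linear_roots [predD1 (predC1 j) & i] y.
Proof.
rewrite -mderiv_mgenf mgenf_deriv_esyms raddfB /= mderivC sub0r mderivZ mderiv_linear_roots inE.
by case: eqVneq => _ /=; rewrite ?scaler0 ?oppr0// scalerN opprK.
Qed.

Section AtPoint.
Variables (x : 'I_n -> K) (y : K).
Hypothesis yx : forall i, y - x i != 0.
Let u i := (y - x i)^-1.
Let Lam := \prod_(i < n) (y - x i).

Lemma prod_predC1 j : \prod_(i < n | i != j) (y - x i) = Lam * u j.
Proof. by rewrite /Lam [in RHS](bigD1 j)//= mulrAC mulfV ?mul1r. Qed.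

Lemma genf_deriv_esyms j :
  genf (fun k => meval x (tnth (deriv_esyms j) k)) y = y ^+ n - y * (Lam * u j).
Proof.
rewrite -(linear_mgenf (meval x)) mgenf_deriv_esyms raddfB /= mevalC mevalZ.
by rewrite meval_linear_roots /= prod_predC1.
Qed.

Lemma genf_deriv2_esyms i j :
  genf (fun k => meval x (mderiv i (tnth (deriv_esyms j) k))) y =
  (i != j)%:R * (y * (Lam * u i * u j)).
Proof.
transitivity (meval x (mgenf [tuple mderiv i (tnth (deriv_esyms j) k) | k < n] y)).
  by rewrite linear_mgenf; apply: eq_genf => k; rewrite !tnth_mktuple.
rewrite mgenf_deriv2_esyms; case: eqVneq => ij; rewrite ?raddf0 ?mul0r// mul1r mevalZ.
congr (_ * _); rewrite meval_linear_roots.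
rewrite mulrAC -prod_predC1 [in RHS](bigD1 i)//= mulrAC mulfV// mul1r.
by apply: eq_bigl => l; rewrite !inE andbC.
Qed.

Lemma genf_deriv_esym i :
  genf (fun k => meval x (mderiv i (mesym n K k.+1))) y = Lam * u i.
Proof.
transitivity (meval x (mderiv i (mgenf (esyms n K) y))).
  rewrite mderiv_mgenf linear_mgenf.
  by apply: eq_genf => k; rewrite !tnth_mktuple.
rewrite mgenf_esyms raddfB /= mderivC sub0r mderiv_linear_roots opprK meval_linear_roots.
by rewrite -prod_predC1; apply: eq_bigl => l; rewrite !inE andbT.
Qed.

End AtPoint.
End GeneratingFunction.

Lemma mderiv2_mesym_diag (K : numFieldType) n i k : mderiv i (mderiv i (mesym n K k)) = 0.
Proof.
apply/mpolyP => m; rewrite !mcoeff_deriv mcoeff_mesym mcoeff0.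
have -> : mechar k (mnm_add (mnm_add m (mnm1 i)) (mnm1 i)) = false.
  apply/negP => /andP[_ /forallP/(_ i)]; rewrite !mnmDE mnm1E eqxx; lia.
by rewrite !mul0rn.
Qed.

(** * The Jack operator on elementary symmetric polynomials *)

(** Each x_i equals at most one natural number. The argument also covers points of R[i], whose sizes
    cannot be compared by the order. *)
Lemma nat_avoid (K : numDomainType) n (x : 'I_n -> K) :
  exists N, forall t : nat, (N <= t)%N -> forall i, t%:R - x i != 0.
Proof.
have /choice[f fP] (i : 'I_n) : exists N, forall t : nat, (N <= t)%N -> t%:R - x i != 0.
  have [[s sx]|nx] := pselect (exists s : nat, s%:R = x i); last first.
    by exists 0%N => t _; rewrite subr_eq0; apply/eqP => tx; apply: nx; exists t.
  by exists s.+1 => t st; rewrite -sx subr_eq0 eqr_nat gtn_eqF.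
exists (\max_i f i) => t ft i; apply: fP; exact: leq_trans (leq_bigmax i) ft.
Qed.

Section LogDerivative.
Variables (K : fieldType) (I : Type) (r : seq I) (A : pred I) (x : I -> K) (y : K).
Hypothesis yx : forall i, y - x i != 0.
Let u i := (y - x i)^-1.
Let Q := \prod_(i <- r | A i) ('X - (x i)%:P).

Let deriv_prod : Q^`().[y] = Q.[y] * \sum_(i <- r | A i) u i /\
  Q^`()^`().[y] = Q.[y] * ((\sum_(i <- r | A i) u i) ^+ 2 - \sum_(i <- r | A i) u i ^+ 2).
Proof.
rewrite /Q; apply: (big_rec3 (fun (p : {poly K}) s s2 => p^`().[y] = p.[y] * s /\
  p^`()^`().[y] = p.[y] * (s ^+ 2 - s2))).
  by rewrite -[1]/(1%:P) derivC deriv0 !hornerE; split; ring.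
move=> i p s s2 _ [p1 p2]; rewrite !derivM derivXsubC mul1r derivD derivM derivXsubC mul1r.
rewrite !hornerD !hornerM !hornerXsubC p1 p2 /u; have := yx i; set d := y - x i => d0.
by split; field.
Qed.

Lemma horner_deriv_prod : Q^`().[y] = Q.[y] * \sum_(i <- r | A i) u i.
Proof. by case: deriv_prod. Qed.

Lemma horner_deriv2_prod : Q^`()^`().[y] =
  Q.[y] * ((\sum_(i <- r | A i) u i) ^+ 2 - \sum_(i <- r | A i) u i ^+ 2).
Proof. by case: deriv_prod. Qed.

End LogDerivative.

Section DoubleSum.
Variables (K : numFieldType) (n : nat) (A : pred 'I_n).

Lemma sum_offdiag (u : 'I_n -> K) :
  \sum_(i < n | A i) \sum_(j < n | A j && (j != i)) u i * u j =
  (\sum_(i < n | A i) u i) ^+ 2 - \sum_(i < n | A i) u i ^+ 2.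
Proof.
rewrite expr2 mulr_suml -sumrB; apply: eq_bigr => i Ai.
by rewrite mulr_sumr [in RHS](bigD1 i)//= addrAC -expr2 subrr add0r.
Qed.

Lemma sum_offdiag1 :
  \sum_(i < n | A i) \sum_(j < n | A j && (j != i)) (1 : K) = #|A|%:R * (#|A|%:R - 1).
Proof.
have := sum_offdiag (fun=> 1); under eq_bigr do under eq_bigr do rewrite mulr1.
by move=> ->; rewrite expr1n sumr_const; ring.
Qed.

Lemma exchange_offdiag (f : 'I_n -> 'I_n -> K) :
  \sum_(i < n | A i) \sum_(j < n | A j && (j != i)) f i j =
  \sum_(i < n | A i) \sum_(j < n | A j && (j != i)) f j i.
Proof.
rewrite (exchange_big_dep A) /= => [|i j _ /andP[]//].
apply: eq_bigr => i Ai; apply: eq_bigl => j; rewrite Ai /=.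
by rewrite eq_sym.
Qed.

(** The terms (i, j) and (j, i) add up to y^2 / ((y - x_i) (y - x_j)) - 1: symmetrizing removes the
    poles x_i = x_j. *)
Lemma sum_repulsion (x : 'I_n -> K) y : injective x -> (forall i, y - x i != 0) ->
  2 * (\sum_(i < n | A i) \sum_(j < n | A j && (j != i)) x i ^+ 2 / (x i - x j) * (y - x i)^-1) =
  y ^+ 2 * ((\sum_(i < n | A i) (y - x i)^-1) ^+ 2 - \sum_(i < n | A i) (y - x i)^-1 ^+ 2)
  - #|A|%:R * (#|A|%:R - 1).
Proof.
move=> xinj yx; rewrite -sum_offdiag -sum_offdiag1 mulr_natl mulr2n [X in _ + X]exchange_offdiag.
rewrite -big_split /= mulr_sumr -sumrB; apply: eq_bigr => i Ai.
rewrite -big_split /= mulr_sumr -sumrB; apply: eq_bigr => j /andP[Aj ji].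
have xij : x i - x j != 0 by rewrite subr_eq0; apply: contraNneq ji => /xinj ->.
have xji : x j - x i != 0 by rewrite -opprB oppr_eq0.
field; rewrite xij xji ?yx//.
Qed.

End DoubleSum.

Section Eigen.
Variables (R : realType) (beta : R) (n : nat).
Local Notation mp := (mpoly n R).

Definition jack_at (x : 'I_n -> R) (p : mp) : R := jack_op beta p x.

Lemma jack_at_is_linear (x : 'I_n -> R) : linear_for *%R (jack_at x).
Proof.
move=> c p q; rewrite /jack_at /jack_op.
under eq_bigr do rewrite !linearP /= mulrDr mulrCA.
under [X in beta * X]eq_bigr do under eq_bigr do rewrite !linearP /= mulrDr mulrCA.
under [X in beta * X]eq_bigr do rewrite big_split /= -mulr_sumr.
by rewrite !big_split /= -!mulr_sumr; ring.
Qed.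

HB.instance Definition _ (x : 'I_n -> R) :=
  GRing.isLinear.Build R mp R *%R (jack_at x) (jack_at_is_linear x).

(** With r = k + 1 this is beta (r (n - 1) - r (r - 1) / 2), the Jack eigenvalue of (1^r). It is
    written with d = n - r because d (d - 1) is the eigenvalue of y^2 d^2/dy^2 on y^d, the power of
    y that accompanies e_r in [genf]. *)
Definition esym_eigen (k : 'I_n) : R :=
  beta / 2 * (n%:R * (n%:R - 1) - (n - k.+1)%:R * ((n - k.+1)%:R - 1)).

Lemma horner_deriv2Xn (d : nat) (y : R) :
  y ^+ 2 * ('X^d)^`()^`().[y] = d%:R * (d%:R - 1) * y ^+ d.
Proof.
case: d => [|[|d]].
- by rewrite expr0 -[1]/(1%:P) derivC deriv0 !hornerE; ring.
- by rewrite expr1 derivX -[1]/(1%:P) derivC !hornerE; ring.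
rewrite derivXn /= derivMn derivXn /= !hornerMn hornerXn -[(y ^+ d *+ d.+1) *+ d.+2]mulr_natl -[y ^+ d *+ d.+1]mulr_natl.
by rewrite -[d.+2%:R in LHS](natr1 d.+1) -[d.+2%:R in RHS](natr1 d.+1) !exprS; ring.
Qed.

Lemma genf_esym_eigen (g : 'I_n -> R) y :
  genf (fun k => esym_eigen k * g k) y =
  beta / 2 * (n%:R * (n%:R - 1) * genf g y - y ^+ 2 * (genp g)^`()^`().[y]).
Proof.
rewrite /genp !raddf_sum /= horner_sum /genf !mulr_sumr -sumrB mulr_sumr.
apply: eq_bigr => k _; rewrite !derivZ !hornerZ /esym_eigen.
have := horner_deriv2Xn (n - k.+1) y; set X2 := _.[y]; set d := (n - k.+1)%:R => e.
rewrite [y ^+ 2 * _]mulrCA e; ring.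
Qed.

(** A product of distinct linear factors has no second derivative in a single variable, so only the
    drift remains. *)
Lemma jack_at_linear_roots (A : pred 'I_n) (x : 'I_n -> R) y :
  jack_at x (linear_roots A y) =
  - beta * \sum_(i < n | A i) (\sum_(j < n | j != i) x i ^+ 2 / (x i - x j)) *
    meval x (linear_roots [predD1 A & i] y).
Proof.
rewrite /jack_at /jack_op big1 => [|i _]; last first.
  rewrite mderiv_linear_roots; case: ifP => _; last by rewrite !raddf0 mulr0.
  by rewrite raddfN /= mderiv_linear_roots inE eqxx oppr0 raddf0 mulr0.
rewrite add0r mulNr -mulrN -sumrN [in RHS]big_mkcond; congr (_ * _); apply: eq_bigr => i _.
rewrite -mulr_suml mderiv_linear_roots; case: ifP => _; last by rewrite raddf0 mulr0.
by rewrite raddfN /= mulrN.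
Qed.

(** On the generating function, [sum_repulsion] turns the drift into y^2 Q'' and a multiple of Q,
    and these act on the powers of y through [esym_eigen]. *)
Lemma jack_at_mesym (x : 'I_n -> R) (k : 'I_n) : injective x ->
  jack_at x (mesym n R k.+1) = esym_eigen k * meval x (mesym n R k.+1).
Proof.
move=> xinj; have [N NP] := nat_avoid x; move: k.
apply: (@genf_inj _ _ _ _ N) => t /NP; set y : R := t%:R => yx.
rewrite genf_esym_eigen; set g := fun k : 'I_n => meval x (mesym n R k.+1).
pose Q : {poly R} := \prod_(i < n) ('X - (x i)%:P); pose u i := (y - x i)^-1.
have Qy z : Q.[z] = \prod_(i < n) (z - x i).
  by rewrite horner_prod; apply: eq_bigr => i _; rewrite hornerXsubC.
have gE : genp g = 'X^n - Q.
  apply/eqP; rewrite -subr_eq0; apply/eqP/(@poly_vanish_nat _ _ 0) => s _.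
  by rewrite hornerD hornerN horner_genp genf_esyms_roots hornerD hornerN hornerXn Qy subrr.
have -> : genf (fun k : 'I_n => jack_at x (mesym n R k.+1)) y =
    jack_at x (mgenf (esyms n R) y).
  rewrite (linear_mgenf (jack_at x)).
  by apply: eq_genf => k; rewrite tnth_mktuple.
rewrite mgenf_esyms linearB /= (_ : jack_at x (mpolyC n _) = 0); last first.
  rewrite /jack_at /jack_op big1 ?big1 ?mulr0 ?addr0// => i _; first by rewrite big1// => j _; rewrite mderivC raddf0 mulr0.
  by rewrite mderivC !raddf0 mulr0.
have D2 : y ^+ 2 * (genp g)^`()^`().[y] =
    n%:R * (n%:R - 1) * y ^+ n - y ^+ 2 * Q^`()^`().[y].
  by rewrite gE !derivB hornerD hornerN mulrBr horner_deriv2Xn.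
have D0 : genf g y = y ^+ n - Q.[y] by rewrite -horner_genp gE hornerD hornerN hornerXn.
rewrite D2 D0 (horner_deriv2_prod _ _ yx) jack_at_linear_roots.
have -> : \sum_(i < n | xpredT i) (\sum_(j < n | j != i) x i ^+ 2 / (x i - x j)) *
    meval x (linear_roots [predD1 xpredT & i] y) =
    Q.[y] * \sum_(i < n) \sum_(j < n | j != i) x i ^+ 2 / (x i - x j) * u i.
  rewrite mulr_sumr; apply: eq_bigr => i _.
  rewrite meval_linear_roots -mulr_suml mulrCA; congr (_ * _).
  rewrite Qy -(prod_predC1 yx).
  by apply: eq_bigl => j; rewrite !inE andbT.
have := sum_repulsion xpredT xinj yx; rewrite card_ord /= => e.
have {}e : \sum_(i < n) \sum_(j < n | j != i) x i ^+ 2 / (x i - x j) * u i =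
   2^-1 * (2 * \sum_(i < n) \sum_(j < n | j != i) x i ^+ 2 / (x i - x j) * u i).
  by rewrite mulrA mulVf ?mul1r ?pnatr_eq0.
rewrite e sum_repulsion// -/Q (_ : #|xpredT| = n); first by field.
by rewrite -[RHS](card_ord n); apply: eq_card.
Qed.

(** The polynomial is free of x_j but the operator is not. The other n - 1 variables reproduce the
    eigenvalue, while their interaction with x_j leaves the sum on the right. This excess is what
    the integration by parts in w has to cancel. *)
Lemma jack_at_deriv_esyms (x : 'I_n -> R) (j k : 'I_n) : injective x ->
  jack_at x (tnth (deriv_esyms R j) k) =
  esym_eigen k * meval x (tnth (deriv_esyms R j) k) +
  beta * \sum_(i < n | i != j) x i * x j / (x i - x j) *
    meval x (mderiv i (tnth (deriv_esyms R j) k)).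
Proof.
move=> xinj; have [N NP] := nat_avoid x; move: k.
apply: (@genf_inj _ _ _ _ N) => t /NP; set y : R := t%:R => yx.
set g := fun k : 'I_n => meval x (tnth (deriv_esyms R j) k).
rewrite [RHS]genfD (genf_esym_eigen g) genfZ genf_sum.
pose Q : {poly R} := \prod_(i < n | i != j) ('X - (x i)%:P); pose u i := (y - x i)^-1.
pose Lam := \prod_(i < n) (y - x i).
have Qy z : Q.[z] = \prod_(i < n | i != j) (z - x i).
  by rewrite horner_prod; apply: eq_bigr => i _; rewrite hornerXsubC.
have gE : genp g = 'X^n - 'X * Q.
  apply/eqP; rewrite -subr_eq0; apply/eqP/(@poly_vanish_nat _ _ N) => s /NP sx.
  rewrite hornerD hornerN horner_genp genf_deriv_esyms// -prod_predC1//.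
  by rewrite hornerD hornerN hornerM hornerX hornerXn Qy subrr.
have -> : genf (fun k : 'I_n => jack_at x (tnth (deriv_esyms R j) k)) y =
    jack_at x (mgenf (deriv_esyms R j) y).
  by rewrite (linear_mgenf (jack_at x)).
rewrite mgenf_deriv_esyms linearB /= (_ : jack_at x (mpolyC n _) = 0); last first.
  rewrite /jack_at /jack_op big1 ?big1 ?mulr0 ?addr0// => i _; first by rewrite big1// => l _; rewrite mderivC raddf0 mulr0.
  by rewrite mderivC !raddf0 mulr0.
have D2 : y ^+ 2 * (genp g)^`()^`().[y] =
    n%:R * (n%:R - 1) * y ^+ n - y ^+ 2 * (2 * Q^`().[y] + y * Q^`()^`().[y]).
  rewrite gE !derivB hornerD hornerN mulrBr horner_deriv2Xn; congr (_ - _).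
  by rewrite derivM derivX mul1r derivD derivM derivX mul1r !hornerD hornerM hornerX; ring.
have D0 : genf g y = y ^+ n - y * Q.[y].
  by rewrite -horner_genp gE hornerD hornerN hornerXn hornerM hornerX.
have QE : Q.[y] = Lam * u j by rewrite Qy prod_predC1.
rewrite D2 D0 (horner_deriv2_prod _ _ yx) (horner_deriv_prod _ _ yx) QE linearZ /= jack_at_linear_roots.
have -> : \sum_(i < n | predC1 j i) (\sum_(l < n | l != i) x i ^+ 2 / (x i - x l)) *
    meval x (linear_roots [predD1 predC1 j & i] y) =
    Lam * u j * \sum_(i < n | i != j) (\sum_(l < n | l != i) x i ^+ 2 / (x i - x l)) * u i.
  rewrite mulr_sumr; apply: eq_bigr => i ij.
  rewrite meval_linear_roots mulrCA; congr (_ * _).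
  rewrite -QE Qy [in RHS](bigD1 i)//= mulrAC mulfV// mul1r.
  by apply: eq_bigl => l; rewrite !inE andbC.
(* The interaction with x_j is separated; the pairs among the other variables can then be
   symmetrized. *)
have -> : \sum_(i < n | i != j) (\sum_(l < n | l != i) x i ^+ 2 / (x i - x l)) * u i =
   \sum_(i < n | i != j) x i ^+ 2 / (x i - x j) * u i +
   2^-1 * (2 * \sum_(i < n | i != j) \sum_(l < n | (l != j) && (l != i)) x i ^+ 2 / (x i - x l) * u i).
  rewrite mulrA mulVf ?pnatr_eq0// mul1r -big_split; apply: eq_bigr => i ij /=.
  rewrite (bigD1 j) 1?eq_sym//= mulrDl mulr_suml; congr (_ + _).
  by apply: eq_bigl => l; rewrite andbC.
rewrite (sum_repulsion (predC1 j) xinj yx).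
have -> : \sum_(i < n | i != j) genf (fun k => x i * x j / (x i - x j) * meval x (mderiv i (tnth (deriv_esyms R j) k))) y =
  y * Lam * u j * \sum_(i < n | i != j) x i * x j / (x i - x j) * u i.
  rewrite mulr_sumr; apply: eq_bigr => i ij.
  by rewrite genfZ genf_deriv2_esyms// ij mul1r -/Lam -/(u i) -/(u j); ring.
have n1 : n.-1%:R = n%:R - 1 :> R.
  by rewrite -[in RHS](prednK (leq_ltn_trans (leq0n _) (ltn_ord j))) -natr1 addrK.
rewrite cardC1 card_ord n1.
(* x_i^2 / (x_i - x_j) = x_i x_j / (x_i - x_j) + x_i, and x_i u_i = y u_i - 1. *)
have -> : \sum_(i < n | i != j) x i ^+ 2 / (x i - x j) * u i =
  \sum_(i < n | i != j) x i * x j / (x i - x j) * u i + y * \sum_(i < n | i != j) u i - (n%:R - 1).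
  have -> : n%:R - 1 = \sum_(i < n | i != j) (1 : R).
    by rewrite sumr_const cardC1 card_ord.
  rewrite mulr_sumr -big_split -sumrB; apply: eq_bigr => i ij /=.
  have xij : x i - x j != 0 by rewrite subr_eq0; apply: contraNneq ij => /xinj ->.
  by rewrite /u; field; rewrite xij yx.
by field.
Qed.

End Eigen.

(** * The squared gradient of the projected symmetric functions *)

Section SquaredGradient.
Variables (K : numFieldType) (n : nat) (lam w mu : 'I_n -> K).

Lemma genf2_sum (c : 'I_n -> K) (a b : 'I_n -> 'I_n -> K) (A : pred 'I_n) y z :
  genf (fun k => genf (fun l => \sum_(i < n | A i) c i * a i k * b i l) z) y =
  \sum_(i < n | A i) c i * genf (a i) y * genf (b i) z.
Proof.
transitivity (genf (fun k => \sum_(i < n | A i) (c i * genf (b i) z) * a i k) y).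
  by apply: eq_genf => k; rewrite genf_sum; apply: eq_bigr => i _; rewrite genfZ mulrAC.
by rewrite genf_sum; apply: eq_bigr => i _; rewrite genfZ; ring.
Qed.

Lemma genfN (g : 'I_n -> K) y : genf (fun k => - g k) y = - genf g y.
Proof. by rewrite -mulN1r -genfZ; apply: eq_genf => k; rewrite mulN1r. Qed.

Lemma genfB (g h : 'I_n -> K) y : genf (fun k => g k - h k) y = genf g y - genf h y.
Proof. by rewrite genfD genfN. Qed.

(* mu lists the roots of z |-> z * \sum_j w_j \prod_(i <> j) (z - lam_i). *)
Hypothesis mu_lam : forall z,
  \prod_(i < n) (z - mu i) = z * \sum_(j < n) w j * \prod_(i < n | i != j) (z - lam i).

Definition deriv_eps (i k : 'I_n) : K :=
  \sum_(j < n) w j * meval lam (mderiv i (tnth (deriv_esyms K j) k)).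

(** The second-order part of the Jack operator pairs gradients with the weights x_i^2. From the
    variables lam to the roots mu this pairing is preserved up to an error that is off-diagonal and
    quadratic in w. In generating variables y and z, the sums over mu are eliminated through Q'/Q
    and those over lam through partial fractions, and a rational identity in a few one-variable sums
    remains. *)
Lemma squared_gradient_esyms (k l : 'I_n) :
  \sum_(i < n) lam i ^+ 2 * deriv_eps i k * deriv_eps i l -
  \sum_(i < n) mu i ^+ 2 * meval mu (mderiv i (mesym n K k.+1)) *
                           meval mu (mderiv i (mesym n K l.+1)) =
  - \sum_(i < n) \sum_(j < n | j != i) w i * w j * lam i * lam j *
      meval lam (mderiv i (tnth (deriv_esyms K j) k)) *
      meval lam (mderiv i (tnth (deriv_esyms K j) l)).
Proof.
have [N1 NP1] := nat_avoid lam; have [N2 NP2] := nat_avoid mu.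
move: k l; apply: (@genf2_inj _ _ _ _ (maxn 1 (maxn N1 N2))) => s t.
rewrite !geq_max => /andP[s0 /andP[/NP1 ys /NP2 ys']] /andP[t0 /andP[/NP1 zs /NP2 zs']] st.
set y : K := s%:R in ys ys' *; set z : K := t%:R in zs zs' *.
have yz : y - z != 0 by rewrite subr_eq0 eqr_nat.
have zy : z - y != 0 by rewrite -opprB oppr_eq0.
have y0 : y != 0 by rewrite pnatr_eq0 -lt0n.
have z0 : z != 0 by rewrite pnatr_eq0 -lt0n.
pose u i := (y - lam i)^-1; pose v i := (z - lam i)^-1.
pose L := \prod_(i < n) (y - lam i); pose M := \prod_(i < n) (z - lam i).
transitivity (genf (fun k => genf (fun l => \sum_(i < n) lam i ^+ 2 * deriv_eps i k * deriv_eps i l) z) y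
  - genf (fun k : 'I_n => genf (fun l : 'I_n => \sum_(i < n) mu i ^+ 2 * meval mu (mderiv i (mesym n K k.+1)) *
                           meval mu (mderiv i (mesym n K l.+1))) z) y).
  by rewrite -genfB; apply: eq_genf => k; rewrite -genfB.
rewrite (genf2_sum (fun i => lam i ^+ 2) deriv_eps deriv_eps xpredT).
pose dmu i (k : 'I_n) := meval mu (mderiv i (mesym n K k.+1)).
rewrite (genf2_sum (fun i => mu i ^+ 2) dmu dmu xpredT) /dmu.
transitivity (- \sum_(j < n) \sum_(i < n | i != j) w j * w i * lam j * lam i *
    (y * (L * u j * u i)) * (z * (M * v j * v i))); last first.
  transitivity (genf (fun k => - genf (fun l => \sum_(i < n) \sum_(j < n | j != i) w i * w j * lam i * lam j *
      meval lam (mderiv i (tnth (deriv_esyms K j) k)) *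
      meval lam (mderiv i (tnth (deriv_esyms K j) l))) z) y); last first.
    by apply: eq_genf => k; rewrite -genfN.
  rewrite genfN; congr (- _).
  transitivity (\sum_(i < n) genf (fun k => genf (fun l => \sum_(j < n | j != i) w i * w j * lam i * lam j *
      meval lam (mderiv i (tnth (deriv_esyms K j) k)) *
      meval lam (mderiv i (tnth (deriv_esyms K j) l))) z) y); last first.
    by rewrite -genf_sum; apply: eq_genf => k; rewrite -genf_sum.
  apply: eq_bigr => i _.
  rewrite genf2_sum; apply: eq_bigr => j ji.
  by rewrite !genf_deriv2_esyms// [i == j]eq_sym ji !mul1r.
pose S := \sum_(j < n) w j * u j; pose S' := \sum_(j < n) w j * v j.
pose S2 := \sum_(j < n) w j * u j ^+ 2; pose S2' := \sum_(j < n) w j * v j ^+ 2.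
pose sg := \sum_(j < n) u j; pose tau := \sum_(j < n) v j.
(* The term j = i drops out because the j-th tuple [deriv_esyms] is free of x_j. *)
have eps_gen i x0 : (forall i, x0 - lam i != 0) -> 
   genf (deriv_eps i) x0 = x0 * (\prod_(i < n) (x0 - lam i)) * (x0 - lam i)^-1 *
     (\sum_j w j * (x0 - lam j)^-1 - w i * (x0 - lam i)^-1).
  move=> x0P; have -> : \sum_j w j * (x0 - lam j)^-1 - w i * (x0 - lam i)^-1 =
    \sum_(j < n | j != i) w j * (x0 - lam j)^-1 by rewrite (bigD1 i)//= addrAC subrr add0r.
  rewrite /deriv_eps genf_sum mulr_sumr.
  rewrite (bigD1 i)//= genfZ genf_deriv2_esyms// eqxx mul0r mulr0 add0r; apply: eq_bigr => j ji.
  by rewrite genfZ genf_deriv2_esyms// eq_sym ji mul1r; ring.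
under eq_bigr do rewrite !eps_gen//.
rewrite -/L -/M.
under [X in _ - X]eq_bigr do rewrite !genf_deriv_esym//.
pose Q : {poly K} := \prod_(i < n) ('X - (mu i)%:P).
have QE : Q = 'X * \sum_(j < n) w j *: \prod_(i < n | i != j) ('X - (lam i)%:P).
  apply/eqP; rewrite -subr_eq0; apply/eqP/(@poly_vanish_nat _ _ 0) => r _.
  rewrite hornerD hornerN hornerM hornerX horner_sum /Q horner_prod.
  under eq_bigr do rewrite hornerXsubC.
  rewrite mu_lam; apply/eqP; rewrite subr_eq0; apply/eqP; congr (_ * _); apply: eq_bigr => j _.
  by rewrite hornerZ horner_prod; congr (_ * _); apply: eq_bigr => i _; rewrite hornerXsubC.
have Qval x0 : Q.[x0] = \prod_(i < n) (x0 - mu i).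
  by rewrite horner_prod; apply: eq_bigr => i _; rewrite hornerXsubC.
have Qy x0 : (forall i, x0 - lam i != 0) ->
   Q.[x0] = x0 * (\prod_(i < n) (x0 - lam i)) * \sum_j w j * (x0 - lam j)^-1.
  move=> x0P; rewrite Qval mu_lam -mulrA; congr (_ * _); rewrite mulr_sumr; apply: eq_bigr => j _.
  by rewrite prod_predC1//; ring.
(* The logarithmic derivative of Q, taken in its second form, expresses the sum of the 1 / (x0 -
   mu_j) by lam and w. *)
have Qd x0 : (forall i, x0 - lam i != 0) -> (forall i, x0 - mu i != 0) ->
   Q.[x0] * (\sum_j (x0 - mu j)^-1) = (\prod_(i < n) (x0 - lam i)) *
     (\sum_j w j * (x0 - lam j)^-1 + x0 * ((\sum_j w j * (x0 - lam j)^-1) * (\sum_j (x0 - lam j)^-1)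
       - \sum_j w j * (x0 - lam j)^-1 ^+ 2)).
  move=> x0P x0Q; rewrite -(horner_deriv_prod _ _ x0Q) -/Q QE derivM derivX mul1r raddf_sum.
  rewrite hornerD hornerM hornerX !horner_sum mulrDr; congr (_ + _).
    by rewrite mulr_sumr; apply: eq_bigr => j _; rewrite hornerZ horner_prod;
      under eq_bigr do rewrite hornerXsubC; rewrite prod_predC1//; ring.
  rewrite mulrCA; congr (_ * _); rewrite mulr_suml -sumrB mulr_sumr; apply: eq_bigr => j _ /=.
  rewrite derivZ hornerZ (horner_deriv_prod _ _ x0P) horner_prod.
  under eq_bigr do rewrite hornerXsubC.
  rewrite prod_predC1// [X in _ * (_ * X - _)](bigD1 j)//=; ring.
(* Partial fractions with poles at y and z reduce the mixed sums to sums in one generating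
   variable. *)
have A1 : \sum_(i < n) lam i ^+ 2 * u i * v i = n%:R + (z ^+ 2 * tau - y ^+ 2 * sg) / (y - z).
  rewrite -[n in n%:R]card_ord -sumr_const !mulr_sumr -sumrB mulr_suml -big_split.
  by apply: eq_bigr => i _ /=; rewrite /u /v; field; rewrite ys zs yz.
have B1 : \sum_(i < n) mu i ^+ 2 * (y - mu i)^-1 * (z - mu i)^-1 =
   n%:R + (z ^+ 2 * (\sum_j (z - mu j)^-1) - y ^+ 2 * (\sum_j (y - mu j)^-1)) / (y - z).
  rewrite -[n in n%:R]card_ord -sumr_const !mulr_sumr -sumrB mulr_suml -big_split.
  by apply: eq_bigr => i _ /=; field; rewrite ys' zs' yz.
have A5 : \sum_(i < n) w i * lam i * u i * v i = (y * S - z * S') / (z - y).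
  rewrite !mulr_sumr -sumrB mulr_suml.
  by apply: eq_bigr => i _ /=; rewrite /u /v; field; rewrite ys zs zy.
have A2 : \sum_(i < n) w i * lam i ^+ 2 * u i * v i ^+ 2 =
   (z * y * (S - S') / (z - y) - z ^+ 2 * S2' - y * S + z * S') / (z - y).
  rewrite -[S - S']sumrB ![z * y * _ / _]mulrAC !mulr_sumr -!sumrB -big_split mulr_suml.
  by apply: eq_bigr => i _ /=; rewrite /u /v; field; rewrite ys zs zy.
have A3 : \sum_(i < n) w i * lam i ^+ 2 * u i ^+ 2 * v i =
   (y ^+ 2 * S2 - z * y * (S - S') / (z - y) - y * S + z * S') / (z - y).
  rewrite -[S - S']sumrB ![z * y * _ / _]mulrAC !mulr_sumr -!sumrB -big_split mulr_suml.
  by apply: eq_bigr => i _ /=; rewrite /u /v; field; rewrite ys zs zy.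
(* This diagonal sum occurs in the gradient of eps and in the off-diagonal double sum and cancels,
   so it is never evaluated. *)
pose A4 := \sum_(i < n) (w i * lam i * u i * v i) ^+ 2.
have -> : \sum_(j < n) \sum_(i < n | i != j) w j * w i * lam j * lam i *
    (y * (L * u j * u i)) * (z * (M * v j * v i)) =
    y * z * L * M * ((\sum_(i < n) w i * lam i * u i * v i) ^+ 2 - A4).
  have := sum_offdiag xpredT (fun i => w i * lam i * u i * v i); rewrite /= => <-.
  rewrite mulr_sumr; apply: eq_bigr => i _; rewrite mulr_sumr; apply: eq_bigr => j _; ring.
have -> : \sum_(i < n) lam i ^+ 2 * (y * L * (y - lam i)^-1 * (\sum_j w j * (y - lam j)^-1 - w i * (y - lam i)^-1)) *
   (z * M * (z - lam i)^-1 * (\sum_j w j * (z - lam j)^-1 - w i * (z - lam i)^-1)) =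
   y * z * L * M * ((\sum_(i < n) lam i ^+ 2 * u i * v i) * S * S' - S * (\sum_(i < n) w i * lam i ^+ 2 * u i * v i ^+ 2)
     - S' * (\sum_(i < n) w i * lam i ^+ 2 * u i ^+ 2 * v i) + A4).
  transitivity (\sum_(i < n) y * z * L * M * (lam i ^+ 2 * u i * v i * (S * S') -
      S * (w i * lam i ^+ 2 * u i * v i ^+ 2) - S' * (w i * lam i ^+ 2 * u i ^+ 2 * v i) +
      (w i * lam i * u i * v i) ^+ 2)).
    by apply: eq_bigr => i _; rewrite -/(u i) -/(v i) -/S -/S'; ring.
  by rewrite -mulr_sumr big_split /= !sumrB -mulr_suml -!mulr_sumr mulrA.
have -> : \sum_(i < n) mu i ^+ 2 * (\prod_(i < n) (y - mu i) * (y - mu i)^-1) * (\prod_(i < n) (z - mu i) * (z - mu i)^-1)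
  = Q.[y] * Q.[z] * n%:R + (z ^+ 2 * (Q.[z] * (\sum_j (z - mu j)^-1)) * Q.[y] - y ^+ 2 * (Q.[y] * (\sum_j (y - mu j)^-1)) * Q.[z]) / (y - z).
  transitivity (Q.[y] * Q.[z] * \sum_(i < n) mu i ^+ 2 * (y - mu i)^-1 * (z - mu i)^-1).
    by rewrite mulr_sumr !Qval; apply: eq_bigr => i _; ring.
  by rewrite B1; field.
rewrite (Qd y)// (Qd z)// (Qy y)// (Qy z)// -/L -/M -/S -/S' -/S2 -/S2' -/sg -/tau A1 A5 A2 A3.
by field; rewrite yz zy.
Qed.

End SquaredGradient.

(** * Averages over the weights of the projection *)

Section MapMpoly.
Variables (K L : comNzRingType) (f : {rmorphism K -> L}) (n : nat).

Lemma map_mpolyM (p q : mpoly n K) : map_mpoly f (p * q) = map_mpoly f p * map_mpoly f q.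
Proof. exact: rmorphM. Qed.

Lemma map_mpoly_mderiv i (p : mpoly n K) :
  map_mpoly f (mderiv i p) = mderiv i (map_mpoly f p).
Proof.
by apply/mpolyP => m; rewrite mcoeff_map_mpoly !mcoeff_deriv mcoeff_map_mpoly raddfMn.
Qed.

Lemma map_mpoly_mesym k : map_mpoly f (mesym n K k) = mesym n L k.
Proof. by apply/mpolyP => m; rewrite mcoeff_map_mpoly !mcoeff_mesym; case: mechar; [exact: rmorph1|exact: rmorph0]. Qed.

Lemma meval_map_mpoly x (p : mpoly n K) :
  meval (f \o x) (map_mpoly f p) = f (meval x p).
Proof.
rewrite (map_mpolyE _ (leqnn (msize p))) [in RHS](mpolywE (leqnn (msize p))) !meval_sum rmorph_sum /=.
apply: eq_bigr => m _; rewrite !mevalZ rmorphM !mevalX rmorph_prod.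
by congr (_ * _); apply: eq_bigr => i _; rewrite rmorphXn.
Qed.

(** Used with complex roots for x and the elementary symmetric polynomials for t: polynomials in the
    e_k take real values at the roots as soon as the e_k do. *)
Lemma meval_map_comp_mpoly k (t : n.-tuple (mpoly k K)) (p : mpoly n K)
    (x : 'I_k -> L) (g : 'I_n -> K) :
  (forall i, meval x (map_mpoly f (tnth t i)) = f (g i)) ->
  meval x (map_mpoly f (comp_mpoly t p)) = f (meval g p).
Proof.
move=> tg; rewrite (comp_mpolywE _ (leqnn (msize p))) [in RHS](mpolywE (leqnn (msize p))).
rewrite (raddf_sum (map_mpoly f)) !meval_sum (rmorph_sum f) /=; apply: eq_bigr => m _.
rewrite map_mpolyZ !mevalZ rmorphM mevalX !rmorph_prod; congr (_ * _).
by apply: eq_bigr => i _; rewrite !rmorphXn /= tg.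
Qed.

End MapMpoly.

Lemma deriv_esyms_map (K L : numFieldType) (f : {rmorphism K -> L}) n j k :
  tnth (deriv_esyms L j) k = map_mpoly f (tnth (deriv_esyms K j) k) :> mpoly n L.
Proof. by rewrite !tnth_mktuple map_mpoly_mderiv map_mpoly_mesym. Qed.

Lemma genf_deriv_esyms_all (K : numFieldType) n (x : 'I_n -> K) j y :
  genf (fun k => meval x (tnth (deriv_esyms K j) k)) y =
  y ^+ n - y * \prod_(i < n | i != j) (y - x i).
Proof.
rewrite -(linear_mgenf (meval x)) mgenf_deriv_esyms raddfB /= mevalC mevalZ.
by rewrite meval_linear_roots.
Qed.

(** Expanding in the variable that only one side contains, e_r without x_i minus e_r without x_j is
    (x_j - x_i) times e_(r-1) without both. This divisibility by x_i - x_j makes the integration by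
    parts free of poles. *)
Lemma deriv_esymsB (K : numFieldType) n (x : 'I_n -> K) i j k : i != j ->
  meval x (tnth (deriv_esyms K i) k) - meval x (tnth (deriv_esyms K j) k) =
  - ((x i - x j) * meval x (mderiv i (tnth (deriv_esyms K j) k))).
Proof.
move=> ij; have [N NP] := nat_avoid x; move: k.
apply: (@genf_inj _ _ _ _ N) => t /NP yx.
rewrite genfB genfN genfZ !genf_deriv_esyms// genf_deriv2_esyms// ij mul1r.
by field; rewrite !yx.
Qed.

(** The prescribed values of e_1, ..., e_n are real but need not come from real numbers: the weights
    w are allowed negative entries later, and then the roots can leave R. *)
Lemma closed_roots_esyms (R : rcfType) n (g : 'I_n -> R) :
  exists2 mu : 'I_n -> R[i],
    forall k : 'I_n, meval mu (mesym n R[i] k.+1) = real_complex R (g k) &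
    forall z, \prod_(i < n) (z - mu i) = z ^+ n - genf (real_complex R \o g) z.
Proof.
pose q : {poly R[i]} := 'X^n - genp (real_complex R \o g).
have sz : (size (genp (real_complex R \o g)) <= n)%N.
  apply: (leq_trans (size_sum _ _ _)); apply/bigmax_leqP => k _.
  apply: (leq_trans (size_scale_leq _ _)); rewrite size_polyXn.
  by have := ltn_ord k; lia.
have szq : size q = n.+1 by rewrite size_addl size_polyXn// size_opp ltnS.
have mq : q \is monic by rewrite monicE lead_coefDl ?lead_coefXn// size_opp size_polyXn ltnS.
have [r rE] := closed_field_poly_normal q.
have szr : size r = n.
  have := szq; rewrite {1}rE (monicP mq) scale1r size_prod_XsubC; exact: succn_inj.
have prodE (z : R[i]) : \prod_(i < n) (z - r`_i) = z ^+ n - genf (real_complex R \o g) z.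
  rewrite -horner_genp -[z ^+ n]hornerXn -hornerN -hornerD -/q rE (monicP mq) scale1r.
  rewrite horner_prod (big_nth 0) szr big_mkord.
  by apply: eq_bigr => i _; rewrite hornerXsubC.
exists (fun i => r`_i) => //.
apply: (@genf_inj _ _ _ _ 0) => t _; rewrite genf_esyms_roots prodE.
by rewrite opprB addrC subrK; apply: eq_genf.
Qed.

(** For each pair, T_i - T_j cancels the denominator lam_i - lam_j and yields the quadratic term.
    The first-order coefficient is antisymmetric in (i, j), so that (w_j - w_i) sums to twice the
    contribution of w_j, which turns beta / 2 into beta. *)
Lemma sum_dirichlet_flow (R : numFieldType) (beta : R) n (lam w F1 : 'I_n -> R)
    (F2 : 'I_n -> 'I_n -> R) (D : 'I_n -> 'I_n -> 'I_n -> R) (T : 'I_n -> 'I_n -> R) :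
  injective lam -> (forall i j k, D i j k = D j i k) ->
  (forall i j k, i != j -> T i k - T j k = - ((lam i - lam j) * D i j k)) ->
  \sum_(k < n) \sum_(l < n) F2 k l *
   (- \sum_(i < n) \sum_(j < n | j != i) w i * w j * lam i * lam j * D i j k * D i j l) +
  \sum_(k < n) F1 k * (beta * \sum_(j < n) w j *
     \sum_(i < n | i != j) lam i * lam j / (lam i - lam j) * D i j k) =
  \sum_(i < n) \sum_(j < n | j != i)
   (w i * w j * (lam i * lam j / (lam i - lam j) * (\sum_(k < n) D i j k * \sum_(l < n) F2 k l * T i l) -
                 lam i * lam j / (lam i - lam j) * (\sum_(k < n) D i j k * \sum_(l < n) F2 k l * T j l)) +
    beta / 2 * ((w j - w i) * (lam i * lam j / (lam i - lam j) * \sum_(k < n) D i j k * F1 k))).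
Proof.
move=> linj Dsym TB.
have lij i j : j != i -> lam i - lam j != 0.
  by move=> ji; rewrite subr_eq0; apply: contraNneq ji => /linj ->.
have termE i j : j != i ->
   w i * w j * (lam i * lam j / (lam i - lam j) * (\sum_(k < n) D i j k * \sum_(l < n) F2 k l * T i l) -
                 lam i * lam j / (lam i - lam j) * (\sum_(k < n) D i j k * \sum_(l < n) F2 k l * T j l)) +
    beta / 2 * ((w j - w i) * (lam i * lam j / (lam i - lam j) * \sum_(k < n) D i j k * F1 k)) =
  \sum_(k < n) (\sum_(l < n) F2 k l * - (w i * w j * lam i * lam j * D i j k * D i j l)) +
  \sum_(k < n) F1 k * (beta / 2 * ((w j - w i) * (lam i * lam j / (lam i - lam j) * D i j k))).
  move=> ji; congr (_ + _).
    rewrite -mulrBr -sumrB !mulr_sumr; apply: eq_bigr => k _.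
    rewrite -mulrBr -sumrB !mulr_sumr; apply: eq_bigr => l _.
    by rewrite -mulrBr TB 1?eq_sym//; field; exact: lij.
  by rewrite !mulr_sumr; apply: eq_bigr => k _; ring.
under [RHS]eq_bigr => i _ do rewrite (eq_bigr _ (termE i)) big_split.
rewrite big_split; congr (_ + _).
  under [RHS]eq_bigr do rewrite exchange_big.
  rewrite [RHS]exchange_big; apply: eq_bigr => k _ /=.
  under [RHS]eq_bigr do rewrite exchange_big.
  rewrite [RHS]exchange_big; apply: eq_bigr => l _ /=.
  rewrite mulrN mulr_sumr -sumrN; apply: eq_bigr => i _.
  by rewrite mulr_sumr -sumrN; apply: eq_bigr => j _; rewrite mulrN.
under [RHS]eq_bigr do rewrite exchange_big.
rewrite [RHS]exchange_big; apply: eq_bigr => k _ /=.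
under [RHS]eq_bigr do rewrite -mulr_sumr -mulr_sumr.
rewrite -!mulr_sumr; congr (_ * _).
pose h i j := lam i * lam j / (lam i - lam j) * D i j k.
have -> : \sum_(i < n) \sum_(j < n | j != i) (w j - w i) * (lam i * lam j / (lam i - lam j) * D i j k) =
    \sum_(i < n) \sum_(j < n | j != i) w j * h i j - \sum_(i < n) \sum_(j < n | j != i) w i * h i j.
  by rewrite -sumrB; apply: eq_bigr => i _; rewrite -sumrB; apply: eq_bigr => j _; rewrite mulrBl.
rewrite (exchange_offdiag xpredT (fun i j => w j * h i j)) /=.
rewrite -sumrB !mulr_sumr; apply: eq_bigr => j _; rewrite -sumrB !mulr_sumr; apply: eq_bigr => i ij.
by rewrite /h (Dsym j i); field; rewrite !lij// eq_sym.
Qed.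

(** * The Jack operator under Dirichlet averages *)

Section Commutation.
Variables (R : realType) (beta : R) (n : nat).
Implicit Types (F : mpoly n R) (x lam w : 'I_n -> R).

(** Chain rule for a second-order operator: second derivatives of F meet the squared gradient of the
    inner polynomials, first derivatives meet the operator applied to them. *)
Lemma jack_at_comp (t : n.-tuple (mpoly n R)) F x :
  jack_at beta x (comp_mpoly t F) =
  \sum_(k < n) \sum_(l < n) meval x (comp_mpoly t (mderiv l (mderiv k F))) *
     \sum_(i < n) x i ^+ 2 * meval x (mderiv i (tnth t k)) * meval x (mderiv i (tnth t l)) +
  \sum_(k < n) meval x (comp_mpoly t (mderiv k F)) * jack_at beta x (tnth t k).
Proof.
rewrite /jack_at /jack_op.
under [in RHS]eq_bigr do under eq_bigr do rewrite mulr_sumr.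
under [X in _ = _ + X]eq_bigr do rewrite mulrDr !mulr_sumr.
rewrite [X in _ = _ + X]big_split /= addrA.
rewrite [X in _ = X + _ + _](_ : _ = \sum_(i < n) \sum_(k < n) \sum_(l < n)
   meval x (comp_mpoly t (mderiv l (mderiv k F))) *
     (x i ^+ 2 * meval x (mderiv i (tnth t k)) * meval x (mderiv i (tnth t l)))); last first.
  by rewrite [RHS]exchange_big; apply: eq_bigr => k _; rewrite exchange_big.
rewrite [X in _ = _ + X + _]exchange_big [X in _ = _ + _ + X]exchange_big -big_split.
rewrite mulr_sumr; congr (_ + _).
  apply: eq_bigr => i _; rewrite -big_split mderiv_comp mderiv_sum meval_sum mulr_sumr.
  apply: eq_bigr => k _; rewrite mderivM mderiv_comp mevalD !mevalM meval_sum mulrDr mulr_suml mulr_sumr.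
  congr (_ + _); last by ring.
  by apply: eq_bigr => l _; rewrite mevalM; ring.
apply: eq_bigr => i _; rewrite mderiv_comp meval_sum -mulr_suml mulrA [LHS]mulr_sumr.
by apply: eq_bigr => k _; rewrite mevalM -mulr_suml; ring.
Qed.

Definition eps w : n.-tuple (mpoly n R) :=
  [tuple \sum_(j < n) w j *: tnth (deriv_esyms R j) k | k < n].

(* eps w as polynomials in w, lam being fixed. *)
Definition weps lam : n.-tuple (mpoly n R) :=
  [tuple \sum_(j < n) meval lam (tnth (deriv_esyms R j) k) *: mpolyX R (mnm1 j) | k < n].

Lemma meval_weps lam w k : meval w (tnth (weps lam) k) = meval lam (tnth (eps w) k).
Proof.
rewrite !tnth_mktuple !meval_sum; apply: eq_bigr => j _.
by rewrite !mevalZ mevalXU mulrC.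
Qed.

Lemma meval_comp_weps lam w F :
  meval w (comp_mpoly (weps lam) F) = meval lam (comp_mpoly (eps w) F).
Proof. by rewrite !comp_mpoly_meval; apply: meval_eq => k; rewrite meval_weps. Qed.

(** [dirichlet_moment] is the integration by parts tested on the monomial w^m, the form in which
    recurrences of Gamma type deliver it. [dirichlet_simplex] refers to the whole hyperplane of sum
    1, so identities in w are checked there for weights of any sign. *)
Record dirichlet_functional (a : R) (L : mpoly n R -> R) : Prop := {
  dirichlet_linear : linear_for *%R L ;
  dirichlet_simplex : forall f, (forall w, \sum_(i < n) w i = 1 -> meval w f = 0) -> L f = 0 ;
  dirichlet_moment : forall (m : multinom n) (i j : 'I_n),
    (a + (m i)%:R) * L (mpolyX R (mnm_add m (mnm1 j))) =
    (a + (m j)%:R) * L (mpolyX R (mnm_add m (mnm1 i))) }.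

Definition dirichlet_flow (a : R) (i j : 'I_n) (f : mpoly n R) : mpoly n R :=
  mpolyX R (mnm1 i) * mpolyX R (mnm1 j) * (mderiv i f - mderiv j f) +
  a *: ((mpolyX R (mnm1 j) - mpolyX R (mnm1 i)) * f).

Lemma meval_dirichlet_flow a i j (f : mpoly n R) w : meval w (dirichlet_flow a i j f) =
  w i * w j * (meval w (mderiv i f) - meval w (mderiv j f)) + a * ((w j - w i) * meval w f).
Proof. by rewrite mevalD mevalZ !mevalM !mevalB !mevalXU. Qed.

Lemma dirichlet_flow0 a L i j f : dirichlet_functional a L -> L (dirichlet_flow a i j f) = 0.
Proof.
move=> dL; have Llin := dirichlet_linear dL.
have L0 : L 0 = 0 by have := Llin (-1) 0 0; rewrite scaler0 addr0 mulN1r addNr.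
have LD p q : L (p + q) = L p + L q by have := Llin 1 p q; rewrite scale1r mul1r.
have LZ c p : L (c *: p) = c * L p by have := Llin c p 0; rewrite L0 !addr0.
rewrite [f]mpolyE; elim/big_rec: _ => [|m p _ IH].
  by rewrite /dirichlet_flow !mderiv0 subrr !mulr0 scaler0 addr0.
rewrite (_ : dirichlet_flow _ _ _ _ = mcoeff m f *: dirichlet_flow a i j (mpolyX R m) + dirichlet_flow a i j p); last first.
  rewrite /dirichlet_flow !mderivD !mderivZ; apply/mpoly_eqP.
  rewrite -!mul_mpolyC; congr mpoly_val; ring.
rewrite LD IH addr0 LZ; apply/eqP; rewrite mulf_eq0; apply/orP; right; apply/eqP.
have XX k l : mpolyX R (mnm1 l) * (mpolyX R (mnm1 k) * mderiv k (mpolyX R m)) = (m k)%:R *: mpolyX R (mnm_add m (mnm1 l)).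
  rewrite mderivX; case: (posnP (m k)) => [->|mk]; first by rewrite !scale0r !mulr0.
  rewrite -!scalerAr -!mpolyXD; congr (_ *: mpolyX R _); apply/mnmP => r.
  rewrite !mnmDE mnmBE !mnm1E.
  by case: (k =P r) => [<-|]; lia.
have -> : dirichlet_flow a i j (mpolyX R m) =
   (m i)%:R *: mpolyX R (mnm_add m (mnm1 j)) - (m j)%:R *: mpolyX R (mnm_add m (mnm1 i)) +
   a *: (mpolyX R (mnm_add m (mnm1 j)) - mpolyX R (mnm_add m (mnm1 i))).
  rewrite /dirichlet_flow -!XX !mpolyXD; congr (_ + _ *: _); first by ring.
  by ring.
have LN q : L (- q) = - L q by rewrite -scaleN1r LZ mulN1r.
have /eqP := dirichlet_moment dL m i j; rewrite -subr_eq0 => /eqP <-.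
by rewrite !LD LN !LZ LD LN; ring.
Qed.

Lemma meval_mderiv_eps lam w i k :
  meval lam (mderiv i (tnth (eps w) k)) =
  \sum_(j < n) w j * meval lam (mderiv i (tnth (deriv_esyms R j) k)).
Proof.
rewrite tnth_mktuple mderiv_sum meval_sum; apply: eq_bigr => j _.
by rewrite mderivZ mevalZ.
Qed.

Lemma meval_mderiv_weps lam w i k :
  meval w (mderiv i (tnth (weps lam) k)) = meval lam (tnth (deriv_esyms R i) k).
Proof.
rewrite tnth_mktuple mderiv_sum meval_sum (bigD1 i)//= big1 ?addr0 => [|j ji].
  rewrite mderivZ mevalZ mderivX mnm1E eqxx scale1r (_ : mnm_sub _ _ = mnm0).
    by rewrite mpolyX0 meval1 mulr1.
  by apply/mnmP => l; rewrite mnmBE mnm0E subnn.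
by rewrite mderivZ mevalZ mderivX mnm1E (negbTE ji) scale0r meval0 mulr0.
Qed.

Lemma jack_at_eps lam w k : injective lam ->
  jack_at beta lam (tnth (eps w) k) = esym_eigen beta k * meval lam (tnth (eps w) k) +
  beta * \sum_(j < n) w j * \sum_(i < n | i != j) lam i * lam j / (lam i - lam j) *
    meval lam (mderiv i (tnth (deriv_esyms R j) k)).
Proof.
move=> linj; rewrite !tnth_mktuple linear_sum /= meval_sum !mulr_sumr -big_split.
apply: eq_bigr => j _ /=; rewrite linearZ /= jack_at_deriv_esyms// mevalZ; ring.
Qed.

Section Eigenfunction.
Variables (F : mpoly n R) (E : R).
Hypothesis eigF : forall x, injective x -> (forall i, 0 < x i) ->
  jack_at beta x (comp_mpoly (esyms n R) F) = E * meval x (comp_mpoly (esyms n R) F).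

Let polyX2 i : mpoly n R := mpolyX R (mnm1 i) ^+ 2.

Let gradient_part : mpoly n R :=
  \sum_(k < n) \sum_(l < n) comp_mpoly (esyms n R) (mderiv l (mderiv k F)) *
    \sum_(i < n) polyX2 i * mderiv i (mesym n R k.+1) * mderiv i (mesym n R l.+1).

Let drift_part : mpoly n R :=
  \sum_(k < n) esym_eigen beta k *: (comp_mpoly (esyms n R) (mderiv k F) * mesym n R k.+1).

(** The repulsion terms are absorbed into [esym_eigen], so the eigenvalue equation becomes an
    identity of polynomials. As such it can be mapped to R[i] and evaluated at points with equal
    coordinates, where [jack_op] has no meaning. *)
Lemma esyms_eigen_identity :
  gradient_part + drift_part = E *: comp_mpoly (esyms n R) F.
Proof.
apply/eqP; rewrite -subr_eq0; apply/eqP/mpoly_vanish_generic => x xinj x0.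
rewrite mevalB mevalZ -eigF// jack_at_comp mevalD /gradient_part /drift_part !meval_sum; apply/eqP; rewrite subr_eq0; apply/eqP.
congr (_ + _).
  apply: eq_bigr => k _; rewrite meval_sum; apply: eq_bigr => l _; rewrite mevalM.
  congr (_ * _); rewrite meval_sum; apply: eq_bigr => i _.
  by rewrite !mevalM mevalXU !tnth_mktuple.
apply: eq_bigr => k _; rewrite mevalZ mevalM tnth_mktuple jack_at_mesym//; ring.
Qed.

(* The identity above is evaluated at the (possibly nonreal) mu with
   e_k(mu) = eps_k(w, lam), to be compared with the chain rule in lam. *)
Lemma jack_at_comp_eps lam w : injective lam -> \sum_(i < n) w i = 1 ->
  jack_at beta lam (comp_mpoly (eps w) F) - E * meval lam (comp_mpoly (eps w) F) =
  \sum_(k < n) \sum_(l < n) meval lam (comp_mpoly (eps w) (mderiv l (mderiv k F))) *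
   (- \sum_(i < n) \sum_(j < n | j != i) w i * w j * lam i * lam j *
      meval lam (mderiv i (tnth (deriv_esyms R j) k)) *
      meval lam (mderiv i (tnth (deriv_esyms R j) l))) +
  \sum_(k < n) meval lam (comp_mpoly (eps w) (mderiv k F)) *
   (beta * \sum_(j < n) w j * \sum_(i < n | i != j) lam i * lam j / (lam i - lam j) *
      meval lam (mderiv i (tnth (deriv_esyms R j) k))).
Proof.
move=> linj w1; pose io : {rmorphism R -> R[i]} := real_complex R.
pose g k := meval lam (tnth (eps w) k).
have [mu muE muP] := closed_roots_esyms g.
(* The powers z^n cancel because w sums to 1. *)
have mu_lam z : \prod_(i < n) (z - mu i) =
    z * \sum_(j < n) io (w j) * \prod_(i < n | i != j) (z - io (lam i)).
  have gE : genf (io \o g) z = \sum_(j < n) io (w j) * (z ^+ n - z * \prod_(i < n | i != j) (z - io (lam i))).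
    under eq_bigr => j _.
      rewrite -(genf_deriv_esyms_all (io \o lam)) -genfZ.
    over.
    rewrite -genf_sum; apply: eq_genf => k; rewrite -[LHS]/(io (g k)) /g tnth_mktuple meval_sum (rmorph_sum io).
    apply: eq_bigr => j _; rewrite mevalZ rmorphM /=.
    by rewrite (deriv_esyms_map io) meval_map_mpoly.
  rewrite muP gE; under eq_bigr do rewrite mulrBr; rewrite sumrB -mulr_suml -rmorph_sum w1 rmorph1 mul1r.
  by rewrite opprB addrC subrK mulr_sumr; apply: eq_bigr => j _; rewrite mulrCA.
have compE G : meval mu (map_mpoly io (comp_mpoly (esyms n R) G)) = io (meval lam (comp_mpoly (eps w) G)).
  rewrite comp_mpoly_meval; apply: meval_map_comp_mpoly => k.
  by rewrite tnth_mktuple map_mpoly_mesym muE.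
have idE0 : meval mu (map_mpoly io gradient_part) + meval mu (map_mpoly io drift_part) =
    io (E * meval lam (comp_mpoly (eps w) F)).
  transitivity (meval mu (map_mpoly io (gradient_part + drift_part))).
    by rewrite (raddfD (map_mpoly io)) mevalD.
  by rewrite esyms_eigen_identity map_mpolyZ mevalZ compE rmorphM.
pose Gmu (k l : 'I_n) := \sum_(i < n) mu i ^+ 2 * meval mu (mderiv i (mesym n R[i] k.+1)) *
                           meval mu (mderiv i (mesym n R[i] l.+1)).
pose D (i j k : 'I_n) := meval lam (mderiv i (tnth (deriv_esyms R j) k)).
have DE i j k : meval (io \o lam) (mderiv i (tnth (deriv_esyms R[i] j) k)) = io (D i j k).
  by rewrite (deriv_esyms_map io) -map_mpoly_mderiv meval_map_mpoly.
have GE k l : io (\sum_(i < n) lam i ^+ 2 * meval lam (mderiv i (tnth (eps w) k)) * meval lam (mderiv i (tnth (eps w) l))) - Gmu k l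
  = io (- \sum_(i < n) \sum_(j < n | j != i) w i * w j * lam i * lam j * D i j k * D i j l).
  have := squared_gradient_esyms (lam := io \o lam) (w := io \o w) mu_lam k l.
  rewrite /deriv_eps => H; transitivity (- \sum_(i < n) \sum_(j < n | j != i) io (w i) * io (w j) * io (lam i) * io (lam j) * io (D i j k) * io (D i j l)); last first.
    rewrite rmorphN rmorph_sum; congr (- _); apply: eq_bigr => i _; rewrite rmorph_sum; apply: eq_bigr => j _.
    by rewrite !rmorphM.
  under [in RHS]eq_bigr do under eq_bigr do rewrite -!DE.
  rewrite -H; congr (_ - _); rewrite rmorph_sum; apply: eq_bigr => i _.
  rewrite (rmorphM io) (rmorphM io) (rmorphXn io) !meval_mderiv_eps !(rmorph_sum io) /=; congr (_ * _ * _).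
    by apply: eq_bigr => j _; rewrite DE rmorphM.
  by apply: eq_bigr => j _; rewrite DE rmorphM.
have GP : meval mu (map_mpoly io gradient_part) =
  \sum_(k < n) \sum_(l < n) io (meval lam (comp_mpoly (eps w) (mderiv l (mderiv k F)))) * Gmu k l.
  rewrite (raddf_sum (map_mpoly io)) meval_sum; apply: eq_bigr => k _.
  rewrite (raddf_sum (map_mpoly io)) meval_sum; apply: eq_bigr => l _.
  apply: etrans (congr1 (meval mu) (map_mpolyM io _ _)) _.
  rewrite mevalM; apply: (congr2 *%R); first exact: compE.
  rewrite (raddf_sum (map_mpoly io)) meval_sum; apply: eq_bigr => i _.
  apply: etrans (congr1 (meval mu) (map_mpolyM io _ _)) _.
  rewrite mevalM; congr (_ * _); last by rewrite map_mpoly_mderiv map_mpoly_mesym.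
  apply: etrans (congr1 (meval mu) (map_mpolyM io _ _)) _.
  rewrite mevalM map_mpoly_mderiv map_mpoly_mesym; congr (_ * _); rewrite /polyX2 expr2.
  apply: etrans (congr1 (meval mu) (map_mpolyM io _ _)) _.
  by rewrite mevalM map_mpolyX mevalXU expr2.
have DP : meval mu (map_mpoly io drift_part) =
  \sum_(k < n) io (meval lam (comp_mpoly (eps w) (mderiv k F)) * (esym_eigen beta k * g k)).
  rewrite (raddf_sum (map_mpoly io)) meval_sum; apply: eq_bigr => k _.
  apply: etrans (congr1 (meval mu) (map_mpolyZ io _ _)) _; rewrite mevalZ.
  apply: etrans (congr1 ( *%R _) (congr1 (meval mu) (map_mpolyM io _ _))) _; rewrite mevalM.
  apply: etrans (congr1 ( *%R _) (congr2 *%R (compE _) (erefl _))) _.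
  by rewrite map_mpoly_mesym muE !(rmorphM io) mulrCA.
have idE := etrans (congr2 +%R (esym GP) (esym DP)) idE0.
apply: (fmorph_inj io); rewrite (rmorphB io) -idE jack_at_comp.
rewrite !(rmorphD io) !(rmorph_sum io) opprD addrACA -!sumrB; congr (_ + _).
  apply: eq_bigr => k _; rewrite !(rmorph_sum io) -sumrB; apply: eq_bigr => l _ /=.
  by rewrite !(rmorphM io) -mulrBr GE.
apply: eq_bigr => k _; rewrite -(rmorphB io); congr (io _); rewrite jack_at_eps// -mulrBr; congr (_ * _).
by rewrite addrAC subrr add0r.
Qed.

(** [g] stands for the Jack operator in lam applied to F(eps), read as a polynomial in w. On the
    hyperplane of sum 1 it differs from the eigenvalue times F(eps) by a sum of Dirichlet flows,
    which [L] annihilates. *)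
Lemma dirichlet_eigen L lam (g : mpoly n R) : dirichlet_functional (beta / 2) L ->
  injective lam -> (forall w, meval w g = jack_at beta lam (comp_mpoly (eps w) F)) ->
  L g = E * L (comp_mpoly (weps lam) F).
Proof.
move=> dL linj gE; have Llin := dirichlet_linear dL.
have L0 : L 0 = 0 by have := Llin (-1) 0 0; rewrite scaler0 addr0 mulN1r addNr.
have LD p q : L (p + q) = L p + L q by have := Llin 1 p q; rewrite scale1r mul1r.
have LZ c p : L (c *: p) = c * L p by have := Llin c p 0; rewrite L0 !addr0.
pose D (i j k : 'I_n) := meval lam (mderiv i (tnth (deriv_esyms R j) k)).
(* Applying d_i - d_j in w to F(eps) brings out a factor lam_i - lam_j, which compensates the
   denominator; D is symmetric in i and j, so f is antisymmetric. *)
pose f i j : mpoly n R := (lam i * lam j / (lam i - lam j)) *: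
  \sum_(k < n) D i j k *: comp_mpoly (weps lam) (mderiv k F).
pose flow := \sum_(i < n) \sum_(j < n | j != i) dirichlet_flow (beta / 2) i j (f i j).
have Lflow : L flow = 0.
  rewrite /flow; apply: (big_ind (fun p => L p = 0)) => // [p q Lp Lq|i _].
    by rewrite LD Lp Lq addr0.
  apply: (big_ind (fun p => L p = 0)) => // [p q Lp Lq|j _].
    by rewrite LD Lp Lq addr0.
  exact: dirichlet_flow0.
suff : L (g - E *: comp_mpoly (weps lam) F - flow) = 0.
  have LN p : L (- p) = - L p by rewrite -scaleN1r LZ mulN1r.
  rewrite !LD !LN LZ Lflow oppr0 addr0 => /eqP.
  by rewrite subr_eq0 => /eqP.
apply: (dirichlet_simplex dL) => w w1.
rewrite !mevalB mevalZ gE meval_comp_weps jack_at_comp_eps// -/D; apply/eqP; rewrite subr_eq0; apply/eqP.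
pose F1 k := meval lam (comp_mpoly (eps w) (mderiv k F)).
pose F2 k l := meval lam (comp_mpoly (eps w) (mderiv l (mderiv k F))).
pose T (i k : 'I_n) := meval lam (tnth (deriv_esyms R i) k).
have fE i j : meval w (f i j) = lam i * lam j / (lam i - lam j) * \sum_(k < n) D i j k * F1 k.
  by rewrite mevalZ meval_sum; congr (_ * _); apply: eq_bigr => k _; rewrite mevalZ meval_comp_weps.
have dfE i j r : meval w (mderiv r (f i j)) = lam i * lam j / (lam i - lam j) *
    \sum_(k < n) D i j k * \sum_(l < n) F2 k l * T r l.
  rewrite mderivZ mevalZ mderiv_sum meval_sum; congr (_ * _); apply: eq_bigr => k _.
  rewrite mderivZ mevalZ mderiv_comp meval_sum; congr (_ * _); apply: eq_bigr => l _.
  by rewrite mevalM meval_comp_weps meval_mderiv_weps.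
rewrite /flow meval_sum; transitivity (\sum_(i < n) \sum_(j < n | j != i)
  (w i * w j * (meval w (mderiv i (f i j)) - meval w (mderiv j (f i j))) +
   beta / 2 * ((w j - w i) * meval w (f i j)))); last first.
  apply: eq_bigr => i _; rewrite meval_sum; apply: eq_bigr => j _.
  exact/esym/meval_dirichlet_flow.
under [RHS]eq_bigr do under eq_bigr do rewrite !dfE fE.
apply: (@sum_dirichlet_flow R beta n lam w F1 F2 D T) => //.
- by move=> i j k; rewrite /D !tnth_mktuple mderiv_comm.
- by move=> i j k; exact: deriv_esymsB.
Qed.

End Eigenfunction.
End Commutation.

Lemma mpoly_ext (R : numDomainType) n (p q : mpoly n R) :
  (forall x, meval x p = meval x q) -> p = q.
Proof.
move=> pq; apply/eqP; rewrite -subr_eq0; apply/eqP/mpoly_vanish_generic => x _ _.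
by rewrite mevalB pq subrr.
Qed.

Lemma meval_msym (R : comNzRingType) n (s : {perm 'I_n}) (p : mpoly n R) x :
  meval x (msym s p) = meval (x \o s) p.
Proof.
rewrite [p]mpolyE (raddf_sum (msym s)) !meval_sum; apply: eq_bigr => m _ /=.
rewrite msymZ msymX !mevalZ !mevalX; congr (_ * _).
rewrite (reindex_inj (@perm_inj _ s)) /=; apply: eq_bigr => i _.
by rewrite mnmE permK.
Qed.

Section Averaging.
Variables (R : realType) (n : nat).
Implicit Types (F : mpoly n R) (x lam w : 'I_n -> R).

Lemma genf_eps lam w y : genf (fun k => meval lam (tnth (eps w) k)) y =
  \sum_(j < n) w j * (y ^+ n - y * \prod_(i < n | i != j) (y - lam i)).
Proof.
transitivity (genf (fun k => \sum_(j < n) w j * meval lam (tnth (deriv_esyms R j) k)) y).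
  by apply: eq_genf => r; rewrite tnth_mktuple meval_sum; apply: eq_bigr => j _; rewrite mevalZ.
by rewrite genf_sum; apply: eq_bigr => j _; rewrite genfZ genf_deriv_esyms_all.
Qed.

Lemma meval_eps_perm lam w (s : {perm 'I_n}) k :
  meval (lam \o s) (tnth (eps (w \o s)) k) = meval lam (tnth (eps w) k).
Proof.
move: k; apply: (@genf_inj _ _ _ _ 0) => t _; rewrite !genf_eps [RHS](reindex_inj (@perm_inj _ s)).
apply: eq_bigr => j _; congr (_ * (_ - _ * _)); rewrite [RHS](reindex_inj (@perm_inj _ s)).
by apply: eq_bigl => i; rewrite (inj_eq perm_inj).
Qed.

(** In lam, eps_k is square-free and of the same degree as the elementary symmetric polynomial that
    it replaces; hence F(eps) keeps the dominance bounds of F(e_1, ..., e_n). *)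
Lemma dom_supp_eps w (k : 'I_n) : dom_supp (minn k.+1) (tnth (eps w) k).
Proof.
rewrite tnth_mktuple; apply: dom_supp_sum => j _; apply: dom_suppZ; rewrite tnth_mktuple => m.
rewrite mcoeff_msupp mcoeff_deriv mcoeff_mesym => mP.
have : mechar k.+2 (mnm_add m (mnm1 j)) by move: mP; case: mechar => //; rewrite mul0rn eqxx.
move=> /andP[/eqP deg /forallP m1]; rewrite mdegD mdeg1 addn1 in deg; case: deg => deg.
have m1' i : (m i <= 1)%N by have := m1 i; rewrite mnmDE; apply: leq_trans; exact: leq_addr.
split=> [J|]; last by rewrite -mdegE deg (minn_idPl (ltn_ord k)).
rewrite leq_min; apply/andP; split.
  by rewrite -deg mdegE [leqRHS](bigID (mem J))/= leq_addr.
by rewrite -sum1_card leq_sum.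
Qed.

Section WithFunctional.
Variables (a : R) (L : mpoly n R -> R).
Hypotheses (a0 : 0 < a) (dL : dirichlet_functional a L).

Let L0 : L 0 = 0.
Proof. by have := dirichlet_linear dL (-1) 0 0; rewrite scaler0 addr0 mulN1r addNr. Qed.

Let LD p q : L (p + q) = L p + L q.
Proof. by have := dirichlet_linear dL 1 p q; rewrite scale1r mul1r. Qed.

Let LZ c p : L (c *: p) = c * L p.
Proof. by have := dirichlet_linear dL c p 0; rewrite L0 !addr0. Qed.

Let LB p q : L (p - q) = L p - L q.
Proof. by rewrite LD -scaleN1r LZ mulN1r. Qed.

Let L_sum I (r : seq I) (f : I -> mpoly n R) : L (\sum_(i <- r) f i) = \sum_(i <- r) L (f i).
Proof. by apply: (big_morph L LD L0). Qed.

Lemma dirichlet_ext p q : (forall w, \sum_(i < n) w i = 1 -> meval w p = meval w q) -> L p = L q.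
Proof.
move=> pq; apply/eqP; rewrite -subr_eq0 -LB; apply/eqP/(dirichlet_simplex dL) => w w1.
by rewrite mevalB pq// subrr.
Qed.

(** Multiply by 1 = sum_j w_j and apply the moment relation to each term. Recursively, all moments
    are determined by [L 1]. *)
Lemma dirichlet_step (m : multinom n) i :
  (a + (m i)%:R) * L (mpolyX R m) =
  (n%:R * a + (mdeg m)%:R) * L (mpolyX R (mnm_add m (mnm1 i))).
Proof.
have -> : L (mpolyX R m) = \sum_(j < n) L (mpolyX R (mnm_add m (mnm1 j))).
  rewrite -L_sum; apply: dirichlet_ext => w w1; rewrite meval_sum.
  under eq_bigr do rewrite mpolyXD mevalM mevalXU.
  by rewrite -mulr_sumr w1 mulr1.
rewrite mulr_sumr; under eq_bigr do rewrite (dirichlet_moment dL m i).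
rewrite -mulr_suml big_split sumr_const card_ord -natr_sum -mdegE; congr ((_ + _) * _).
by rewrite mulr_natl.
Qed.

(** A monomial and its permuted copy satisfy the same recursion on the degree, and the factor n a +
    |m| to be divided out is positive. *)
Lemma dirichlet_sym (s : {perm 'I_n}) p : L (msym s p) = L p.
Proof.
have LX d (m : multinom n) : mdeg m = d -> L (msym s (mpolyX R m)) = L (mpolyX R m).
  elim: d m => [|d IH] m md.
    by move: md => /eqP; rewrite mdeg_eq0 => /eqP ->; rewrite mpolyX0 msym1.
  have [i mi] : exists i, m i != 0%N.
    apply/existsP; apply: contraPT md => /existsPn m0.
    by rewrite mdegE big1// => i _; apply/eqP/negPn; exact: m0.
  pose m' := mnm_sub m (mnm1 i).
  have mE : m = mnm_add m' (mnm1 i) by rewrite submK// lep1mP.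
  have md' : mdeg m' = d by apply/eqP; rewrite -eqSS -md [in X in _ == X]mE mdegD mdeg1 addn1.
  have := dirichlet_step m' i; have := dirichlet_step (Multinom [tuple m' ((s^-1)%g j) | j < n]) (s i).
  rewrite mnmE permK mdeg_mperm -msymX IH// => -> /mulfI; rewrite -mE => H.
  have -> : msym s (mpolyX R m) = mpolyX R (mnm_add (Multinom [tuple m' ((s^-1)%g j) | j < n]) (mnm1 (s i))).
    rewrite msymX {1}mE; congr mpolyX; apply/mnmP => j; rewrite !mnmE; congr addn.
    by rewrite (canF_eq (permK s)).
  apply: H; apply: lt0r_neq0; rewrite ltr_wpDr// mulr_gt0// ltr0n.
  exact: leq_ltn_trans (ltn_ord i).
rewrite [p]mpolyE (raddf_sum (msym s)) !L_sum; apply: eq_bigr => m _ /=.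
by rewrite msymZ !LZ (LX _ _ (erefl _)).
Qed.

(* A F is the polynomial in lam obtained by applying L, acting on polynomials in
   w, to F(eps(w, lam)); its images under linear functionals are computed
   under L. *)
Lemma averaging F : exists A : mpoly n R,
  (forall l : mpoly n R -> R, linear_for *%R l -> exists2 f, L f = l A &
     forall w, meval w f = l (comp_mpoly (eps w) F)) /\
  (forall m, m \in msupp A -> exists w, m \in msupp (comp_mpoly (eps w) F)).
Proof.
pose epsS : n.-tuple (mpoly n (mpoly n R)) :=
  [tuple \sum_(j < n) mpolyX R (mnm1 j) *: map_mpoly (@mpolyC n R) (tnth (deriv_esyms R j) k) | k < n].
pose Phi := comp_mpoly epsS (map_mpoly (@mpolyC n R) F).
have PhiE w : map_mpoly (meval w) Phi = comp_mpoly (eps w) F.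
  have mapC (p : mpoly n R) : map_mpoly (meval w) (map_mpoly (@mpolyC n R) p) = p.
    by apply/mpolyP => m; rewrite !mcoeff_map_mpoly /= mevalC.
  rewrite /Phi; set G := map_mpoly (@mpolyC n R) F.
  rewrite (comp_mpolywE _ (leq_maxl (msize G) (msize F))).
  rewrite [RHS](comp_mpolywE _ (leq_maxr (msize G) (msize F))).
  rewrite raddf_sum; apply: eq_bigr => m _ /=.
  rewrite map_mpolyZ mcoeff_map_mpoly /= mevalC; congr (_ *: _).
  rewrite (rmorph_prod (map_mpoly (meval w))); apply: eq_bigr => k _.
  rewrite rmorphXn /=; congr (_ ^+ _); rewrite !tnth_mktuple raddf_sum; apply: eq_bigr => j _ /=.
  by rewrite map_mpolyZ mapC /= mevalXU.
pose A := \sum_(m <- msupp Phi) L (mcoeff m Phi) *: mpolyX R m.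
have coefA m : mcoeff m A = L (mcoeff m Phi).
  rewrite /A raddf_sum /=; case: (boolP (m \in msupp Phi)) => mP; last first.
    rewrite (memN_msupp_eq0 mP) L0 big1_seq// => m' /andP[_ m'P].
    rewrite mcoeffZ mcoeffX; case: eqP => [e|]; last by rewrite mulr0.
    by rewrite -e m'P in mP.
  rewrite (bigD1_seq m) ?msupp_uniq//= mcoeffZ mcoeffX eqxx mulr1 big1 ?addr0// => m' m'm.
  by rewrite mcoeffZ mcoeffX (negbTE m'm) mulr0.
exists A; split.
  move=> l llin; have l0 : l 0 = 0 by have := llin (-1) 0 0; rewrite scaler0 addr0 mulN1r addNr.
  have lD p q : l (p + q) = l p + l q by have := llin 1 p q; rewrite scale1r mul1r.
  have lZ c p : l (c *: p) = c * l p by have := llin c p 0; rewrite l0 !addr0.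
  exists (\sum_(m <- msupp Phi) l (mpolyX R m) *: mcoeff m Phi).
    rewrite L_sum /A (big_morph l lD l0); apply: eq_bigr => m _.
    by rewrite LZ lZ mulrC.
  move=> w; rewrite -PhiE meval_sum [in RHS](mpolyE Phi) raddf_sum (big_morph l lD l0).
  apply: eq_bigr => m _ /=; rewrite map_mpolyZ lZ mevalZ mulrC map_mpolyX.
  by [].
move=> m; rewrite mcoeff_msupp coefA => LP; apply: contrapT => nw; case/eqP: LP.
rewrite (_ : mcoeff m Phi = 0) ?L0//; apply: mpoly_ext => w; rewrite meval0.
have : m \notin msupp (comp_mpoly (eps w) F) by apply/negP => mw; apply: nw; exists w.
by rewrite -PhiE => /memN_msupp_eq0; rewrite mcoeff_map_mpoly.
Qed.

Section Averaged.
Variables (F A : mpoly n R).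
Hypothesis AP : forall l : mpoly n R -> R, linear_for *%R l -> exists2 f, L f = l A &
  forall w, meval w f = l (comp_mpoly (eps w) F).

Lemma meval_averaged lam : meval lam A = L (comp_mpoly (weps lam) F).
Proof.
have [|f Lf fE] := AP (l := meval lam); first by move=> c p q; rewrite mevalD mevalZ.
by rewrite -Lf; apply: (congr1 L); apply: mpoly_ext => w; rewrite fE (meval_comp_weps lam w).
Qed.

(** Permuting w and lam together leaves eps unchanged, and [L] does not see a permutation of w. *)
Lemma averaged_sym : symmetric_pred A.
Proof.
apply/issymP => s; apply: mpoly_ext => x; rewrite meval_msym !meval_averaged.
rewrite -(dirichlet_sym s (comp_mpoly (weps (x \o s)) F)).
apply: (congr1 L); apply: mpoly_ext => w; rewrite meval_msym.
rewrite (meval_comp_weps (x \o s) (w \o s)) (meval_comp_weps x w) !comp_mpoly_meval.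
by apply: meval_eq => k; rewrite meval_eps_perm.
Qed.

Lemma averaged_dom_supp K : dom_weight K F ->
  (forall m, m \in msupp A -> exists w, m \in msupp (comp_mpoly (eps w) F)) -> dom_supp K A.
Proof.
move=> KF AS m /AS[w]; apply: dom_supp_comp KF m => k; exact: dom_supp_eps.
Qed.

Lemma averaged_eigen (beta E : R) : a = beta / 2 ->
  (forall x, injective x -> (forall i, 0 < x i) ->
    jack_at beta x (comp_mpoly (esyms n R) F) = E * meval x (comp_mpoly (esyms n R) F)) ->
  forall x, injective x -> jack_at beta x A = E * meval x A.
Proof.
move=> aE eigF x xinj; have [|f Lf fE] := AP (l := jack_at beta x); first exact: jack_at_is_linear.
rewrite -Lf meval_averaged; apply: (dirichlet_eigen (beta := beta)) => //.
by rewrite -aE.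
Qed.

End Averaged.
End WithFunctional.
End Averaging.

(** * Jack polynomials *)

Definition psum (kappa : seq nat) (j : nat) : nat := sumn (take j kappa).

Lemma psumE kappa j : psum kappa j = (\sum_(i < j) nth 0%N kappa i)%N.
Proof.
rewrite /psum; elim: j kappa => [|j IH] [|x s]; rewrite ?big_ord0//.
  by rewrite big1// => i _; rewrite nth_nil.
by rewrite big_ord_recl /= IH.
Qed.

Lemma psum_ge kappa j : (size kappa <= j)%N -> psum kappa j = sumn kappa.
Proof. by move=> kj; rewrite /psum take_oversize. Qed.

Lemma psum_le kappa i j : (i <= j)%N -> (psum kappa i <= psum kappa j)%N.
Proof.
move=> ij; rewrite !psumE -(subnKC ij) big_split_ord /=; exact: leq_addr.
Qed.

Lemma partition_nth_le kappa i j : is_partition kappa -> (i <= j)%N ->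
  (nth 0%N kappa j <= nth 0%N kappa i)%N.
Proof.
move=> /andP[sk _] ij; case: (ltnP j (size kappa)) => [jk|kj]; last by rewrite (nth_default _ kj).
have := sorted_leq_nth geq_trans leqnn 0%N sk; apply => //.
by rewrite inE; exact: leq_ltn_trans jk.
Qed.

Lemma partition_nth_gt0 kappa i : is_partition kappa -> (i < size kappa)%N ->
  (0 < nth 0%N kappa i)%N.
Proof.
move=> /andP[_ k0] ik; rewrite lt0n; apply: contraNneq k0 => <-; exact: mem_nth.
Qed.

Lemma nth_nonzero_parts s i : sorted geq s -> nth 0%N (nonzero_parts s) i = nth 0%N s i.
Proof.
move=> /sorted_nonzero_parts sE; rewrite [in RHS]sE nth_cat nth_nseq.
by case: ltnP => // le; rewrite nth_default//; case: ifP.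
Qed.

Lemma is_partition_nonzero_parts s : sorted geq s -> is_partition (nonzero_parts s).
Proof.
move=> ss; rewrite /is_partition sorted_filter//; last exact: geq_trans.
by rewrite mem_filter.
Qed.

Lemma is_partition_perm kappa mu : is_partition kappa -> is_partition mu ->
  perm_eq kappa mu -> kappa = mu.
Proof.
move=> /andP[sk _] /andP[sm _]; apply: (@sorted_eq _ geq) => //; first exact: geq_trans.
by move=> x y /= /andP[yx xy]; apply/eqP; rewrite eqn_leq yx xy.
Qed.

(** Either the largest part lies in t and is removed from both sides, or t already consists of parts
    of the tail, whose partial sums are no larger. *)
Lemma sumn_perm_take t u kappa : is_partition kappa -> perm_eq (t ++ u) kappa ->
  (sumn t <= psum kappa (size t))%N.
Proof.
elim: kappa t u => [|x kappa IH] t u pk tu.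
  by have := perm_size tu; case: t {tu}.
have pk' : is_partition kappa.
  move: pk; rewrite /is_partition /= inE negb_or => /andP[/path_sorted -> /andP[_ ->]].
  by [].
have [xt|xt] := boolP (x \in t).
  have tE := perm_to_rem xt; rewrite (perm_sumn tE) (perm_size tE) /psum /= leq_add2l.
  apply: (IH _ u) => //; rewrite -(perm_cons x) -cat_cons.
  by rewrite -(perm_cat2r u) in tE; rewrite perm_sym in tE; exact: perm_trans tu.
have xu : x \in u.
  by have := perm_mem tu x; rewrite mem_cat mem_head (negbTE xt).
have uE := perm_to_rem xu.
have : (sumn t <= psum kappa (size t))%N.
  apply: (IH _ (rem x u)) => //; rewrite -(perm_cons x).
  apply: perm_trans tu; rewrite -cat1s -[X in perm_eq X]/(([:: x] ++ t ++ rem x u)) perm_catCA.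
  by rewrite perm_cat2l perm_sym.
move=> /leq_trans; apply; rewrite !psumE; apply: leq_sum => i _.
by have := @partition_nth_le _ i i.+1 pk (leqnSn i).
Qed.

Section MonomialSym.
Variables (R : realType) (n : nat).

Lemma coef_monomial_sym mu (m : multinom n) : mcoeff m (monomial_sym R n mu) =
  (perm_eq (nonzero_parts [seq m i | i <- enum 'I_n]) mu)%:R.
Proof.
rewrite /monomial_sym raddf_sum /=; case: (boolP (perm_eq _ mu)) => mP; last first.
  rewrite big1// => m' m'P; rewrite mcoeffX; case: eqP => // e.
  by rewrite -e m'P in mP.
have md : (mdeg m < (sumn mu).+1)%N.
  by rewrite ltnS -(perm_sumn mP) sumn_nonzero_parts sumnE big_map big_enum mdegE.
rewrite (bigD1 (BMultinom md))//= mcoeffX eqxx big1 ?addr0// => m' /andP[_ m'm].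
by rewrite mcoeffX; move: m'm; rewrite bmeqP /= => /negbTE ->.
Qed.

Lemma monomial_sym_sym mu : symmetric_pred (monomial_sym R n mu).
Proof.
apply/issymP => s; apply/mpolyP => m; rewrite mcoeff_sym !coef_monomial_sym; congr ((nat_of_bool _)%:R).
have sE : perm_eq [seq Multinom [tuple m (s j) | j < n] i | i <- enum 'I_n] [seq m i | i <- enum 'I_n].
  rewrite (eq_map (g := m \o s)) => [|i]; last by rewrite /= mnmE.
  rewrite map_comp perm_map// uniq_perm ?enum_uniq// ?(map_inj_uniq perm_inj) ?enum_uniq// => i.
  rewrite mem_enum inE; apply/mapP; exists (s^-1 i)%g; rewrite ?mem_enum//.
  by rewrite permKV.
exact: (permPl (perm_filter (fun i => i != 0%N) sE) mu).
Qed.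

Lemma monomial_sym_dom mu : is_partition mu -> (size mu <= n)%N ->
  dom_supp (psum mu) (monomial_sym R n mu).
Proof.
move=> pm mun m; rewrite mcoeff_msupp coef_monomial_sym; case: (boolP (perm_eq _ _)) => [mP _|]; last by rewrite eqxx.
split; last first.
  by rewrite psum_ge// -(perm_sumn mP) sumn_nonzero_parts sumnE big_map big_enum.
move=> J; pose t := [seq m i | i <- enum J]; pose u := [seq m i | i <- enum (~: J)].
have -> : (\sum_(i in J) m i = sumn (nonzero_parts t))%N.
  by rewrite sumn_nonzero_parts sumnE big_map big_enum.
have : (size (nonzero_parts t) <= #|J|)%N.
  by rewrite size_filter (leq_trans (count_size _ _))// size_map -cardE.
move=> /(psum_le mu); apply: leq_trans; apply: (@sumn_perm_take _ (nonzero_parts u)) => //.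
rewrite -filter_cat -map_cat; apply: perm_trans mP; apply/perm_filter/perm_map.
apply: uniq_perm; rewrite ?cat_uniq ?enum_uniq//=.
  by rewrite andbT; apply/hasPn => i; rewrite !mem_enum inE.
by move=> i; rewrite mem_cat !mem_enum inE orbN.
Qed.

Definition mnm_part (kappa : seq nat) : multinom n :=
  Multinom [tuple nth 0%N kappa i | i < n].

Lemma coef_monomial_sym_part kappa mu : is_partition kappa -> (size kappa <= n)%N ->
  is_partition mu -> mcoeff (mnm_part kappa) (monomial_sym R n mu) = (kappa == mu)%:R.
Proof.
move=> pk kn pm; rewrite coef_monomial_sym; congr ((nat_of_bool _)%:R).
have -> : nonzero_parts [seq mnm_part kappa i | i <- enum 'I_n] = kappa.
  have -> : [seq mnm_part kappa i | i <- enum 'I_n] = kappa ++ nseq (n - size kappa) 0%N.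
    apply: (@eq_from_nth _ 0%N) => [|i].
      by rewrite size_map size_enum_ord size_cat size_nseq subnKC.
    rewrite size_map size_enum_ord => lt_in; rewrite (nth_map (Ordinal lt_in)) ?size_enum_ord//.
    rewrite mnmE nth_enum_ord// nth_cat nth_nseq; case: ltnP => // ki.
    by rewrite nth_default//; case: ifP.
  rewrite /nonzero_parts filter_cat; have /andP[_ k0] := pk.
  have /all_filterP -> : all (fun i => i != 0%N) kappa.
    by apply/allP => i; apply: contraTneq => ->.
  suff -> : [seq i <- nseq (n - size kappa) 0%N | i != 0%N] = [::] by rewrite cats0.
  by elim: (_ - _)%N.
by apply/idP/eqP => [|->//]; exact: is_partition_perm.
Qed.

(** At the first index where m and kappa differ, the bound on the sum of the exponents up to that
    index forces m to be smaller there. *)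
Lemma dom_supp_le_part kappa (p : mpoly n R) m : dom_supp (psum kappa) p ->
  (size kappa <= n)%N -> m \in msupp p -> (m <= mnm_part kappa)%O.
Proof.
move=> Kp kn /Kp[mJ mT].
have kT : (\sum_(i < n) mnm_part kappa i = psum kappa n)%N.
  by rewrite psumE; apply: eq_bigr => i _; rewrite mnmE.
have [->|mk] := eqVneq m (mnm_part kappa); first exact: lexx.
apply: ltW; apply/ltmcP; first by rewrite !mdegE kT mT.
have [i0 i0P] : exists i : 'I_n, m i != mnm_part kappa i.
  apply/existsP; apply: contraNT mk => /existsPn e; apply/eqP/mnmP => i.
  by apply/eqP/negPn; exact: e.
have [i iP imin] := @arg_minnP _ i0 (fun i => m i != mnm_part kappa i) (fun i => i) i0P.
have eqm (j : 'I_n) : (j < i)%N -> m j = mnm_part kappa j.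
  by move=> ji; apply/eqP; apply: contraTT ji => /imin; rewrite -leqNgt.
exists i => //; rewrite ltn_neqAle iP /=.
have := mJ [set j : 'I_n | (j <= i)%N]%SET.
have -> : #|[set j : 'I_n | (j <= i)%N]%SET| = i.+1.
  rewrite -sum1dep_card -(big_ord_widen _ (fun=> 1%N) (ltn_ord i)) sum1_card card_ord//.
rewrite psumE (big_ord_widen n _ (ltn_ord i)) (bigD1 i) ?inE//= [leqRHS](bigD1 i)//= mnmE.
rewrite (eq_bigr (fun j : 'I_n => nth 0%N kappa j)) => [|j].
  rewrite (eq_bigl (fun j : 'I_n => (j < i.+1)%N && (j != i))) ?leq_add2r// => j.
  by rewrite inE ltnS.
rewrite inE => /andP[ji jni]; rewrite eqm ?mnmE// ltn_neqAle ji andbT.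
by move: jni; apply: contraNneq => /val_inj ->.
Qed.

Lemma sym_mlead_part kappa (p : mpoly n R) : symmetric_pred p -> dom_supp (psum kappa) p ->
  (size kappa <= n)%N -> p != 0 ->
  exists mu, [/\ mu \in partitions (sumn kappa) n, dominates kappa mu & mlead p = mnm_part mu].
Proof.
move=> psym Kp kn p0; set m := mlead p.
have sm : sorted geq (m : seq nat).
  apply/(sortedP 0%N) => i; rewrite size_tuple => i1n.
  have := mlead_msym_sorted psym (leqnSn i : (Ordinal (ltnW i1n) <= Ordinal i1n)%N).
  by rewrite -/m !(mnm_nth 0%N).
pose mu := nonzero_parts m.
have nthE (i : 'I_n) : nth 0%N mu i = m i by rewrite nth_nonzero_parts// -mnm_nth.
have szmu : (size mu <= n)%N.
  by rewrite size_filter (leq_trans (count_size _ _))// size_tuple.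
have [mJ mT] := Kp m (mlead_supp p0).
exists mu; split; last by apply/mnmP => i; rewrite mnmE nthE.
  rewrite mem_partitions is_partition_nonzero_parts// szmu andbT /=.
  rewrite -(psum_ge kn) -mT -(psum_ge szmu) psumE; apply/eqP/eq_bigr => i _; exact: nthE.
have jle j : (j <= n)%N -> (psum mu j <= psum kappa j)%N.
  move=> jn; have := mJ [set i : 'I_n | (i < j)%N]%SET.
  have -> : #|[set i : 'I_n | (i < j)%N]%SET| = j.
    by rewrite -sum1dep_card -(big_ord_widen _ (fun=> 1%N) jn) sum1_card card_ord.
  rewrite [psum mu j]psumE (big_ord_widen n _ jn); under eq_bigl do rewrite inE.
  by under eq_bigr do rewrite -nthE.
move=> j; rewrite -!/(psum _ j); case: (leqP j n) => [|/ltnW jn]; first exact: jle.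
rewrite [psum mu j]psum_ge ?(leq_trans szmu)// -(psum_ge szmu).
by apply: leq_trans (psum_le _ jn); exact: jle.
Qed.

End MonomialSym.

Lemma sum_by_parts (R : nzRingType) n (d g : nat -> R) :
  \sum_(i < n) d i * g i =
  \sum_(i < n) (\sum_(l < i.+1) d l) * (g i - g i.+1) + (\sum_(l < n) d l) * g n.
Proof.
elim: n => [|n IH]; first by rewrite !big_ord0 mul0r addr0.
rewrite big_ord_recr /= IH [in RHS]big_ord_recr /= -[LHS]addrA -[RHS]addrA; congr (_ + _).
by rewrite -mulrDl -mulrDr subrK big_ord_recr.
Qed.

Lemma seq_argmax (d : Order.disp_t) (T : orderType d) (I : eqType) (f : I -> T) (r : seq I) i0 :
  i0 \in r -> exists2 i, i \in r & forall j, j \in r -> (f j <= f i)%O.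
Proof.
elim: r i0 => // x [|y r] IH i0 _.
  by exists x; rewrite ?mem_head// => j; rewrite inE => /eqP ->.
have [i ir iP] := IH y (mem_head _ _).
case: (leP (f i) (f x)) => fix_.
  exists x; rewrite ?mem_head// => j; rewrite inE => /predU1P[->//|/iP/le_trans]; exact.
exists i; first by rewrite inE ir orbT.
by move=> j; rewrite inE => /predU1P[->|/iP//]; exact: ltW.
Qed.

Section JackFamily.
Variables (R : realType) (beta : R) (C : forall m : nat, seq nat -> mpoly m R).
Hypotheses (beta0 : 0 < beta) (jackC : jack_family beta C).
Implicit Types (kappa mu : seq nat).

Definition jack_eigenvalue n kappa : R :=
  jack_rho beta kappa + beta * (sumn kappa)%:R * (n%:R - 1).

Lemma jack_rhoE n kappa : (size kappa <= n)%N -> jack_rho beta kappa =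
  \sum_(i < n) (nth 0%N kappa i)%:R * ((nth 0%N kappa i)%:R - 1 - beta * i%:R).
Proof.
move=> kn; rewrite /jack_rho -(subnKC kn) big_split_ord /= [X in _ + X]big1 ?addr0// => i _.
by rewrite nth_default ?leq_addr// mul0r.
Qed.

(** The difference is the sum of d_i g_i with d_i = kappa_i - mu_i and g_i = kappa_i + mu_i - 1 -
    beta i. Summation by parts pairs the partial sums of d, nonnegative by dominance, with the drops
    of g, each at least beta. *)
Lemma jack_eigenvalue_lt n kappa mu : is_partition kappa -> is_partition mu ->
  (size kappa <= n)%N -> (size mu <= n)%N -> sumn kappa = sumn mu ->
  dominates kappa mu -> mu != kappa -> jack_eigenvalue n mu < jack_eigenvalue n kappa.
Proof.
move=> pk pm kn mn km dom neq; rewrite /jack_eigenvalue km ltrD2r -subr_gt0.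
rewrite !(@jack_rhoE n)// -sumrB.
pose d i : R := (nth 0%N kappa i)%:R - (nth 0%N mu i)%:R.
pose g i : R := (nth 0%N kappa i)%:R + (nth 0%N mu i)%:R - 1 - beta * i%:R.
rewrite (eq_bigr (fun i : 'I_n => d i * g i)) => [|i _]; last by rewrite /d /g; ring.
have PE j : \sum_(l < j) d l = (psum kappa j)%:R - (psum mu j)%:R.
  by rewrite sumrB -!natr_sum -!psumE.
have P0 j : 0 <= \sum_(l < j) d l by rewrite PE subr_ge0 ler_nat; exact: dom.
have gd i : beta <= g i - g i.+1.
  have := partition_nth_le pk (leqnSn i); have := partition_nth_le pm (leqnSn i).
  rewrite /g -(natr1 i) -!(ler_nat R) => h1 h2; lra.
have Pn : \sum_(l < n) d l = 0 by rewrite PE !psum_ge// km subrr.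
rewrite sum_by_parts Pn mul0r addr0.
(* For strictness: if all partial sums of d vanished, kappa and mu would agree part by part. *)
have [j jP] : exists j : 'I_n, 0 < \sum_(l < j.+1) d l.
  apply/existsP; apply: contraNT neq => /existsPn Pz.
  have P00 j : (j <= n)%N -> \sum_(l < j) d l = 0.
    case: j => [|j] jn; first by rewrite big_ord0.
    by apply/eqP; rewrite eq_le P0 andbT leNgt; exact: (Pz (Ordinal jn)).
  apply/eqP/is_partition_perm => //; rewrite (_ : mu = kappa)//.
  have nE i : (i < n)%N -> nth 0%N mu i = nth 0%N kappa i.
    move=> lt_in; have := P00 i.+1 lt_in; rewrite big_ord_recr /= P00 ?add0r; last exact: ltnW.
    by move/eqP; rewrite subr_eq0 eqr_nat => /eqP.
  have nE' i : nth 0%N mu i = nth 0%N kappa i.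
    by case: (ltnP i n) => [/nE//|ni]; rewrite !nth_default// (leq_trans _ ni).
  have sz (s t : seq nat) : is_partition s -> (forall i, nth 0%N s i = nth 0%N t i) -> (size s <= size t)%N.
    move=> ps st; rewrite leqNgt; apply/negP => ts.
    by have := partition_nth_gt0 ps ts; rewrite st nth_default.
  apply: (@eq_from_nth _ 0%N) => // ; apply/eqP; rewrite eqn_leq !sz//.
have T0 (i : 'I_n) : 0 <= (\sum_(l < i.+1) d l) * (g i - g i.+1).
  by rewrite mulr_ge0// (le_trans (ltW beta0)).
rewrite (bigD1 j)//=; apply: ltr_pwDl; last by apply: sumr_ge0 => i _; exact: T0.
by apply: mulr_gt0 => //; exact: lt_le_trans (gd _).
Qed.

Variable n : nat.

Lemma jack_sym kappa : is_partition kappa -> (size kappa <= n)%N -> symmetric_pred (C n kappa).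
Proof.
move=> pk kn; have [a [_ _ ->]] := jack_triangular jackC pk kn.
by apply: rpred_sum => mu _; apply: rpredZ; exact: monomial_sym_sym.
Qed.

Lemma dom_supp_dominates kappa mu (p : mpoly n R) : (size kappa <= n)%N -> (size mu <= n)%N ->
  sumn kappa = sumn mu -> dominates kappa mu -> dom_supp (psum mu) p -> dom_supp (psum kappa) p.
Proof.
move=> kn mn km dom; apply: dom_supp_le => [j _|]; first exact: dom.
by rewrite !psum_ge.
Qed.

Lemma jack_dom kappa : is_partition kappa -> (size kappa <= n)%N -> dom_supp (psum kappa) (C n kappa).
Proof.
move=> pk kn; have [a [_ a0 ->]] := jack_triangular jackC pk kn.
apply: dom_supp_sum => mu; rewrite mem_partitions => /and3P[pm /eqP mk mn].
have [d|nd] := pselect (dominates kappa mu); last first.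
  by rewrite a0// scale0r; exact: dom_supp0.
apply: dom_suppZ; apply: dom_supp_dominates d _ => //; exact: monomial_sym_dom.
Qed.

Lemma jack_coef kappa : is_partition kappa -> (size kappa <= n)%N ->
  mcoeff (mnm_part n kappa) (C n kappa) != 0.
Proof.
move=> pk kn; have [a [ak _ ->]] := jack_triangular jackC pk kn.
rewrite raddf_sum /= (bigD1_seq kappa) ?partitions_uniq//=; last by rewrite mem_partitions pk eqxx kn.
rewrite mcoeffZ coef_monomial_sym_part// eqxx mulr1 big1_seq ?addr0// => mu /andP[mk].
rewrite mem_partitions => /and3P[pm _ _].
by rewrite mcoeffZ coef_monomial_sym_part// eq_sym (negbTE mk) mulr0.
Qed.

(** Leading monomials are eliminated one by one: the leading exponents of a symmetric p form a
    partition mu dominated by kappa, and subtracting a multiple of C_mu keeps the support below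
    kappa. *)
Lemma jack_span kappa (p : mpoly n R) : (size kappa <= n)%N ->
  symmetric_pred p -> dom_supp (psum kappa) p ->
  exists2 b : seq nat -> R, (forall mu, b mu != 0 -> dominates kappa mu) &
    p = \sum_(mu <- partitions (sumn kappa) n) b mu *: C n mu.
Proof.
move=> kn; elim/mleadrect: p => p IH psym Kp.
have [->|p0] := eqVneq p 0.
  exists (fun=> 0) => [mu|]; first by rewrite eqxx.
  by rewrite big1// => mu _; rewrite scale0r.
have [mu [muP dom lp]] := sym_mlead_part psym Kp kn p0.
move: (muP); rewrite mem_partitions => /and3P[pm /eqP mk mn].
pose c := mcoeff (mlead p) p / mcoeff (mlead p) (C n mu).
have c1 : mcoeff (mlead p) (p - c *: C n mu) = 0.
  by rewrite mcoeffB mcoeffZ /c divfK ?subrr// lp jack_coef.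
have qsym : symmetric_pred (p - c *: C n mu).
  by apply: rpredB => //; apply: rpredZ; exact: jack_sym.
have qdom : dom_supp (psum kappa) (p - c *: C n mu).
  apply: dom_suppD => //; rewrite -scaleNr; apply: dom_suppZ.
  by apply: dom_supp_dominates dom _ => //; exact: jack_dom.
have sum1 : \sum_(nu <- partitions (sumn kappa) n) (if nu == mu then c else 0) *: C n nu = c *: C n mu.
  rewrite (bigD1_seq mu) ?partitions_uniq//= eqxx big1 ?addr0// => nu /negbTE ->.
  by rewrite scale0r.
have [q0|q0] := eqVneq (p - c *: C n mu) 0.
  exists (fun nu => if nu == mu then c else 0); last by rewrite sum1; apply/eqP; rewrite -subr_eq0 q0.
  by move=> nu; case: (nu =P mu) => [->//|]; rewrite eqxx.
have [|b bdom bE] := IH (p - c *: C n mu) _ qsym qdom.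
  rewrite lt_neqAle; apply/andP; split.
    by apply: contraNneq q0 => e; rewrite -mleadc_eq0 e c1.
  have := mlead_supp q0 => /msuppB_le; rewrite mem_cat => /orP[|/msuppZ_le].
    exact: msupp_le_mlead.
  by rewrite lp; apply: dom_supp_le_part => //; exact: jack_dom.
exists (fun nu => b nu + (if nu == mu then c else 0)).
  by move=> nu; case: (nu =P mu) => [->//|_]; rewrite addr0; exact: bdom.
under eq_bigr do rewrite scalerDl.
by rewrite big_split /= sum1 -bE subrK.
Qed.

(** The largest mu with a nonzero coefficient contributes a monomial that no other C_nu with a
    nonzero coefficient contains. *)
Lemma jack_free k (b : seq nat -> R) :
  \sum_(mu <- partitions k n) b mu *: C n mu = 0 ->
  forall mu, mu \in partitions k n -> b mu = 0.
Proof.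
move=> sum0 mu0 mu0P; apply/eqP/negPn/negP => b0.
have [|mu] := @seq_argmax _ _ _ (mnm_part n) [seq nu <- partitions k n | b nu != 0] mu0.
  by rewrite mem_filter b0.
rewrite mem_filter => /andP[bmu muP] mumax.
move: (muP); rewrite mem_partitions => /and3P[pm /eqP mk mn].
have := congr1 (mcoeff (mnm_part n mu)) sum0; rewrite mcoeff0 raddf_sum /=.
rewrite (bigD1_seq mu) ?partitions_uniq//= mcoeffZ big1_seq ?addr0 => [|nu /andP[numu nuP]].
  by move/eqP; rewrite mulf_eq0 (negbTE bmu) (negbTE (jack_coef pm mn)).
rewrite mcoeffZ; have [->|bnu] := eqVneq (b nu) 0; first by rewrite mul0r.
move: (nuP); rewrite mem_partitions => /and3P[pn /eqP nk nn].
apply/eqP; rewrite mulf_eq0 (negbTE bnu) /=; apply: contraNT numu.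
rewrite -mcoeff_msupp => /(dom_supp_le_part (jack_dom pn nn) nn) le1.
have le2 := mumax nu; rewrite mem_filter bnu nuP in le2.
have e : mnm_part n mu = mnm_part n nu by apply/le_anti; rewrite le1 le2.
have := coef_monomial_sym_part R pn nn pm; rewrite -e coef_monomial_sym_part// eqxx => /eqP.
by case: (nu == mu) => //; rewrite oner_eq0.
Qed.

(** In the expansion over the C_mu with mu below kappa, every mu other than kappa has a strictly
    smaller eigenvalue, so its coefficient vanishes. *)
Lemma jack_unique kappa (p : mpoly n R) : is_partition kappa -> (size kappa <= n)%N ->
  symmetric_pred p -> dom_supp (psum kappa) p ->
  (forall x, injective x -> (forall i, 0 < x i) ->
     jack_at beta x p = jack_eigenvalue n kappa * meval x p) ->
  exists c, p = c *: C n kappa.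
Proof.
move=> pk kn psym Kp peig; have [b bdom pE] := jack_span kn psym Kp.
have kP : kappa \in partitions (sumn kappa) n by rewrite mem_partitions pk eqxx.
have : \sum_(mu <- partitions (sumn kappa) n)
    (b mu * (jack_eigenvalue n mu - jack_eigenvalue n kappa)) *: C n mu = 0.
  apply: mpoly_vanish_generic => x xinj x0; rewrite meval_sum.
  have := peig x xinj x0; rewrite {1}pE linear_sum /= pE meval_sum mulr_sumr => /eqP.
  rewrite -subr_eq0 -sumrB => /eqP e; rewrite -[RHS]e; apply: eq_big_seq => mu.
  rewrite mem_partitions => /and3P[pm /eqP mk mn].
  have -> : jack_at beta x (b mu *: C n mu) = b mu * jack_op beta (C n mu) x.
    by rewrite -[jack_op _ _ _]/(jack_at beta x (C n mu)) linearZ.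
  by rewrite (jack_eigen jackC pm mn xinj) !mevalZ /jack_eigenvalue; ring.
move=> /jack_free b0; exists (b kappa); rewrite pE (bigD1_seq kappa) ?partitions_uniq//=.
rewrite big1_seq ?addr0// => mu /andP[mk muP]; have := b0 mu muP.
move: (muP); rewrite mem_partitions => /and3P[pm /eqP mk' mn].
move/eqP; rewrite mulf_eq0 => /orP[/eqP ->|]; first by rewrite scale0r.
have [->|bm] := eqVneq (b mu) 0; first by rewrite scale0r.
by rewrite subr_eq0 lt_eqF// jack_eigenvalue_lt//; exact: bdom.
Qed.

End JackFamily.

(** * Stability under setting the last variable to 0 *)

Section Restriction.
Variables (R : realType) (n : nat).
Implicit Types (p : mpoly n.+1 R) (x : 'I_n -> R).

Definition extend0 x (i : 'I_n.+1) : R := if unlift ord_max i is Some j then x j else 0.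

Definition restr_vars : n.+1.-tuple (mpoly n R) :=
  [tuple if unlift ord_max i is Some j then mpolyX R (mnm1 j) else 0 | i < n.+1].

(* p(x_1, ..., x_n, 0) *)
Definition restr p : mpoly n R := comp_mpoly restr_vars p.

Lemma extend0_lift x j : extend0 x (lift ord_max j) = x j.
Proof. by rewrite /extend0 liftK. Qed.

Lemma extend0_max x : extend0 x ord_max = 0.
Proof. by rewrite /extend0 unlift_none. Qed.

Lemma extend0_inj x : injective x -> (forall j, 0 < x j) -> injective (extend0 x).
Proof.
move=> xinj x0 i j; case: (unliftP ord_max i) => [i'|] ->; case: (unliftP ord_max j) => [j'|] ->;
  rewrite ?extend0_lift ?extend0_max//.
- by move=> /xinj ->.
- by move=> e; have := x0 i'; rewrite e ltxx.
- by move=> e; have := x0 j'; rewrite -e ltxx.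
Qed.

Lemma meval_restr x p : meval x (restr p) = meval (extend0 x) p.
Proof.
rewrite comp_mpoly_meval; apply: meval_eq => i; rewrite tnth_mktuple /extend0.
by case: (unlift ord_max i) => [j|]; rewrite ?mevalXU ?meval0.
Qed.

Lemma mderiv_restr p j : mderiv j (restr p) = restr (mderiv (lift ord_max j) p).
Proof.
rewrite mderiv_comp (bigD1 (lift ord_max j))//= tnth_mktuple liftK.
rewrite big1 => [|i ij].
  rewrite addr0 mderivX mnm1E eqxx scale1r (_ : mnm_sub _ _ = mnm0).
    by rewrite mpolyX0 mulr1.
  by apply/mnmP => l; rewrite mnmBE mnm0E subnn.
rewrite tnth_mktuple; move: ij; case: (unliftP ord_max i) => [k|] ->; last by rewrite mderiv0 mulr0.
rewrite (inj_eq lift_inj) => kj.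
by rewrite mderivX mnm1E (negbTE kj) scale0r mulr0.
Qed.

Lemma restr_sym p : symmetric_pred p -> symmetric_pred (restr p).
Proof.
move=> /issymP psym; apply/issymP => s; apply: mpoly_ext => x; rewrite meval_msym !meval_restr.
rewrite -[in RHS](psym (lift_perm ord_max ord_max s)) meval_msym; apply: meval_eq => i /=.
case: (unliftP ord_max i) => [j|] ->; first by rewrite lift_perm_lift !extend0_lift.
by rewrite lift_perm_id !extend0_max.
Qed.

Lemma restrE p : restr p = \sum_(m <- msupp p) mcoeff m p *: (0 ^+ (m ord_max) *:
  mpolyX R (Multinom [tuple m (lift ord_max j) | j < n])).
Proof.
rewrite /restr comp_mpolyE; apply: eq_bigr => m _; congr (_ *: _).
rewrite (bigD1_ord ord_max)//= tnth_mktuple unlift_none mpolyXE_id.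
rewrite (eq_bigr (fun j : 'I_n => mpolyX R (mnm1 j) ^+ m (lift ord_max j))) => [|j _]; last first.
  by rewrite tnth_mktuple liftK.
under [in RHS]eq_bigr do rewrite mnmE.
by rewrite !expr0n; case: eqP => _; rewrite ?mul1r ?scale1r// mul0r scale0r.
Qed.

Lemma restr_dom K p : K n.+1 = K n -> dom_supp K p -> dom_supp K (restr p).
Proof.
move=> Kn Kp; rewrite restrE; apply: dom_supp_sum => m mp; apply: dom_suppZ.
rewrite expr0n; case: eqP => [m0|_]; last by rewrite scale0r; exact: dom_supp0.
rewrite scale1r => m'; rewrite msuppX inE => /eqP ->; have [mJ mT] := Kp m mp; split.
  move=> J; have := mJ [set lift ord_max j | j in J]%SET.
  rewrite card_imset; last exact: lift_inj.
  rewrite big_imset /=; last by move=> i j _ _; exact: lift_inj.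
  by under [X in _ -> (X <= _)%N]eq_bigr do rewrite mnmE.
rewrite -Kn -mT (bigD1_ord ord_max)//= m0 add0n.
by apply: eq_bigr => j _; rewrite mnmE.
Qed.

(** The first n exponents sum to at most K n, less than the total degree, so every monomial contains
    the last variable. This is the case of a partition with n + 1 parts. *)
Lemma restr_eq0 K p : (K n < K n.+1)%N -> dom_supp K p -> restr p = 0.
Proof.
move=> Kn Kp; rewrite restrE big1_seq// => m /andP[_ /Kp[mJ mT]].
rewrite expr0n; case: eqP => [m0|_]; last by rewrite scale0r scaler0.
have := mJ [set lift ord_max j | j in 'I_n]%SET; rewrite card_imset ?card_ord; last exact: lift_inj.
rewrite big_imset /=; last by move=> i j _ _; exact: lift_inj.
by move: mT; rewrite (bigD1_ord ord_max)//= m0 add0n => ->; rewrite leqNgt Kn.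
Qed.

End Restriction.

Lemma euler_monomial (R : comNzRingType) n (x : 'I_n -> R) j (m : multinom n) :
  x j * meval x (mderiv j (mpolyX R m)) = (m j)%:R * meval x (mpolyX R m).
Proof.
rewrite mderivX mevalZ; case: (posnP (m j)) => [->|mj]; first by rewrite !mul0r mulr0.
rewrite mulrCA -(mevalXU x j) -mevalM [mpolyX R (mnm1 j) * _]mulrC -mpolyXD submK// lep1mP -lt0n//.
Qed.

Lemma euler_dom (R : realType) n K (p : mpoly n R) x : dom_supp K p ->
  \sum_(j < n) x j * meval x (mderiv j p) = (K n)%:R * meval x p.
Proof.
move=> Kp; rewrite {2}[p]mpolyE meval_sum mulr_sumr.
under eq_bigr do rewrite {1}[p]mpolyE mderiv_sum meval_sum mulr_sumr.
rewrite exchange_big; apply: eq_big_seq => m /Kp[_ <-].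
rewrite mevalZ natr_sum mulr_suml; apply: eq_bigr => j _.
by rewrite mderivZ mevalZ mulrCA euler_monomial; ring.
Qed.

(** At x_(n+1) = 0 the interaction of x_j with the last variable has coefficient x_j^2 / x_j, which
    adds beta times the Euler operator. This matches the change beta |kappa| of the eigenvalue
    between n and n + 1 variables. *)
Lemma jack_at_restr (R : realType) (beta : R) n (p : mpoly n.+1 R) x :
  injective x -> (forall j, 0 < x j) ->
  jack_at beta (extend0 x) p =
  jack_at beta x (restr p) + beta * \sum_(j < n) x j * meval x (mderiv j (restr p)).
Proof.
move=> xinj x0; rewrite /jack_at /jack_op.
rewrite (bigD1_ord ord_max)//= extend0_max expr0n mul0r add0r.
rewrite [X in beta * X](bigD1_ord ord_max)//= [X in beta * (X + _)]big1 ?add0r => [|i _]; last first.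
  by rewrite extend0_max expr0n !mul0r.
under [in RHS]eq_bigr do rewrite !mderiv_restr meval_restr.
under eq_bigr do rewrite extend0_lift.
rewrite -addrA; congr (_ + _); rewrite -mulrDr -big_split; congr (_ * _); apply: eq_bigr => j _ /=.
rewrite big_mkcond (bigD1_ord ord_max)//= extend0_lift extend0_max subr0.
rewrite neq_lift addrC mderiv_restr meval_restr.
congr (_ + _); last by rewrite expr2 mulfK ?gt_eqF.
rewrite [RHS]big_mkcond; by apply: eq_bigr => l _; rewrite (inj_eq lift_inj) extend0_lift.
Qed.

Section Stability.
Variables (R : realType) (beta : R) (C : forall m : nat, seq nat -> mpoly m R).
Hypotheses (beta0 : 0 < beta) (jackC : jack_family beta C).
Variable n : nat.

Lemma restr_jack_multiple kappa : is_partition kappa -> (size kappa <= n)%N ->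
  exists c, restr (C n.+1 kappa) = c *: C n kappa.
Proof.
move=> pk kn; have kn1 := leq_trans kn (leqnSn n).
have Kd := jack_dom jackC pk kn1.
have Kr : dom_supp (psum kappa) (restr (C n.+1 kappa)).
  by apply: restr_dom => //; rewrite !psum_ge.
apply: (jack_unique beta0 jackC) => //; first by apply: restr_sym; exact: (jack_sym jackC).
move=> x xinj x0; have := jack_at_restr beta (C n.+1 kappa) xinj x0.
rewrite (euler_dom _ Kr) psum_ge// {1}/jack_at.
rewrite (jack_eigen jackC pk kn1 (extend0_inj xinj x0)) -meval_restr.
move=> /eqP; rewrite -subr_eq => /eqP <-.
by rewrite /jack_eigenvalue -natr1; ring.
Qed.

(** All proportionality factors are found at once: restricting the sum of the C_mu, a power of x_1 +
    ... + x_(n+1), gives the same sum in n variables, and the C_mu are linearly independent. *)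
Lemma restr_jack kappa : is_partition kappa -> (size kappa <= n)%N ->
  restr (C n.+1 kappa) = C n kappa.
Proof.
move=> pk kn; set k := sumn kappa.
have /choice[c cE] : forall mu, exists c, is_partition mu && (size mu <= n)%N ->
    restr (C n.+1 mu) = c *: C n mu.
  move=> mu; case: (boolP (is_partition mu && (size mu <= n)%N)) => [/andP[pm mn]|_].
    by have [c] := restr_jack_multiple pm mn; exists c.
  by exists 0.
have : \sum_(mu <- partitions k n) (c mu - 1) *: C n mu = 0.
  under eq_bigr do rewrite scalerBl scale1r.
  rewrite sumrB (jack_sum jackC); apply/eqP; rewrite subr_eq0; apply/eqP.
  transitivity (restr (\sum_(mu <- partitions k n.+1) C n.+1 mu)).
    rewrite /restr raddf_sum /= [RHS](bigID (fun mu : seq nat => (size mu <= n)%N)) /=.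
    rewrite [X in _ = _ + X]big1_seq ?addr0 => [|mu].
      rewrite -[RHS]big_filter; apply: esym; rewrite (perm_big (partitions k n)) /=.
        rewrite -!/(restr _); apply: eq_big_seq => mu; rewrite mem_partitions => /and3P[pm _ mn].
        by apply: cE; rewrite pm.
      apply: uniq_perm; rewrite ?filter_uniq ?partitions_uniq// => mu.
      rewrite mem_filter !mem_partitions; case: (is_partition mu); rewrite /= ?andbF//.
      case: (sumn mu == k); rewrite /= ?andbF//; case: (ltnP n (size mu)) => //= h.
      by rewrite (leq_trans h).
    rewrite -ltnNge mem_partitions => /andP[nm /and3P[pm _ mn]].
    have szE : size mu = n.+1 by apply/eqP; rewrite eqn_leq nm mn.
    apply: (restr_eq0 (K := psum mu)); last exact: (jack_dom jackC).
    by rewrite !psumE big_ord_recr /= -[ltnLHS]addn0 ltn_add2l partition_nth_gt0// szE.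
  rewrite (jack_sum jackC) /restr rmorphXn /= raddf_sum /= (bigD1_ord ord_max)//=.
  rewrite comp_mpolyXU -tnth_nth tnth_mktuple unlift_none add0r; congr (_ ^+ _).
  by apply: eq_bigr => j _; rewrite comp_mpolyXU -tnth_nth tnth_mktuple liftK.
move=> /(jack_free jackC)/(_ kappa); rewrite mem_partitions pk eqxx kn => /(_ isT) /eqP.
by rewrite subr_eq0 => /eqP c1; rewrite cE ?pk// c1 scale1r.
Qed.

End Stability.

(** Since x_i d_i e_n = e_n for every i, moving e_n through the operator costs an Euler term and a
    constant. The constant is beta times the sum of the x_i / (x_i - x_j), where opposite pairs add
    up to 1. This serves to remove a full column from a partition. *)
Lemma jack_at_mul_esym (R : realType) (beta : R) n K (p : mpoly n R) x : dom_supp K p ->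
  injective x -> (forall i, 0 < x i) ->
  jack_at beta x (mesym n R n * p) = meval x (mesym n R n) *
    (jack_at beta x p + (2 * (K n)%:R + beta * (n%:R * (n%:R - 1) / 2)) * meval x p).
Proof.
move=> Kp xinj x0; set e := mesym n R n.
have xe i : x i * meval x (mderiv i e) = meval x e.
  have -> : e = mpolyX R (Multinom [tuple 1%N | i < n]).
    by rewrite /e mesymnnE mpolyXE_id; apply: eq_bigr => j _; rewrite mnmE.
  by rewrite euler_monomial mnmE mul1r.
have e2 i : mderiv i (mderiv i e) = 0 by exact: mderiv2_mesym_diag.
have sum1 : \sum_(i < n) \sum_(j < n | j != i) x i / (x i - x j) = n%:R * (n%:R - 1) / 2.
  have E := exchange_offdiag xpredT (fun i j => x i / (x i - x j)).
  have n1 := @sum_offdiag1 R n xpredT; rewrite /= in E n1.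
  have cn : #|(fun=> true) : pred 'I_n| = n by rewrite -[RHS](card_ord n); apply: eq_card.
  rewrite cn in n1; rewrite -n1; set S := \sum_(i < n) _ in E *.
  have -> : \sum_(i < n) \sum_(j < n | j != i) (1 : R) = S + S.
    rewrite {2}E -big_split; apply: eq_bigr => i _; rewrite -big_split; apply: eq_bigr => j ji /=.
    have xij : x i - x j != 0 by rewrite subr_eq0; apply: contraNneq ji => /xinj ->.
    have xji : x j - x i != 0 by rewrite -opprB oppr_eq0.
    by field; rewrite xij xji.
  by field.
have D2 i : x i ^+ 2 * meval x (mderiv i (mderiv i (e * p))) =
    meval x e * (x i ^+ 2 * meval x (mderiv i (mderiv i p)) + 2 * (x i * meval x (mderiv i p))).
  rewrite mderivM mderivD !mderivM e2 mul0r add0r !mevalD !mevalM -(xe i); ring.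
have D1 i j : x i ^+ 2 / (x i - x j) * meval x (mderiv i (e * p)) =
    meval x e * (x i ^+ 2 / (x i - x j) * meval x (mderiv i p)) +
    meval x e * meval x p * (x i / (x i - x j)).
  by rewrite mderivM mevalD !mevalM -(xe i); ring.
rewrite /jack_at /jack_op -/e; under eq_bigr do rewrite D2.
rewrite -mulr_sumr big_split /= -mulr_sumr (euler_dom x Kp).
have -> : \sum_(i < n) \sum_(j < n | j != i) x i ^+ 2 / (x i - x j) * meval x (mderiv i (e * p)) =
   meval x e * (\sum_(i < n) \sum_(j < n | j != i) x i ^+ 2 / (x i - x j) * meval x (mderiv i p)) +
   meval x e * meval x p * \sum_(i < n) \sum_(j < n | j != i) x i / (x i - x j).
  rewrite [X in _ = X + _]mulr_sumr [X in _ = _ + X]mulr_sumr -big_split; apply: eq_bigr => i _ /=.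
  rewrite [X in _ = X + _]mulr_sumr [X in _ = _ + X]mulr_sumr -big_split.
  by apply: eq_bigr => j _; exact: D1.
by rewrite sum1; ring.
Qed.


(** * The constant of the average and nonvanishing at (1, ..., 1) *)

Section Averages.
Variables (R : realType) (beta : R) (C : forall m : nat, seq nat -> mpoly m R).
Hypotheses (beta0 : 0 < beta) (jackC : jack_family beta C).

(** The relation for c is a product and not a quotient because the nonvanishing of C_kappa(1, ...,
    1) is itself deduced from it. *)
Lemma jack_average n kappa F (L : mpoly n.+1 R -> R) :
  is_partition kappa -> (size kappa <= n)%N ->
  comp_mpoly (esyms n.+1 R) F = C n.+1 kappa -> dom_weight (psum kappa) F ->
  dirichlet_functional (beta / 2) L ->
  exists2 c, forall lam, L (comp_mpoly (weps lam) F) = c * meval lam (C n.+1 kappa) &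
    c * meval (fun=> 1) (C n.+1 kappa) = L 1 * meval (fun=> 1) (C n kappa).
Proof.
move=> pk kn FC KF dL; have kn1 := leq_trans kn (leqnSn n).
have a0 : 0 < beta / 2 by rewrite divr_gt0.
have [A [AP AS]] := averaging dL F.
have eigF x : injective x -> (forall i, 0 < x i) ->
    jack_at beta x (comp_mpoly (esyms n.+1 R) F) =
    jack_eigenvalue beta n.+1 kappa * meval x (comp_mpoly (esyms n.+1 R) F).
  by move=> xinj _; rewrite FC; exact: (jack_eigen jackC).
have [|x xinj _|c cE] := jack_unique beta0 jackC pk kn1 (averaged_sym a0 dL AP).
- exact: averaged_dom_supp KF AS.
- exact: (averaged_eigen dL AP (erefl _) eigF).
have LA lam : L (comp_mpoly (weps lam) F) = c * meval lam (C n.+1 kappa).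
  by rewrite -(meval_averaged AP) cE mevalZ.
exists c => //; rewrite -LA mulrC.
have L0 : L 0 = 0 by have := dirichlet_linear dL (-1) 0 0; rewrite scaler0 addr0 mulN1r addNr.
have -> : meval (fun=> 1) (C n kappa) * L 1 = L (meval (fun=> 1) (C n kappa) *: 1).
  by have := dirichlet_linear dL (meval (fun=> 1) (C n kappa)) 1 0; rewrite L0 !addr0.
apply: (dirichlet_ext dL) => w w1; rewrite mevalZ meval1 mulr1.
rewrite (meval_comp_weps (fun=> 1) w) comp_mpoly_meval -(restr_jack beta0 jackC pk kn).
rewrite meval_restr -FC comp_mpoly_meval; apply: meval_eq.
apply: (@genf_inj _ _ _ _ 0) => t _; rewrite genf_eps.
under [RHS]eq_genf do rewrite tnth_mktuple.
rewrite genf_esyms_roots [in RHS](bigD1_ord ord_max)//= extend0_max subr0.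
under [in RHS]eq_bigr do rewrite extend0_lift.
rewrite prodr_const card_ord (eq_bigr (fun j => w j * (t%:R ^+ n.+1 - t%:R * (t%:R - 1) ^+ n))).
  by rewrite -mulr_suml w1 mul1r.
by move=> j _; rewrite prodr_const cardC1 card_ord.
Qed.

(** Supplied later by the integral over the sphere, whose total mass is positive. *)
Hypothesis dirichlet_exists : forall n, exists2 L : mpoly n.+1 R -> R,
  dirichlet_functional (beta / 2) L & L 1 != 0.

(** e_n C_mu has the support and the eigenvalue of kappa = mu + (1^n), so it is a multiple of
    C_kappa; at (1, ..., 1) the factor e_n is 1. *)
Lemma jack1_neq0_full n kappa mu : is_partition kappa -> is_partition mu ->
  size kappa = n -> (forall i, (i < n)%N -> nth 0%N kappa i = (nth 0%N mu i).+1) ->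
  (size mu <= n)%N -> meval (fun=> 1) (C n mu) != 0 -> meval (fun=> 1) (C n kappa) != 0.
Proof.
move=> pk pm kn kmu mn; apply: contraNneq => C0.
have kn' : (size kappa <= n)%N by rewrite kn.
have psE j : (j <= n)%N -> psum kappa j = (minn n j + psum mu j)%N.
  move=> jn; rewrite (minn_idPr jn) !psumE -[j in (j + _)%N]card_ord -sum1_card -big_split /=.
  by apply: eq_bigr => i _; rewrite kmu// (leq_trans (ltn_ord i)).
have Kd : dom_supp (psum kappa) (mesym n R n * C n mu).
  apply: (@dom_supp_le _ _ (fun j => minn n j + psum mu j)%N); last first.
  - exact: dom_suppM (dom_supp_mesym (leqnn n)) (jack_dom jackC pm mn).
  - by rewrite psE.
  - by move=> j jn; rewrite psE.
have [||c cE] := jack_unique beta0 jackC pk kn' _ Kd.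
- by apply: rpredM; [exact: mesym_sym|exact: (jack_sym jackC)].
- move=> x xinj x0; rewrite (jack_at_mul_esym beta (jack_dom jackC pm mn) xinj x0).
  rewrite {1}/jack_at (jack_eigen jackC pm mn xinj) mevalM psum_ge//.
  have sE : sumn kappa = (n + sumn mu)%N by rewrite -(psum_ge kn') -(psum_ge mn) psE// minnn.
  have rhoE : jack_rho beta kappa = jack_rho beta mu + 2 * (sumn mu)%:R - beta * (n%:R * (n%:R - 1) / 2).
    rewrite !(@jack_rhoE _ _ n)// -(psum_ge mn) psumE natr_sum mulr_sumr.
    have gauss : \sum_(i < n) (i : nat)%:R = n%:R * (n%:R - 1) / 2 :> R.
      elim: (n) => [|m IH]; first by rewrite big_ord0 mul0r mul0r.
      by rewrite big_ord_recr /= IH -natr1; field.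
    rewrite -gauss mulr_sumr -big_split -sumrB; apply: eq_bigr => i _ /=.
    by rewrite kmu// -natr1; ring.
  by rewrite /jack_eigenvalue rhoE sE natrD; field.
have := congr1 (meval (fun=> 1)) cE; rewrite mevalM mevalZ C0 mulr0 mesymnnE => /eqP.
rewrite mulf_eq0 => /orP[|//].
rewrite rmorph_prod big1 ?oner_eq0// => i _; exact: mevalXU.
Qed.

(** Induction on the number of variables, and inside it on |kappa|. A partition of full length loses
    its first column; a shorter one is treated by the average, whose constant links the values in n
    + 1 and in n variables. *)
Lemma jack1_neq0 n kappa : is_partition kappa -> (size kappa <= n)%N ->
  meval (fun=> 1) (C n kappa) != 0.
Proof.
elim: n kappa => [|n IHn] kappa.
  move=> pk; rewrite leqn0 => /nilP ->.
  have := jack_sum jackC 0 0; rewrite expr0.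
  have -> : partitions 0 0 = [:: [::]].
    have := @mem_partitions 0 0; have := partitions_uniq 0 0.
    case: (partitions 0 0) => [|a [|b s]] u memP.
    - by have := memP [::].
    - by have := memP a; rewrite mem_head leqn0 => /esym/and3P[_ _ /nilP ->].
    - have := memP a; rewrite mem_head => /esym/and3P[_ _]; rewrite leqn0 => /nilP a0.
      have := memP b; rewrite inE mem_head orbT => /esym/and3P[_ _]; rewrite leqn0 => /nilP b0.
      by move: u; rewrite a0 b0 cons_uniq inE eqxx.
  by rewrite big_seq1 => ->; rewrite meval1 oner_eq0.
have [k] := ubnP (sumn kappa); elim: k kappa => // k IHk kappa kk pk.
rewrite leq_eqVlt => /predU1P[kn|].
  pose mu := nonzero_parts [seq i.-1 | i <- kappa].
  have /andP[sk _] := pk.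
  have smap : sorted geq [seq i.-1 | i <- kappa].
    apply: (homo_sorted (e := geq) (e' := geq)) sk => x y; rewrite /= => yx.
    by rewrite -!subn1 leq_sub2r.
  have pm : is_partition mu by exact: is_partition_nonzero_parts.
  have mn : (size mu <= n.+1)%N by rewrite size_filter (leq_trans (count_size _ _))// size_map kn.
  have kmu i : (i < n.+1)%N -> nth 0%N kappa i = (nth 0%N mu i).+1.
    move=> lt_in; rewrite nth_nonzero_parts// (nth_map 0%N) ?kn// prednK//.
    by rewrite partition_nth_gt0// kn.
  apply: (jack1_neq0_full pk pm kn kmu mn); apply: IHk => //.
  have : (sumn mu < sumn kappa)%N.
    rewrite -(@psum_ge mu n.+1)// -(@psum_ge kappa n.+1) ?kn// !psumE !big_ord_recl !kmu//.
    rewrite -addSn leq_add// leq_sum// => i _; rewrite kmu//.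
  by move=> /leq_trans; apply; rewrite -ltnS.
rewrite ltnS => kn; have [L dL L1] := dirichlet_exists n.
have kn1 : (size kappa <= n.+1)%N by exact: leq_trans kn _.
have [F FE KF] := sym_dom_supp (jack_sym jackC pk kn1) (jack_dom jackC pk kn1).
have [c _ cE] := jack_average pk kn FE KF dL.
apply: contraNneq (mulf_neq0 L1 (IHn _ pk kn)) => C0.
by rewrite -cE C0 mulr0.
Qed.

End Averages.

(** * Gamma and beta integrals *)

Section ChangeOfVariable.
Local Open Scope classical_set_scope.
Variable R : realType.
Notation mu := (@lebesgue_measure R).

Lemma continuous_at_measurable (D : set R) (f : R -> R) : measurable D ->
  (forall x, D x -> {for x, continuous f}) -> measurable_fun D f.
Proof.
move=> mD cf; apply: subspace_continuous_measurable_fun => //.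
by apply: continuous_in_subspaceT => x /set_mem; exact: cf.
Qed.

Lemma continuous_at_comp (f g : R -> R) x : {for x, continuous f} ->
  {for f x, continuous g} -> {for x, continuous (fun y => g (f y))}.
Proof. by move=> cf cg; exact: continuous_comp. Qed.

Lemma continuous_at_mul (f g : R -> R) x : {for x, continuous f} ->
  {for x, continuous g} -> {for x, continuous (fun y => f y * g y)}.
Proof. by move=> cf cg; exact: continuousM. Qed.

Lemma is_derive_continuous (f : R -> R) (x df : R) : is_derive x 1 f df -> {for x, continuous f}.
Proof. by move=> [? _]; apply/differentiable_continuous/derivable1_diffP. Qed.

Variables (F F' f : R -> R) (D E : set R) (a b : nat -> R).
Hypotheses (ab : forall k, a k <= b k) (a_dec : forall k, a k.+1 <= a k)
  (b_inc : forall k, b k <= b k.+1).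
Hypotheses (Da : forall k, D (a k)) (Db : forall k, D (b k))
  (Dab : forall x, D x -> exists k, a k <= x <= b k).
Hypotheses (oD : open D) (Ditv : is_interval D) (Eitv : is_interval E).
Hypotheses (FD : forall x, D x -> E (F x)) (FE : forall y, E y -> exists2 x, D x & F x = y).
Hypotheses (Fhomo : forall x y, D x -> D y -> x < y -> F x < F y).
Hypotheses (dF : forall x, D x -> is_derive x 1 F (F' x)).
Hypotheses (F'0 : forall x, D x -> 0 <= F' x) (cF' : forall x, D x -> {for x, continuous F'}).
Hypotheses (f0 : forall y, E y -> 0 <= f y) (cf : forall y, E y -> {for y, continuous f}).

(* Exhausts D by compact intervals, where the change of variable formula for
   continuous functions applies. *)
Lemma change_of_variable :
  (\int[mu]_(y in E) (f y)%:E = \int[mu]_(x in D) (f (F x) * F' x)%:E)%E.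
Proof.
have dec k l : (k <= l)%N -> a l <= a k.
  by move=> /subnK <-; elim: (l - k)%N => // i; exact: le_trans (a_dec _).
have inc k l : (k <= l)%N -> b k <= b l.
  by move=> /subnK <-; elim: (l - k)%N => // i /le_trans; apply; exact: b_inc.
have Fle x y : D x -> D y -> x <= y -> F x <= F y.
  move=> Dx Dy; rewrite le_eqVlt => /predU1P[->//|/Fhomo xy]; exact/ltW/xy.
have subD k x : `[a k, b k] x -> D x.
  rewrite /= in_itv /= => xk; exact: (Ditv (Da k) (Db k) xk).
have subE k y : `[F (a k), F (b k)] y -> E y.
  rewrite /= in_itv /= => yk; exact: (Eitv (FD (Da k)) (FD (Db k)) yk).
have DE : D = \bigcup_k `[a k, b k].
  apply/seteqP; split=> [x /Dab[k kx]|x [k _]]; last exact: subD.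
  by exists k => //=; rewrite in_itv.
have EE : E = \bigcup_k `[F (a k), F (b k)].
  apply/seteqP; split=> [y /FE[x Dx <-]|y [k _]]; last exact: subE.
  have [k /andP[ax xb]] := Dab Dx; exists k => //=; rewrite in_itv /=.
  by rewrite !Fle.
have D1 x : D x -> F^`() x = F' x.
  by move=> Dx; rewrite derive1E; exact: (@derive_val _ _ _ _ _ _ _ (dF Dx)).
have cD1 x : D x -> {for x, continuous F^`()}.
  move=> Dx; rewrite /prop_for /continuous_at D1//; apply: cvg_trans (cF' Dx).
  apply: near_eq_cvg; near=> y; apply/esym/D1.
  by near: y; exact: (open_nbhs_nbhs (conj oD Dx)).
have cF x : D x -> {for x, continuous F}.
  move=> Dx; apply/differentiable_continuous/derivable1_diffP.
  exact: (@ex_derive _ _ _ _ _ _ _ (dF Dx)).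
have cG x : D x -> {for x, continuous (fun x => f (F x) * F' x)}.
  move=> Dx; apply: continuousM; last exact: cF'.
  by apply: continuous_comp; [exact: cF|exact/cf/FD].
have stepk k : (\int[mu]_(y in `[F (a k), F (b k)]) (f y)%:E =
   \int[mu]_(x in `[a k, b k]) (f (F x) * F' x)%:E)%E.
  rewrite integration_by_substitution_increasing//.
  - apply: eq_integral => x /set_mem xk; rewrite /= /GRing.mul /= D1 //; exact: subD xk.
  - by move=> x y xk yk; apply: Fhomo; [exact: (subD _ _ xk)|exact: (subD _ _ yk)].
  - move=> x; rewrite in_itv /= => /andP[ax xb]; apply: cD1.
    by apply: (subD k); rewrite /= in_itv /= !ltW.
  - by apply/cvg_ex; exists (F^`() (a k)); apply: cvg_at_right_filter; exact: cD1.
  - by apply/cvg_ex; exists (F^`() (b k)); apply: cvg_at_left_filter; exact: cD1.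
  - split.
    + move=> x; rewrite in_itv /= => /andP[ax xb].
      have Dx : D x by apply: (subD k); rewrite /= in_itv /= !ltW.
      exact: (@ex_derive _ _ _ _ _ _ _ (dF Dx)).
    + by apply: cvg_at_right_filter; exact: cF.
    + by apply: cvg_at_left_filter; exact: cF.
  - by apply: continuous_in_subspaceT => y /set_mem yk; apply: cf; exact: subE yk.
have cvgE : (\int[mu]_(y in `[F (a k), F (b k)]) (f y)%:E)%E @[k --> \oo] -->
    (\int[mu]_(y in E) (f y)%:E)%E.
  rewrite [in X in _ --> X]EE; apply: ge0_nondecreasing_set_cvg_integral => //.
  - move=> k l kl; apply/subsetPset => y; rewrite /= !in_itv /= => /andP[h1 h2].
    by rewrite (le_trans _ h1) ?(le_trans h2)//; apply: Fle => //; [exact: inc|exact: dec].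
  - move=> k; apply/measurable_EFinP; apply: continuous_at_measurable => // y yk.
    by apply: cf; exact: subE yk.
  - by move=> k y yk; rewrite lee_fin; apply: f0; exact: subE yk.
have cvgD : (\int[mu]_(x in `[a k, b k]) (f (F x) * F' x)%:E)%E @[k --> \oo] -->
    (\int[mu]_(x in D) (f (F x) * F' x)%:E)%E.
  rewrite [in X in _ --> X]DE; apply: ge0_nondecreasing_set_cvg_integral => //.
  - move=> k l kl; apply/subsetPset => y; rewrite /= !in_itv /= => /andP[h1 h2].
    by rewrite (le_trans _ h1) ?(le_trans h2)//; [exact: inc|exact: dec].
  - move=> k; apply/measurable_EFinP; apply: continuous_at_measurable => // y yk.
    by apply: cG; exact: subD yk.
  - move=> k y yk; have Dy := subD _ _ yk.
    by rewrite lee_fin mulr_ge0 ?F'0 ?f0//; exact: FD.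
move: cvgE; rewrite (_ : (fun k => _) = fun k => (\int[mu]_(x in `[a k, b k]) (f (F x) * F' x)%:E)%E).
  by move=> cvgE; exact: cvg_unique cvgE cvgD.
by apply/funext => k; exact: stepk.
Unshelve. all: by end_near. Qed.

End ChangeOfVariable.

Section OpenIntervals.
Local Open Scope classical_set_scope.
Variable R : realType.
Notation mu := (@lebesgue_measure R).

Lemma change_of_variable_oy (F F' f : R -> R) (p : R) (E : interval R) :
  (forall x, p < x -> F x \in E) ->
  (forall y, y \in E -> exists2 x, p < x & F x = y) ->
  (forall x y, p < x -> x < y -> F x < F y) ->
  (forall x, p < x -> is_derive x 1 F (F' x)) ->
  (forall x, p < x -> 0 <= F' x) -> (forall x, p < x -> {for x, continuous F'}) ->
  (forall y, y \in E -> 0 <= f y) -> (forall y, y \in E -> {for y, continuous f}) ->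
  (\int[mu]_(y in [set` E]) (f y)%:E = \int[mu]_(x in `]p, +oo[) (f (F x) * F' x)%:E)%E.
Proof.
move=> FD FE Fh dF F'0 cF' f0 cf.
have gtE x : `]p, +oo[ x = (p < x) :> Prop by rewrite /= in_itv /= andbT.
apply: (@change_of_variable R F F' f _ _ (fun k => p + k.+1%:R^-1) (fun k => p + k.+1%:R)).
- by move=> k; rewrite lerD2l (@le_trans _ _ 1)// ?invf_le1// ler1n.
- by move=> k; rewrite lerD2l lef_pV2 ?posrE// ler_nat.
- by move=> k; rewrite lerD2l ler_nat.
- by move=> k; rewrite gtE ltrDl.
- by move=> k; rewrite gtE ltrDl.
- move=> x; rewrite gtE -subr_gt0 => x0.
  pose m := maxn (Num.bound (x - p)) (Num.bound (x - p)^-1); exists m.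
  have h1 := archi_boundP (ltW x0).
  have h2 : (x - p)^-1 < (Num.bound (x - p)^-1)%:R by apply: archi_boundP; rewrite invr_ge0 ltW.
  apply/andP; split.
    rewrite -lerBrDl -[leRHS]invrK lef_pV2 ?posrE ?invr_gt0//; apply: (le_trans (ltW h2)).
    by rewrite ler_nat /m ltnW// ltnS leq_maxr.
  by rewrite -lerBlDl; apply: (le_trans (ltW h1)); rewrite ler_nat /m ltnW// ltnS leq_maxl.
- exact: interval_open.
- exact: interval_is_interval.
- exact: interval_is_interval.
- by move=> x; rewrite gtE; exact: FD.
- by move=> y /FE[x px <-]; exists x; rewrite ?gtE.
- by move=> x y; rewrite !gtE => px _; exact: Fh.
- by move=> x; rewrite gtE; exact: dF.
- by move=> x; rewrite gtE; exact: F'0.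
- by move=> x; rewrite gtE; exact: cF'.
- exact: f0.
- exact: cf.
Qed.

Lemma change_of_variable_oo (F F' f : R -> R) (p q : R) (E : interval R) : p < q ->
  (forall x, p < x < q -> F x \in E) ->
  (forall y, y \in E -> exists2 x, p < x < q & F x = y) ->
  (forall x y, p < x < q -> x < y -> F x < F y) ->
  (forall x, p < x < q -> is_derive x 1 F (F' x)) ->
  (forall x, p < x < q -> 0 <= F' x) -> (forall x, p < x < q -> {for x, continuous F'}) ->
  (forall y, y \in E -> 0 <= f y) -> (forall y, y \in E -> {for y, continuous f}) ->
  (\int[mu]_(y in [set` E]) (f y)%:E = \int[mu]_(x in `]p, q[) (f (F x) * F' x)%:E)%E.
Proof.
move=> pq FD FE Fh dF F'0 cF' f0 cf.
have gtE x : `]p, q[ x = (p < x < q) :> Prop by rewrite /= in_itv.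
(* The denominator starts at 2, so that p + h k <= q - h k. *)
pose h k : R := (q - p) / k.+2%:R.
have qp : 0 < q - p by rewrite subr_gt0.
have h0 k : 0 < h k by rewrite divr_gt0.
have h2 k : h k <= (q - p) / 2 by rewrite ler_pM2l// lef_pV2 ?posrE// ler_nat.
have hdec k : h k.+1 <= h k by rewrite ler_pM2l// lef_pV2 ?posrE// ler_nat.
apply: (@change_of_variable R F F' f _ _ (fun k => p + h k) (fun k => q - h k)).
- by move=> k; have := h2 k; lra.
- by move=> k; have := hdec k; lra.
- by move=> k; have := hdec k; lra.
- by move=> k; rewrite gtE; have := h0 k; have := h2 k; lra.
- by move=> k; rewrite gtE; have := h0 k; have := h2 k; lra.
- move=> x; rewrite gtE => /andP[px xq].
  have hsmall d : 0 < d -> exists k, forall l, (k <= l)%N -> h l <= d.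
    move=> d0; exists (Num.bound ((q - p) / d)) => l kl.
    have b : (q - p) / d < l.+2%:R.
      apply: (lt_le_trans (archi_boundP _)); first by rewrite divr_ge0// ltW.
      by rewrite ler_nat (leq_trans kl)// -addn2 leq_addr.
    by rewrite /h ler_pdivrMr// mulrC -ler_pdivrMr// ltW.
  have [k1 P1] := hsmall (x - p) ltac:(by rewrite subr_gt0).
  have [k2 P2] := hsmall (q - x) ltac:(by rewrite subr_gt0).
  exists (maxn k1 k2); have := P1 _ (leq_maxl k1 k2); have := P2 _ (leq_maxr k1 k2); lra.
- exact: interval_open.
- exact: interval_is_interval.
- exact: interval_is_interval.
- by move=> x; rewrite gtE; exact: FD.
- by move=> y /FE[x px <-]; exists x; rewrite ?gtE.
- by move=> x y; rewrite !gtE => px _; exact: Fh.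
- by move=> x; rewrite gtE; exact: F'0.
- by move=> x; rewrite gtE; exact: cF'.
- exact: f0.
- exact: cf.
Qed.

End OpenIntervals.

Section GammaBeta.
Local Open Scope classical_set_scope.
Variable R : realType.
Notation mu := (@lebesgue_measure R).
Implicit Types (a c s t x y : R).

(** Gamma with values in the extended reals, so that Tonelli's theorem can be used before finiteness
    is known; the real-valued [Gamma] would read an infinite integral as 0. *)
Definition egamma a : \bar R := (\int[mu]_(x in `]0%R, +oo[) (x `^ (a - 1) * expR (- x))%:E)%E.

Lemma powRB1 a x : 0 < x -> x `^ (a - 1) = x `^ a / x.
Proof. by move=> x0; rewrite powRB ?(gt_eqF x0) ?implybT// powRr1// ltW. Qed.

Lemma powR_continuous a x : 0 < x -> {for x, continuous (fun x => x `^ a)}.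
Proof.
move=> x0; apply/differentiable_continuous/derivable1_diffP.
by apply: derivable_powR; rewrite in_itv /= x0.
Qed.

Lemma expRN_continuous x : {for x, continuous (fun x : R => expR (- x))}.
Proof.
by apply: continuous_comp; [exact: continuousN|exact: continuous_expR].
Qed.

Lemma measurable_oy (f : R -> R) : (forall x, 0 < x -> {for x, continuous f}) ->
  measurable_fun (`]0, +oo[%classic : set R) f.
Proof.
move=> cf; apply: continuous_at_measurable => // x.
by rewrite /= in_itv /= andbT; exact: cf.
Qed.

(** Substitution of s x^2 in the Gamma integral. Read from right to left it writes the power s^(-a)
    as a mixture of Gaussians in x, which later splits a common denominator. *)
Lemma gauss_moment a s : 0 < s ->
  (\int[mu]_(x in `]0%R, +oo[) (x `^ (2 * a - 1) * expR (- (s * x ^+ 2)))%:E =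
   (2 * s `^ a)^-1%:E * egamma a)%E.
Proof.
move=> s0; have sa0 : 0 < 2 * s `^ a by rewrite mulr_gt0// powR_gt0.
have sqrt_pos y : 0 < y -> 0 < Num.sqrt (y / s) by move=> y0; rewrite sqrtr_gt0 divr_gt0.
have cF x : is_derive x 1 (fun x => s * x ^+ 2) (s * (2 * x)).
  have H := is_deriveZ s (is_deriveX 2 (is_derive_id x (1 : R^o))).
  have -> : s * (2 * x) = s *: ((2%:R * id x ^+ 2.-1) *: (1:R^o)).
    by rewrite /GRing.scale/= expr1 mulr1.
  exact: H.
rewrite /egamma (@change_of_variable_oy _ (fun x => s * x ^+ 2) (fun x => s * (2 * x))
  (fun x => x `^ (a - 1) * expR (- x)) 0).
- rewrite -ge0_integralZl//=; last 3 first.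
  + apply/measurable_EFinP; apply: measurable_oy => x x0.
    have sx0 : 0 < s * x ^+ 2 by rewrite mulr_gt0// exprn_gt0.
    have cs := is_derive_continuous (cF x).
    apply: continuous_at_mul; last first.
      by apply: continuous_at_mul; [exact: cst_continuous|apply: continuous_at_mul; [exact: cst_continuous|exact: cvg_id]].
    apply: continuous_at_mul.
      by apply: (@continuous_at_comp _ _ (fun t => t `^ (a - 1)) _ cs); exact: powR_continuous.
    by apply: (@continuous_at_comp _ _ (fun t => expR (- t)) _ cs); exact: expRN_continuous.
  + move=> x; rewrite in_itv /= andbT => x0.
    by rewrite lee_fin !mulr_ge0 ?expR_ge0 ?powR_ge0// ltW.
  + by rewrite lee_fin invr_ge0 ltW.
  apply: eq_integral => x; rewrite inE /= in_itv /= andbT => x0.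
  rewrite -EFinM; congr EFin.
  have x2 : (x ^+ 2) `^ a = x `^ (2 * a) by rewrite -powR_mulrn 1?ltW// -powRrM.
  rewrite !powRB1 ?mulr_gt0 ?exprn_gt0// powRM ?sqr_ge0 1?ltW// x2.
  have := powR_gt0 a s0; have := powR_gt0 (2 * a) x0.
  move: (s `^ a) (x `^ (2 * a)) => u v v0 u0.
  by field; rewrite !gt_eqF.
- by move=> x x0; rewrite in_itv /= andbT mulr_gt0// exprn_gt0.
- move=> y; rewrite in_itv /= andbT => y0; exists (Num.sqrt (y / s)); first exact: sqrt_pos.
  by rewrite sqr_sqrtr ?divr_ge0 1?ltW// mulrCA divff ?mulr1 ?gt_eqF.
- by move=> x y x0 xy; rewrite ltr_pM2l// ltr_pXn2r ?nnegrE// ltW// (lt_trans x0).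
- by move=> x x0; rewrite !mulr_ge0// ltW.
- move=> x _; apply: continuousM; first exact: cst_continuous.
  by apply: continuousM; [exact: cst_continuous|exact: cvg_id].
- by move=> y _; rewrite mulr_ge0 ?powR_ge0 ?expR_ge0.
- move=> y; rewrite in_itv /= andbT => y0.
  by apply: continuousM; [exact: powR_continuous|exact: expRN_continuous].
Qed.

End GammaBeta.

(** * The Beta integral, recurrence and positivity of Gamma *)

Section BetaGamma.
Local Open Scope classical_set_scope.
Variable R : realType.
Notation mu := (@lebesgue_measure R).
Implicit Types (a c s t : R).

Lemma integral_ife d (T : measurableType d) (m : {measure set T -> \bar R}) (D : set T)
    (b : pred T) (f : T -> \bar R) : (forall x, D x <-> b x) ->
  (\int[m]_(x in D) f x = \int[m]_x (if b x then f x else 0))%E.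
Proof.
move=> Db; rewrite integral_mkcond; apply: eq_integral => x _; rewrite patchE.
by case: (boolP (b x)) => [/Db/mem_set->|/negP nb]//; rewrite memNset// => /Db.
Qed.

Lemma integral_oy_ife (p : R) (f : R -> \bar R) :
  (\int[mu]_(x in `]p, +oo[) f x = \int[mu]_x (if (p < x)%R then f x else 0))%E.
Proof. by apply: integral_ife => x; rewrite /= in_itv /= andbT. Qed.

Lemma integral_if d (T : measurableType d) (m : {measure set T -> \bar R}) (D : set T)
    (b : pred T) (f : T -> R) : (forall x, D x <-> b x) ->
  (\int[m]_(x in D) (f x)%:E = \int[m]_x (if b x then f x else 0)%:E)%E.
Proof.
by move=> /integral_ife->; apply: eq_integral => x _; case: (b x).
Qed.

Lemma integral_oy_if (p : R) (f : R -> R) :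
  (\int[mu]_(x in `]p, +oo[) (f x)%:E = \int[mu]_x (if p < x then f x else 0)%:E)%E.
Proof. by apply: integral_if => x; rewrite /= in_itv /= andbT. Qed.

Lemma integral_oo_if (p q : R) (f : R -> R) :
  (\int[mu]_(x in `]p, q[) (f x)%:E = \int[mu]_x (if p < x < q then f x else 0)%:E)%E.
Proof. by apply: integral_if => x; rewrite /= in_itv. Qed.

Lemma measurable_powR_comp d (T : measurableType d) (f : T -> R) a :
  measurable_fun setT f -> measurable_fun setT (fun x => f x `^ a).
Proof. by move=> mf; apply: (measurableT_comp (measurable_powR a)). Qed.

Lemma measurable_expR_comp d (T : measurableType d) (f : T -> R) :
  measurable_fun setT f -> measurable_fun setT (fun x => expR (f x)).
Proof. by move=> mf; apply: measurableT_comp. Qed.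

Lemma measurable_expRN_comp d (T : measurableType d) (f : T -> R) :
  measurable_fun setT f -> measurable_fun setT (fun x => expR (- f x)).
Proof. by move=> mf; apply: measurable_expR_comp; apply: measurable_funN. Qed.

Lemma egamma_ge0 a : (0 <= egamma a)%E.
Proof.
apply: integral_ge0 => x _; by rewrite lee_fin mulr_ge0 ?powR_ge0 ?expR_ge0.
Qed.

Lemma measurable_gamma_integrand a :
  measurable_fun setT (fun x : R => x `^ (a - 1) * expR (- x)).
Proof.
apply: measurable_funM; first exact: measurable_powR.
exact: measurable_expRN_comp.
Qed.

Lemma egamma1 : egamma 1 = 1%E :> \bar R.
Proof.
rewrite -[RHS](@integral_exponential_pdf R 1 ltr01) /egamma.
transitivity (\int[mu]_(x in `[0%R, +oo[) (expR (- x))%:E)%E.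
  rewrite integral_itv_obnd_cbnd.
    by apply: eq_integral => x _; rewrite subrr powRr0 mul1r//.
  by apply/measurable_EFinP; apply: measurable_funTS; exact: measurable_gamma_integrand.
transitivity (\int[mu]_x (if 0 <= x then expR (- x) else 0)%:E)%E.
  by apply: integral_if => x; rewrite /= in_itv /= andbT.
apply: eq_integral => x _; rewrite /exponential_pdf patchE; congr EFin.
by rewrite mul1r mulN1r mem_setE in_itv /= andbT.
Qed.

Lemma egamma_shift c t :
  egamma c = (\int[mu]_(x in `]t, +oo[) ((x - t) `^ (c - 1) * expR (- (x - t)))%:E)%E.
Proof.
have dF (x : R) : t < x -> is_derive x 1 (fun x => x - t) 1.
  move=> _; have H := is_deriveB (is_derive_id x (1 : R^o)) (is_derive_cst t x (1 : R^o)).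
  by rewrite subr0 in H.
rewrite /egamma (@change_of_variable_oy _ (fun x => x - t) (fun=> 1)
  (fun x => x `^ (c - 1) * expR (- x)) t).
- by apply: eq_integral => x _; rewrite mulr1.
- by move=> x tx; rewrite in_itv /= andbT subr_gt0.
- move=> y; rewrite in_itv /= andbT => y0; exists (y + t); first by rewrite ltrDr.
  by rewrite addrK.
- by move=> x y _ xy; rewrite ltrD2r.
- by [].
- by move=> x _; exact: cst_continuous.
- by move=> y _; rewrite mulr_ge0 ?powR_ge0 ?expR_ge0.
- move=> y; rewrite in_itv /= andbT => y0.
  by apply: continuous_at_mul; [exact: powR_continuous|exact: expRN_continuous].
Qed.

(** The Beta integral in the variable y^2 with squared radius r, as it arises from integrating one
    coordinate over a ball. For r > 0 it is r^(a + c - 1) B(a, c) / 2. *)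
Definition ebeta a c r : \bar R :=
  (\int[mu]_(y in `]0%R, Num.sqrt r[) (y `^ (2 * a - 1) * (r - y ^+ 2) `^ (c - 1))%:E)%E.

Lemma ebeta_ge0 a c r : (0 <= ebeta a c r)%E.
Proof. by apply: integral_ge0 => x _; rewrite lee_fin mulr_ge0 ?powR_ge0. Qed.

Lemma lt_sqrt (y r : R) : 0 < y -> (y < Num.sqrt r) = (y ^+ 2 < r).
Proof.
move=> y0; case: (ltP 0 r) => [r0|r0]; last first.
  rewrite ler0_sqrtr// ltNge (ltW y0) ltNge; apply/esym/negbF.
  by rewrite (le_trans r0)// sqr_ge0.
by rewrite -{2}(sqr_sqrtr (ltW r0)) ltr_pXn2r ?nnegrE ?sqrtr_ge0// ltW.
Qed.

Lemma ebeta_integrand_measurable a c r :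
  measurable_fun setT (fun y : R => y `^ (2 * a - 1) * (r - y ^+ 2) `^ (c - 1)).
Proof.
apply: measurable_funM; first exact: measurable_powR.
apply: measurable_powR_comp; apply: measurable_funB; first exact: measurable_cst.
exact: measurable_funX.
Qed.

Lemma ebeta_integrand_continuous a c r y : 0 < y -> y ^+ 2 < r ->
  {for y, continuous (fun y : R => y `^ (2 * a - 1) * (r - y ^+ 2) `^ (c - 1))}.
Proof.
move=> y0 yr; apply: continuous_at_mul; first exact: powR_continuous.
apply: (@continuous_at_comp _ (fun y => r - y ^+ 2) (fun t => t `^ (c - 1))).
  apply: continuousB; first exact: cst_continuous.
  by apply: continuous_at_mul; exact: cvg_id.
by apply: powR_continuous; rewrite subr_gt0.
Qed.

Lemma ebeta_scale a c r : 0 < r -> ebeta a c r = ((r `^ (a + c - 1))%:E * ebeta a c 1)%E.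
Proof.
move=> r0; have sr0 : 0 < Num.sqrt r by rewrite sqrtr_gt0.
have dF (x : R) : 0 < x < 1 -> is_derive x 1 (fun x => Num.sqrt r * x) (Num.sqrt r).
  move=> _; have H := is_deriveZ (Num.sqrt r) (is_derive_id x (1 : R^o)).
  by rewrite /GRing.scale/= mulr1 in H.
rewrite /ebeta sqrtr1 (@change_of_variable_oo _ (fun x => Num.sqrt r * x) (fun=> Num.sqrt r)
  (fun y => y `^ (2 * a - 1) * (r - y ^+ 2) `^ (c - 1)) 0 1).
- rewrite -ge0_integralZl//=; last 3 first.
  + by apply/measurable_EFinP; apply: measurable_funTS; exact: ebeta_integrand_measurable.
  + by move=> x _; rewrite lee_fin mulr_ge0 ?powR_ge0.
  + by rewrite lee_fin powR_ge0.
  apply: eq_integral => x; rewrite inE /= in_itv /= => /andP[x0 x1].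
  rewrite -EFinM; congr EFin.
  have x21 : 0 < 1 - x ^+ 2 by rewrite subr_gt0 expr_lt1// ltW.
  have -> : r - (Num.sqrt r * x) ^+ 2 = r * (1 - x ^+ 2).
    by rewrite exprMn sqr_sqrtr ?ltW// mulrBr mulr1.
  rewrite (powRM _ (ltW sr0) (ltW x0)) (powRM _ (ltW r0) (ltW x21)).
  have -> : Num.sqrt r `^ (2 * a - 1) = r `^ a / Num.sqrt r.
    by rewrite powRB1// -powR12_sqrt 1?ltW// -powRrM mulrA mulVf ?mul1r// pnatr_eq0.
  have -> : r `^ (a + c - 1) = r `^ a * r `^ (c - 1).
    by rewrite -powRD ?addrA// (gt_eqF r0) implybT.
  by field; rewrite gt_eqF.
- by [].
- by move=> x /andP[x0 x1]; rewrite in_itv /= mulr_gt0// gtr_pMr.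
- move=> y; rewrite in_itv /= => /andP[y0 y1]; exists (y / Num.sqrt r).
    by rewrite divr_gt0// ltr_pdivrMr// mul1r.
  by rewrite mulrCA divff ?mulr1// gt_eqF.
- by move=> x y _ xy; rewrite ltr_pM2l.
- by move=> x _; rewrite ltW.
- by move=> x _; exact: cst_continuous.
- by move=> y _; rewrite mulr_ge0 ?powR_ge0.
- move=> y; rewrite in_itv /= => /andP[y0 y1].
  by apply: ebeta_integrand_continuous => //; rewrite -lt_sqrt.
Qed.

Lemma ebeta_a1 a : 0 < a -> ebeta a 1 1 = (2 * a)^-1%:E.
Proof.
move=> a0; have a20 : 0 < 2 * a by rewrite mulr_gt0.
transitivity (\int[mu]_(x in `]0%R, 1%R[) ((2 * a)^-1)%:E)%E; last first.
  by rewrite integral_cst//= lebesgue_measure_itv/= lte_fin ltr01 -EFinB subr0 mule1.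
have pR1 b : 1 `^ b = 1 :> R by rewrite powR1.
have dF (x : R) : 0 < x < 1 -> is_derive x 1 (fun x => x `^ (2 * a)) (2 * a * x `^ (2 * a - 1)).
  by move=> /andP[x0 _]; exact: is_derive1_powR.
rewrite /ebeta sqrtr1 (@change_of_variable_oo _ (fun x => x `^ (2 * a))
  (fun x => 2 * a * x `^ (2 * a - 1)) (fun=> (2 * a)^-1) 0 1).
- apply: eq_integral => x _; congr EFin.
  by rewrite subrr powRr0 mulr1 mulrA mulVf ?mul1r// gt_eqF.
- by [].
- move=> x /andP[x0 x1]; rewrite in_itv /= powR_gt0//=.
  by rewrite -[ltRHS](pR1 (2 * a)) gt0_ltr_powR ?nnegrE// ltW.
- move=> y; rewrite in_itv /= => /andP[y0 y1]; exists (y `^ (2 * a)^-1).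
    rewrite powR_gt0//= -[ltRHS](pR1 (2 * a)^-1) gt0_ltr_powR ?nnegrE ?invr_gt0// ltW//.
  by rewrite -powRrM mulVf ?powRr1 ?ltW// gt_eqF.
- move=> x y /andP[x0 _] xy; rewrite gt0_ltr_powR ?nnegrE// ltW// (lt_trans x0)//.
- by move=> x _; rewrite mulr_ge0 ?powR_ge0// ltW.
- move=> x /andP[x0 _]; apply: continuous_at_mul; first exact: cst_continuous.
  exact: powR_continuous.
- by move=> y _; rewrite invr_ge0 ltW.
- by move=> y _; exact: cst_continuous.
Qed.

(** Tonelli on the region 0 < y, y^2 < r: integrating over r first, with r - y^2 as the variable of
    Gamma(c), gives the product of the two Gammas; integrating over y first gives Beta integrals
    scaled by powers of r. *)
Lemma egamma_mul a c : (egamma a * egamma c = 2%:E * (ebeta a c 1 * egamma (a + c)))%E.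
Proof.
pose f y r := if (0 < y) && (y ^+ 2 < r) then
  y `^ (2 * a - 1) * ((r - y ^+ 2) `^ (c - 1) * expR (- r)) else 0 : R.
have f0 y r : 0 <= f y r.
  by rewrite /f; case: ifP => // _; rewrite !mulr_ge0 ?powR_ge0 ?expR_ge0.
have mf : measurable_fun setT (fun z : R * R => (f z.1 z.2)%:E).
  apply/measurable_EFinP; apply: measurable_fun_ifT => //.
    apply: measurable_and; apply: measurable_fun_ltr => //.
    exact: measurable_funX.
  apply: measurable_funM; first exact: measurable_powR_comp.
  apply: measurable_funM; last exact: measurable_expRN_comp.
  apply: measurable_powR_comp; apply: measurable_funB => //.
  exact: measurable_funX.
have := @fubini_tonelli _ _ _ _ _ mu mu (fun z : R * R => (f z.1 z.2)%:E) mf.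
move=> /(_ ltac:(by move=> z; rewrite lee_fin))/=.
have -> : (\int[mu]_y \int[mu]_r (f y r)%:E = 2^-1%:E * (egamma a * egamma c))%E.
  have := @gauss_moment R a 1 ltr01; rewrite powR1 mulr1 => g1.
  rewrite muleA -g1 -ge0_integralZr//; last 3 first.
  - apply/measurable_EFinP; apply: measurable_funTS; apply: measurable_funM.
      exact: measurable_powR.
    apply: measurable_expRN_comp; apply: measurable_funM => //; exact: measurable_funX.
  - by move=> x _; rewrite lee_fin mulr_ge0 ?powR_ge0 ?expR_ge0.
  - exact: egamma_ge0.
  rewrite [RHS]integral_oy_ife; apply: eq_integral => y _.
  case: ifPn => y0; last first.
    by under eq_integral do rewrite /f (negbTE y0) /=; rewrite integral0.
  rewrite (egamma_shift c (y ^+ 2)) -ge0_integralZl//; last 3 first.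
  - apply/measurable_EFinP; apply: measurable_funTS; apply: measurable_funM.
      by apply: measurable_powR_comp; exact: measurable_funB.
    by apply: measurable_expRN_comp; exact: measurable_funB.
  - by move=> x _; rewrite lee_fin mulr_ge0 ?powR_ge0 ?expR_ge0.
  - by rewrite lee_fin mulr_ge0 ?powR_ge0 ?expR_ge0.
  under [RHS]eq_integral do rewrite -EFinM.
  rewrite integral_oy_if; apply: eq_integral => r _; rewrite /f y0 /=; congr EFin.
  case: ifP => // _; rewrite opprB expRD mul1r expRN; field.
  by rewrite gt_eqF// expR_gt0.
have -> : (\int[mu]_r \int[mu]_y (f y r)%:E = ebeta a c 1 * egamma (a + c))%E.
  rewrite /egamma -ge0_integralZl//; last 3 first.
  - by apply/measurable_EFinP; apply: measurable_funTS; exact: measurable_gamma_integrand.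
  - by move=> x _; rewrite lee_fin mulr_ge0 ?powR_ge0 ?expR_ge0.
  - exact: ebeta_ge0.
  rewrite [RHS]integral_oy_ife; apply: eq_integral => r _.
  case: ifPn => r0; last first.
    rewrite -[RHS](@integral0 _ _ R mu setT); apply: eq_integral => y _; congr EFin.
    rewrite /f [_ < r]ltNge (@le_trans _ _ 0) ?sqr_ge0 ?andbF//.
    by rewrite leNgt.
  rewrite EFinM muleCA muleA -ebeta_scale//.
  rewrite /ebeta -ge0_integralZr//; last 2 first.
  - by apply/measurable_EFinP; apply: measurable_funTS; exact: ebeta_integrand_measurable.
  - by move=> x _; rewrite lee_fin mulr_ge0 ?powR_ge0.
  under [RHS]eq_integral do rewrite -EFinM.
  rewrite integral_oo_if; apply: eq_integral => y _; congr EFin; rewrite /f.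
  by case: (ltP 0 y) => //= y0; rewrite lt_sqrt// mulrA.
move=> <-; rewrite muleA -EFinM mulfV ?pnatr_eq0// mul1e.
by [].
Qed.

(** The case c = 1 of the product formula, where Gamma(1) = 1 and the Beta integral is explicit. *)
Lemma egammaS a : 0 < a -> egamma (a + 1) = (a%:E * egamma a)%E.
Proof.
move=> a0; have := egamma_mul a 1; rewrite ebeta_a1// egamma1 mule1 => ->.
rewrite !muleA -!EFinM.
by rewrite (_ : a * 2 * (2 * a)^-1 = 1) ?mul1e//; field; rewrite gt_eqF.
Qed.

Lemma egamma_nat n : (egamma (n.+1%:R : R) < +oo)%E.
Proof.
elim: n => [|n IH]; first by rewrite egamma1 ltry.
by rewrite -natr1 egammaS// lte_mul_pinfty// egamma_ge0.
Qed.

(** For b >= 1, x^(b - 1) <= 1 + x^n for some natural n, so integer arguments bound the integral;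
    arguments below 1 follow from the recurrence. *)
Lemma egamma_lty a : 0 < a -> (egamma a < +oo)%E.
Proof.
have ge1 (b : R) : 1 <= b -> (egamma b < +oo)%E.
  move=> b1; pose n := Num.bound b.
  have bn : b - 1 <= n%:R.
    by apply: (@le_trans _ _ b); [lra|exact/ltW/archi_boundP/(le_trans ler01)].
  apply: (@le_lt_trans _ _ (egamma 1 + egamma n.+1%:R)%E); last first.
    by apply: lte_add_pinfty; [exact: (egamma_nat 0)|exact: egamma_nat].
  have pos (d x : R) : (0 <= (x `^ (d - 1) * expR (- x))%:E)%E.
    by rewrite lee_fin mulr_ge0 ?powR_ge0 ?expR_ge0.
  have meas d : measurable_fun (`]0, +oo[%classic : set R) (fun x : R => (x `^ (d - 1) * expR (- x))%:E).
    by apply/measurable_EFinP; apply: measurable_funTS; exact: measurable_gamma_integrand.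
  have -> : (egamma 1 + egamma n.+1%:R = \int[mu]_(x in `]0%R, +oo[)
      ((x `^ (1 - 1) + x `^ (n.+1%:R - 1)) * expR (- x))%:E)%E.
    under [RHS]eq_integral do rewrite mulrDl EFinD.
    by rewrite ge0_integralD//; solve [exact: meas|move=> x _; exact: pos].
  apply: ge0_le_integral => //; first exact: meas.
    apply/measurable_EFinP; apply: measurable_funTS; apply: measurable_funM.
      by apply: measurable_funD; exact: measurable_powR.
    exact: measurable_expRN_comp.
  move=> x; rewrite /= in_itv /= andbT => x0; rewrite lee_fin.
  rewrite ler_pM2r ?expR_gt0// subrr powRr0 -natr1 addrK.
  have [x1|x1] := leP x 1.
    apply: (@le_trans _ _ 1); last by rewrite lerDl powR_ge0.
    by rewrite -[leRHS](powRr0 x); apply: ger_powR; [rewrite x0|lra].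
  apply: (@le_trans _ _ (x `^ n%:R)); last by rewrite lerDr.
  by apply: ler_powR => //; exact: ltW.
move=> a0; have [/ge1//|a1] := leP 1 a.
have := ge1 (a + 1) ltac:(lra); rewrite egammaS//.
have := egamma_ge0 a; case: (egamma a) => [r _|//|//]; rewrite ?ltry//.
by rewrite gt0_muley ?lte_fin.
Qed.

Lemma egammaE a : 0 < a -> egamma a = (Gamma a)%:E.
Proof. by move=> a0; rewrite /Gamma /Rintegral fineK// ge0_fin_numE ?egamma_ge0 ?egamma_lty. Qed.

Lemma GammaS a : 0 < a -> Gamma (a + 1) = a * Gamma a.
Proof.
move=> a0; have := egammaS a0; rewrite !egammaE ?addr_gt0//.
by rewrite -EFinM => -[].
Qed.

Lemma Gamma_gt0 a : 0 < a -> 0 < Gamma a.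
Proof.
have ge1 (b : R) : 1 <= b -> 0 < Gamma b.
  move=> b1; have b0 : 0 < b by exact: lt_le_trans b1.
  suff : (0 < egamma b)%E by rewrite egammaE.
  (* The interval ]1, 2[ alone gives this bound: there x^(b - 1) >= 1 and exp(-x) >= exp(-2). *)
  apply: (@lt_le_trans _ _ (expR (- 2))%:E); first by rewrite lte_fin expR_gt0.
  rewrite /egamma; apply: (@le_trans _ _ (\int[mu]_(x in `]1%R, 2%R[) (x `^ (b - 1) * expR (- x))%:E)%E).
    rewrite -[leLHS]mule1 -[X in (_ * X)%E](_ : lebesgue_measure (`]1, 2[%classic : set R) = 1%E); last first.
      by rewrite lebesgue_measure_itv/= lte_fin ltr1n -EFinB; congr EFin; lra.
    rewrite -integral_cst//; apply: ge0_le_integral => //.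
    - by move=> x _; rewrite lee_fin expR_ge0.
    - by apply/measurable_EFinP; apply: measurable_funTS; exact: measurable_gamma_integrand.
    move=> x; rewrite /= in_itv /= => /andP[x1 x2]; rewrite lee_fin.
    apply: (@le_trans _ _ (1 * expR (- x))); first by rewrite mul1r ler_expR lerN2 ltW.
    rewrite ler_pM2r ?expR_gt0// -[leLHS](powRr0 x); apply: ler_powR; [exact: ltW|lra].
  apply: ge0_subset_integral => //.
  - by apply/measurable_EFinP; apply: measurable_funTS; exact: measurable_gamma_integrand.
  - by move=> x _; rewrite lee_fin mulr_ge0 ?powR_ge0 ?expR_ge0.
  - move=> x; rewrite /= !in_itv /= => /andP[x1 _]; rewrite andbT; exact: lt_trans x1.
move=> a0; have := ge1 (a + 1) ltac:(lra); rewrite GammaS// pmulr_rgt0//.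
Qed.

Lemma ebetaE a c r : 0 < a -> 0 < c -> 0 < r ->
  ebeta a c r = (r `^ (a + c - 1) * (Gamma a * Gamma c / (2 * Gamma (a + c))))%:E.
Proof.
move=> a0 c0 r0; have ac0 : 0 < a + c by rewrite addr_gt0.
have Ga := Gamma_gt0 a0; have Gc := Gamma_gt0 c0; have Gac := Gamma_gt0 ac0.
rewrite ebeta_scale// EFinM; congr (_ * _)%E.
have := egamma_mul a c; rewrite !egammaE//.
have := ebeta_ge0 a c 1; case: (ebeta a c 1) => [x _|_|//].
  by rewrite -!EFinM => -[->]; congr EFin; field; rewrite gt_eqF.
by rewrite gt0_mulye ?lte_fin// gt0_muley ?lte_fin.
Qed.

End BetaGamma.

(** * Moments on the sphere *)


Section WeightedMoments.
Local Open Scope classical_set_scope.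
Variables (R : realType) (d : measure_display) (T : measurableType d).
Variables (mu : {measure set T -> \bar R}) (D : set T) (n : nat).
Variables (g : T -> R) (w : T -> 'I_n -> R).
Hypothesis mD : measurable D.
Hypothesis integrable_monomial : forall m : multinom n,
  mu.-integrable D (fun x => (g x * \prod_i w x i ^+ m i)%:E).

Lemma integrable_weighted (f : mpoly n R) :
  mu.-integrable D (fun x => (g x * meval (w x) f)%:E).
Proof.
have := @integrable_sum _ _ _ mu D mD _ (msupp f) xpredT
  (fun m x => ((mcoeff m f)%:E * (g x * \prod_i w x i ^+ m i)%:E)%E).
move=> /(_ (fun m _ => integrableZl mD _ (integrable_monomial m))).
apply: eq_integrable => // x _; rewrite sumEFin mevalE mulr_sumr; congr EFin.
by apply: eq_bigr => m _; rewrite mulrCA.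
Qed.

(** The common form of both averages: on the sphere [g] is the weight times the area element, for
    chi variables it is 1. *)
Definition weighted_integral (f : mpoly n R) : R :=
  fine (\int[mu]_(x in D) (g x * meval (w x) f)%:E).

Lemma weighted_integralE f :
  (\int[mu]_(x in D) (g x * meval (w x) f)%:E = (weighted_integral f)%:E)%E.
Proof. by rewrite fineK//; exact/integrable_fin_num/integrable_weighted. Qed.

Lemma weighted_integral_linear : linear_for *%R weighted_integral.
Proof.
move=> c p q; apply: EFin_inj; rewrite EFinD EFinM -!weighted_integralE.
rewrite -integralZl//; last exact: integrable_weighted.
rewrite -integralD//; [|exact/integrableZl/integrable_weighted|exact: integrable_weighted].
by apply: eq_integral => x _; rewrite -EFinM -EFinD mevalD mevalZ mulrDr mulrCA.
Qed.

Lemma weighted_integral_dirichlet a : (forall x, D x -> \sum_i w x i = 1) ->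
  (forall (m : multinom n) (i j : 'I_n),
    (a + (m i)%:R) * weighted_integral (mpolyX R (mnm_add m (mnm1 j))) =
    (a + (m j)%:R) * weighted_integral (mpolyX R (mnm_add m (mnm1 i)))) ->
  dirichlet_functional a weighted_integral.
Proof.
move=> w1 mom; split => //; first exact: weighted_integral_linear.
move=> f f0; rewrite /weighted_integral integral0_eq// => x Dx.
by rewrite f0 ?mulr0//; exact: w1.
Qed.

End WeightedMoments.

Section SphereMoments.
Local Open Scope classical_set_scope.
Variable R : realType.
Notation mu := (@lebesgue_measure R).
Implicit Types (a b c r s : R).

(** The cut-off at s <= 0 carries the indicators of the orthant and of the ball, so that integrals
    can run over all tuples; the shift by 1 makes a the parameter of the corresponding Gamma. *)
Definition pos_powR a s : R := if 0 < s then s `^ (a - 1) else 0.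

Lemma pos_powR_ge0 a s : 0 <= pos_powR a s.
Proof. by rewrite /pos_powR; case: ifP => // _; exact: powR_ge0. Qed.

Lemma measurable_pos_powR d (T : measurableType d) (f : T -> R) a :
  measurable_fun setT f -> measurable_fun setT (fun x => pos_powR a (f x)).
Proof.
move=> mf; apply: measurable_fun_ifT => //; first exact: measurable_fun_ltr.
exact: measurable_powR_comp.
Qed.

Lemma measurable_tnth_real m (i : 'I_m) :
  measurable_fun setT (fun y : m.-tuple R => tnth y i).
Proof. exact: (measurable_tnth (T := R)). Qed.

Lemma measurable_sumsq m : measurable_fun setT (fun y : m.-tuple R => \sum_(i < m) tnth y i ^+ 2).
Proof.
by apply: measurable_sum => i; apply: measurable_funX; exact: measurable_tnth_real.
Qed.

Definition orthant_integrand m (al : 'I_m -> R) b r (y : m.-tuple R) : R :=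
  \prod_(i < m) pos_powR (2 * al i) (tnth y i) * pos_powR b (r - \sum_(i < m) tnth y i ^+ 2).

Lemma orthant_integrand_ge0 m (al : 'I_m -> R) b r y : 0 <= orthant_integrand al b r y.
Proof. by rewrite mulr_ge0 ?pos_powR_ge0// prodr_ge0// => i _; exact: pos_powR_ge0. Qed.

Lemma measurable_orthant_integrand m (al : 'I_m -> R) b r :
  measurable_fun setT (orthant_integrand al b r).
Proof.
apply: measurable_funM.
  by apply: measurable_prod => i _; apply: measurable_pos_powR; exact: measurable_tnth_real.
apply: measurable_pos_powR; apply: measurable_funB; first exact: measurable_cst.
exact: measurable_sumsq.
Qed.

Lemma integral_lebesgue_cons m (f : m.+1.-tuple R -> \bar R) :
  measurable_fun setT f -> (forall y, 0 <= f y)%E ->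
  (\int[lebesgue_tuple R m.+1]_y f y =
   \int[mu]_x \int[lebesgue_tuple R m]_y f [tuple of x :: y])%E.
Proof.
move=> mf f0.
have mcons : measurable_fun [set: measurableTypeR R * m.-tuple R]
    (fun p => [tuple of p.1 :: p.2] : m.+1.-tuple R).
  exact: (measurable_cons (T2 := R) measurable_fst measurable_snd).
have := @ge0_integral_pushforward _ _ _ _ R _ mcons (@lebesgue_measure R \x lebesgue_tuple R m)%E
  setT f measurableT mf (fun y _ => f0 y).
rewrite preimage_setT => H.
rewrite [LHS]H fubini_tonelli1//.
- exact: measurableT_comp.
- by move=> x; exact: f0.
Qed.

(** Integrating out one coordinate reproduces a function of the same family with added parameters,
    which drives the induction on the dimension. *)
Lemma pos_powR_convolution a c r : 0 < a -> 0 < c ->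
  (\int[mu]_x (pos_powR (2 * a) x * pos_powR c (r - x ^+ 2))%:E =
   (pos_powR (a + c) r * (Gamma a * Gamma c / (2 * Gamma (a + c))))%:E)%E.
Proof.
move=> a0 c0; rewrite /pos_powR; have [r0|r0] := ltP 0 r; last first.
  rewrite mul0r; apply: integral0_eq => x _; congr EFin.
  by rewrite subr_gt0 [_ < r]ltNge (le_trans r0) ?sqr_ge0// mulr0.
rewrite -ebetaE// /ebeta integral_oo_if; apply: eq_integral => x _; congr EFin.
case: (ltP 0 x) => [x0|_]; last by rewrite mul0r.
by rewrite lt_sqrt// subr_gt0 /=; case: ifP; rewrite ?mulr0.
Qed.

(** A Dirichlet-Liouville integral, computed by peeling off the first coordinate. The squared radius
    r is general because the slice at x has squared radius r - x^2. *)
Lemma orthant_integral m (al : 'I_m -> R) b r : (forall i, 0 < al i) -> 0 < b ->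
  (\int[lebesgue_tuple R m]_y (orthant_integrand al b r y)%:E =
   (pos_powR (\sum_i al i + b) r *
    (\prod_i Gamma (al i) * Gamma b / (2 ^+ m * Gamma (\sum_i al i + b))))%:E)%E.
Proof.
move=> + b0; elim: m al r => [|m IH] al r al0.
  rewrite [lebesgue_tuple R 0]/= integral_dirac//; last first.
    by apply/measurable_EFinP; exact: measurable_orthant_integrand.
  rewrite diracT mul1e /orthant_integrand !big_ord0 add0r subr0 !mul1r.
  by rewrite divff ?mulr1// gt_eqF// Gamma_gt0.
rewrite integral_lebesgue_cons; last 2 first.
- by apply/measurable_EFinP; exact: measurable_orthant_integrand.
- by move=> y; rewrite lee_fin orthant_integrand_ge0.
have al'0 i : 0 < al (lift ord0 i) by [].
set s := \sum_(i < m) al (lift ord0 i).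
have s0 : 0 <= s by apply: sumr_ge0 => i _; exact/ltW.
set K := \prod_(i < m) Gamma (al (lift ord0 i)) * Gamma b / (2 ^+ m * Gamma (s + b)).
have K0 : 0 <= K.
  have G0 (z : R) : 0 < z -> 0 <= Gamma z by move=> /Gamma_gt0/ltW.
  rewrite !(mulr_ge0, invr_ge0, exprn_ge0)// ?G0// ?ltr_wpDl// .
  by apply: prodr_ge0 => i _; apply: G0.
transitivity (\int[mu]_x (K%:E * (pos_powR (2 * al ord0) x * pos_powR (s + b) (r - x ^+ 2))%:E))%E.
  apply: eq_integral => x _.
  transitivity ((pos_powR (2 * al ord0) x)%:E * \int[lebesgue_tuple R m]_y
    (orthant_integrand (fun i => al (lift ord0 i)) b (r - x ^+ 2) y)%:E)%E.
    rewrite -ge0_integralZl//; last 3 first.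
    - by apply/measurable_EFinP; exact: measurable_orthant_integrand.
    - by move=> y _; rewrite lee_fin orthant_integrand_ge0.
    - by rewrite lee_fin pos_powR_ge0.
    apply: eq_integral => y _; rewrite -EFinM; congr EFin.
    rewrite /orthant_integrand !big_ord_recl/= tnth0 mulrA opprD addrA.
    congr (_ * pos_powR _ _); last first.
      by congr (_ - _); apply: eq_bigr => i _; rewrite tnthS.
    by congr (_ * _); apply: eq_bigr => i _; rewrite tnthS.
  rewrite IH// -!EFinM; congr EFin; rewrite -/s -/K; ring.
rewrite ge0_integralZl//; last 2 first.
- apply/measurable_EFinP; apply: measurable_funM.
    exact: measurable_pos_powR.
  apply: measurable_pos_powR; apply: measurable_funB => //; exact: measurable_funX.
- by move=> x _; rewrite lee_fin mulr_ge0 ?pos_powR_ge0.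
rewrite pos_powR_convolution// ?ltr_wpDl// -EFinM !big_ord_recl -/s -addrA; congr EFin.
have Gs : Gamma (s + b) != 0 by rewrite gt_eqF// Gamma_gt0// ltr_wpDl.
have Gas : Gamma (al ord0 + (s + b)) != 0.
  by rewrite gt_eqF// Gamma_gt0// addr_gt0// ltr_wpDl.
have := expf_neq0 m (@lt0r_neq0 R 2 ltac:(by [])).
rewrite /K exprS; move: (2 ^+ m) Gs Gas; move: (Gamma (s + b)) (Gamma (_ + (s + b))).
move: (\prod_(i < m) _) (Gamma (al ord0)) (Gamma b) (pos_powR _ r) => p g1 g2 w g3 g4 t Gs Gas t0.
by field; rewrite Gs Gas t0.
Qed.

Lemma orthant_ball_sum m (y : m.-tuple R) : orthant_ball y -> 0 < 1 - \sum_(i < m) tnth y i ^+ 2.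
Proof. by move=> [_]; rewrite subr_gt0. Qed.

Lemma hemisphere_gt0 m (y : m.-tuple R) : orthant_ball y -> 0 < hemisphere y.
Proof. by move=> /orthant_ball_sum; rewrite sqrtr_gt0. Qed.

Lemma hemisphere_partial m (y : m.-tuple R) i : orthant_ball y ->
  partial_derivative (@hemisphere R m) i y = - tnth y i / hemisphere y.
Proof.
move=> yb; have h0 := hemisphere_gt0 yb; have s0 := orthant_ball_sum yb.
pose c := 1 - \sum_(j < m | j != i) tnth y j ^+ 2.
have hE t : hemisphere [tuple if j == i then t else tnth y j | j < m] = Num.sqrt (c - t ^+ 2).
  rewrite /hemisphere (bigD1 i)//= tnth_mktuple eqxx opprD addrA addrAC.
  rewrite /c; congr (Num.sqrt (1 - _ - _)); apply: eq_bigr => j ji.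
  by rewrite tnth_mktuple (negbTE ji).
have yE : hemisphere y = Num.sqrt (c - tnth y i ^+ 2).
  by rewrite -hE /hemisphere; congr (Num.sqrt (1 - _)); apply: eq_bigr => j _;
    rewrite tnth_mktuple; case: eqP => [->|].
have c0 : 0 < c - tnth y i ^+ 2 by rewrite -sqrtr_gt0 -yE.
rewrite /partial_derivative (_ : (fun t => _) = Num.sqrt \o (fun t => c - t ^+ 2)); last first.
  by apply/funext => t; rewrite hE.
have dx := is_deriveX 2 (is_derive_id (tnth y i) (1 : R^o)).
have dc := is_deriveB (is_derive_cst c (tnth y i) (1 : R^o)) dx.
have ds := is_derive1_sqrt c0.
rewrite derive1_comp; [|exact: (@ex_derive _ _ _ _ _ _ _ dc)|exact: (@ex_derive _ _ _ _ _ _ _ ds)].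
rewrite !derive1E (@derive_val _ _ _ _ _ _ _ ds) (@derive_val _ _ _ _ _ _ _ dc) -yE.
rewrite /GRing.scale/= expr1; field; exact: lt0r_neq0.
Qed.

Lemma hemisphere_area m (y : m.-tuple R) : orthant_ball y ->
  area_element (@hemisphere R m) y = (hemisphere y)^-1.
Proof.
move=> yb; have h0 := hemisphere_gt0 yb; have s0 := orthant_ball_sum yb.
rewrite /area_element (eq_bigr (fun i => tnth y i ^+ 2 / hemisphere y ^+ 2)); last first.
  by move=> i _; rewrite hemisphere_partial// exprMn sqrrN exprVn.
rewrite -mulr_suml; have hE : hemisphere y ^+ 2 = 1 - \sum_(i < m) tnth y i ^+ 2.
  by rewrite sqr_sqrtr// ltW.
rewrite -[X in 1 + X / _](subKr 1) -hE mulrBl divff ?expf_neq0 ?lt0r_neq0// mul1r addrCA subrr addr0.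
by rewrite -exprVn sqrtr_sqr gtr0_norm// invr_gt0.
Qed.

Lemma measurable_lt_set d (T : measurableType d) (f g : T -> R) :
  measurable_fun setT f -> measurable_fun setT g -> measurable [set x | f x < g x].
Proof.
move=> mf mg; have := measurable_fun_ltr mf mg measurableT (Y := [set true]) ltac:(by []).
by rewrite setTI.
Qed.

Lemma measurable_orthant_ball m : measurable (@orthant_ball R m).
Proof.
apply: measurableI; last first.
  by apply: measurable_lt_set; [exact: measurable_sumsq|exact: measurable_cst].
rewrite [X in measurable X](_ : _ = \bigcap_(i in [set: 'I_m]) [set y : m.-tuple R | 0 < tnth y i]).
  apply: fin_bigcap_measurable => // i _.
  by apply: measurable_lt_set; [exact: measurable_cst|exact: measurable_tnth_real].
by apply/seteqP; split=> y yA i; [move=> _; exact: yA|exact: (yA i I)].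
Qed.

Lemma sphere_point_gt0 m (y : m.-tuple R) i : orthant_ball y ->
  0 < (@sphere_point R m.+1 y) i ord0.
Proof. by move=> yb; have [+ _] := (sphere_pointP (@sphere_point R m.+1 y)).2 (ex_intro2 _ _ y yb erefl). Qed.

Lemma sphere_point_sum m (y : m.-tuple R) : orthant_ball y ->
  \sum_i @sphere_point R m.+1 y i ord0 ^+ 2 = 1.
Proof. by move=> yb; have [_ +] := (sphere_pointP (@sphere_point R m.+1 y)).2 (ex_intro2 _ _ y yb erefl). Qed.

(** The last coordinate is h = sqrt(1 - |y|^2) and the area element is 1 / h. Together they give
    h^(2 a - 2) = (1 - |y|^2)^(a - 1), so the exponent of the last coordinate becomes the parameter
    b of the integrand over the ball. *)
Lemma sphere_monomial m (al : 'I_m.+1 -> R) (y : m.-tuple R) : orthant_ball y ->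
  \prod_i @sphere_point R m.+1 y i ord0 `^ (2 * al i - 1) * area_element (@hemisphere R m) y =
  orthant_integrand (fun i => al (widen_ord (leqnSn m) i)) (al ord_max) 1 y.
Proof.
move=> yb; have h0 := hemisphere_gt0 yb; have s0 := orthant_ball_sum yb.
rewrite hemisphere_area// big_ord_recr /= /orthant_integrand -mulrA; congr (_ * _).
  apply: eq_bigr => i _; rewrite mxE/= (set_nth_default 0) ?size_tuple// -tnth_nth.
  by rewrite /pos_powR (yb.1 i).
rewrite mxE nth_default ?size_tuple// /pos_powR s0 !powRB1//.
have hE : hemisphere y ^+ 2 = 1 - \sum_(i < m) tnth y i ^+ 2 by rewrite sqr_sqrtr// ltW.
rewrite -hE -(powR_mulrn 2 (ltW h0)) -powRrM powR_mulrn ?ltW// expr2 invfM mulrA.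
by [].
Qed.

Lemma sphere_moment m (al : 'I_m.+1 -> R) : (forall i, 0 < al i) ->
  sphere_integral (fun q : 'cV[R]_m.+1 => \prod_i q i ord0 `^ (2 * al i - 1)) =
  (\prod_i Gamma (al i) / (2 ^+ m * Gamma (\sum_i al i)))%:E.
Proof.
move=> al0; rewrite /sphere_integral.
transitivity (\int[lebesgue_tuple R m]_y
  (orthant_integrand (fun i => al (widen_ord (leqnSn m) i)) (al ord_max) 1 y)%:E)%E.
  rewrite [RHS](_ : _ = \int[lebesgue_tuple R m]_(y in @orthant_ball R m)
    (orthant_integrand (fun i => al (widen_ord (leqnSn m) i)) (al ord_max) 1 y)%:E)%E.
    by apply: eq_integral => y /set_mem yb; rewrite sphere_monomial.
  rewrite [RHS]integral_mkcond; apply: eq_integral => y _; rewrite patchE.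
  case: ifPn => // /negP yb; congr EFin; rewrite /orthant_integrand.
  have [pos|/forallPn[k]] := altP (@forallP _ (fun i : 'I_m => 0 < tnth y i)); last first.
    by move=> yk; rewrite (bigD1 k)//= {1}/pos_powR (negbTE yk) !mul0r.
  rewrite {2}/pos_powR subr_gt0; case: ifPn => [yl|]; last by rewrite mulr0.
  by case: yb; apply/mem_set; split.
rewrite orthant_integral// big_ord_recr/= /pos_powR ltr01 powR1 mul1r.
by rewrite [\sum_(i < m.+1) _]big_ord_recr.
Qed.

Lemma sphere_moment_integrable m (al : 'I_m.+1 -> R) : (forall i, 0 < al i) ->
  sphere_integrable (fun q : 'cV[R]_m.+1 => \prod_i q i ord0 `^ (2 * al i - 1)).
Proof.
move=> al0; apply/integrableP; split.
  apply: (eq_measurable_fun (fun y => (orthant_integrand (fun i => al (widen_ord (leqnSn m) i)) (al ord_max) 1 y)%:E)).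
    by move=> y /set_mem yb; rewrite sphere_monomial.
  apply/measurable_EFinP; apply: measurable_funTS; exact: measurable_orthant_integrand.
rewrite (_ : (\int[_]_(_ in _) _)%E = sphere_integral (fun q : 'cV[R]_m.+1 => \prod_i q i ord0 `^ (2 * al i - 1))).
  by rewrite sphere_moment// ltry.
apply: eq_integral => y /set_mem yb; rewrite gee0_abs// lee_fin.
by rewrite sphere_monomial// orthant_integrand_ge0.
Qed.

(** The factor c does not depend on k and cancels when two indices are compared. It is 1 for Gamma
    on the sphere and 1 / (s + 1/2) for chi moments damped by exp(- s X^2). *)
Lemma prod_recurrence (G : R -> R) c n a (m : multinom n) k : 0 < a ->
  (forall x, 0 < x -> G (x + 1) = c * (x * G x)) ->
  \prod_i G (a + (mnm_add m (mnm1 k) i)%:R) = c * ((a + (m k)%:R) * \prod_i G (a + (m i)%:R)).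
Proof.
move=> a0 GS; rewrite (bigD1 k)//= [in RHS](bigD1 k)//= !mulrA; congr (_ * _).
  by rewrite mnmDE mnm1E eqxx addn1 -natr1 addrA GS ?mulrA// ltr_wpDr.
by apply: eq_bigr => l lk; rewrite mnmDE mnm1E eq_sym (negbTE lk) addn0.
Qed.

Lemma mdegDU n (m : multinom n) k : (\sum_i mnm_add m (mnm1 k) i)%N = (\sum_i m i).+1.
Proof. by rewrite -!mdegE mdegD mdeg1 addn1. Qed.

Lemma sphere_functional_exists n a : 0 < a ->
  exists L : mpoly n.+1 R -> R,
    [/\ dirichlet_functional a L,
        L 1 = Gamma a ^+ n.+1 / (2 ^+ n * Gamma (n.+1%:R * a)),
        (forall f, sphere_integrable (fun q : 'cV[R]_n.+1 =>
           \prod_i q i ord0 `^ (2 * a - 1) * meval (fun i => q i ord0 ^+ 2) f)) &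
        (forall f, sphere_integral (fun q : 'cV[R]_n.+1 =>
           \prod_i q i ord0 `^ (2 * a - 1) * meval (fun i => q i ord0 ^+ 2) f) = (L f)%:E)].
Proof.
move=> a0; have mD := @measurable_orthant_ball n.
have SM := @sphere_moment n.
have [G GE GS] : exists2 G, @Gamma R = G & forall x, 0 < x -> G (x + 1) = 1 * (x * G x).
  by exists (@Gamma R) => // x x0; rewrite mul1r GammaS.
rewrite GE in SM *.
pose g (y : n.-tuple R) := \prod_i (@sphere_point R n.+1 y) i ord0 `^ (2 * a - 1) *
  area_element (@hemisphere R n) y.
pose w (y : n.-tuple R) (i : 'I_n.+1) := (@sphere_point R n.+1 y) i ord0 ^+ 2.
have am0 (m : multinom n.+1) i : 0 < a + (m i)%:R by rewrite ltr_wpDr.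
(* Multiplying by q_i^(2 m_i) shifts the i-th parameter from a to a + m_i. *)
have gwE (m : multinom n.+1) y : orthant_ball y -> g y * \prod_i w y i ^+ m i =
    \prod_i (@sphere_point R n.+1 y) i ord0 `^ (2 * (a + (m i)%:R) - 1) * area_element (@hemisphere R n) y.
  move=> yb; rewrite /g mulrAC -big_split/=; congr (_ * _); apply: eq_bigr => i _.
  have q0 := sphere_point_gt0 i yb; rewrite /w -exprM -powR_mulrn ?ltW// -powRD.
    by congr powR; rewrite natrM; ring.
  by rewrite (gt_eqF q0) implybT.
have int_mono (m : multinom n.+1) : (lebesgue_tuple R n).-integrable (@orthant_ball R n)
    (fun y => (g y * \prod_i w y i ^+ m i)%:E).
  apply: eq_integrable (sphere_moment_integrable (am0 m)) => // y /set_mem yb.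
  by rewrite gwE.
pose L := weighted_integral (lebesgue_tuple R n) (@orthant_ball R n) g w.
have LX m : L (mpolyX R m) = \prod_i G (a + (m i)%:R) / (2 ^+ n * G (n.+1%:R * a + (\sum_i m i)%:R)).
  apply: EFin_inj; rewrite -weighted_integralE//.
  transitivity (sphere_integral (fun q : 'cV[R]_n.+1 => \prod_i q i ord0 `^ (2 * (a + (m i)%:R) - 1))).
    by apply: eq_integral => y /set_mem yb; rewrite mevalX gwE.
  rewrite SM//; congr (_ / (_ * G _))%:E.
  by rewrite big_split/= natr_sum sumr_const card_ord mulr_natl.
have LE f : sphere_integral (fun q : 'cV[R]_n.+1 =>
      \prod_i q i ord0 `^ (2 * a - 1) * meval (fun i => q i ord0 ^+ 2) f) = (L f)%:E.
  by rewrite -weighted_integralE//; apply: eq_integral => y _; rewrite mulrAC.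
exists L; split => //.
- apply: weighted_integral_dirichlet => //; first by move=> y; exact: sphere_point_sum.
  move=> m i j; rewrite -/L !LX.
  rewrite !(prod_recurrence _ _ a0 GS) !mdegDU.
  by move: (\prod_i _) (_ * G _) => u v; ring.
- have := LX mnm0; rewrite mpolyX0 => ->; congr (_ / (_ * G _)).
    rewrite (eq_bigr (fun=> G a)) ?prodr_const ?card_ord// => i _.
    by rewrite mnm0E addr0.
  by rewrite big1 ?addr0// => i _; exact: mnm0E.
- move=> f; apply: eq_integrable (integrable_weighted mD int_mono f) => // y _.
  by rewrite mulrAC.
Qed.

End SphereMoments.

(** * Independent chi variables *)


Section LayerCake.
Local Open Scope classical_set_scope.
Variable R : realType.
Notation mu := (@lebesgue_measure R).

Lemma integral_between (c y : R) : 0 <= c -> 0 <= y ->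
  (\int[mu]_t (if (0 <= t < y)%R then c else 0%R)%:E = (c * y)%:E)%E.
Proof.
move=> c0 y0; transitivity (\int[mu]_(t in `[0%R, y[) c%:E)%E.
  by apply/esym/integral_if => t; rewrite /= in_itv.
rewrite integral_cst//= lebesgue_measure_itv/= lte_fin; case: ltP => [_|y1].
  by rewrite -EFinB subr0.
by rewrite (@le_anti _ _ y 0) ?y1// mule0 mulr0.
Qed.

Lemma layer_cake d (T : measurableType d) (m : {sigma_finite_measure set T -> \bar R})
    (Z g : T -> R) : measurable_fun setT Z -> measurable_fun setT g ->
  (forall x, 0 <= Z x) -> (forall x, 0 <= g x) ->
  measurable_fun setT (fun t : R => \int[m]_x (if (0 <= t < g x)%R then Z x else 0%R)%:E)%E /\
  (\int[m]_x (Z x * g x)%:E =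
   \int[mu]_t \int[m]_x (if (0 <= t < g x)%R then Z x else 0%R)%:E)%E.
Proof.
move=> mZ mg Z0 g0.
have mf : measurable_fun setT
    (fun z : T * R => (if (0 <= z.2 < g z.1)%R then Z z.1 else 0%R)%:E).
  apply/measurable_EFinP; apply: measurable_fun_ifT => //; last exact: measurableT_comp.
  apply: measurable_and; first exact: measurable_fun_ler.
  by apply: measurable_fun_ltr => //; exact: measurableT_comp.
have f0 (z : T * R) : (0 <= (if (0 <= z.2 < g z.1)%R then Z z.1 else 0%R)%:E)%E.
  by case: ifP; rewrite ?lee_fin.
split; first exact: (measurable_fun_fubini_tonelli_G (m1 := m) _ mf f0).
rewrite -(@fubini_tonelli _ _ _ _ _ m mu _ mf f0)/=.
by apply: eq_integral => x _; rewrite integral_between.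
Qed.

(** The superlevel sets of [f] are measurable sets of values, so the layer-cake formula lifts an
    identity for indicators to nonnegative functions. It handles independence as well as the passage
    from a law to a density. *)
Lemma integral_comparison d1 d2 (T1 : measurableType d1) (T2 : measurableType d2)
    (m1 : {sigma_finite_measure set T1 -> \bar R}) (m2 : {sigma_finite_measure set T2 -> \bar R})
    (Z1 : T1 -> R) (Z2 : T2 -> R) (X1 : T1 -> R) (X2 : T2 -> R) (c : \bar R) (f : R -> R) :
  measurable_fun setT Z1 -> measurable_fun setT Z2 ->
  measurable_fun setT X1 -> measurable_fun setT X2 -> measurable_fun setT f ->
  (forall x, 0 <= Z1 x) -> (forall x, 0 <= Z2 x) -> (forall x, 0 <= f x) -> (0 <= c)%E ->
  (forall B : set R, measurable B -> \int[m1]_x (if X1 x \in B then Z1 x else 0%R)%:E =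
    c * \int[m2]_x (if X2 x \in B then Z2 x else 0%R)%:E)%E ->
  (\int[m1]_x (Z1 x * f (X1 x))%:E = c * \int[m2]_x (Z2 x * f (X2 x))%:E)%E.
Proof.
move=> mZ1 mZ2 mX1 mX2 mf Z10 Z20 f0 c0 H.
have [_ ->] := @layer_cake _ _ m1 Z1 (f \o X1) mZ1 (measurableT_comp mf mX1) Z10 (fun x => f0 _).
have [mi ->] := @layer_cake _ _ m2 Z2 (f \o X2) mZ2 (measurableT_comp mf mX2) Z20 (fun x => f0 _).
rewrite -ge0_integralZl//; last first.
  by move=> t _; apply: integral_ge0 => x _; case: ifP; rewrite ?lee_fin.
apply: eq_integral => t _.
pose B := [set x | (0 <= t) && (t < f x)].
have mB : measurable B.
  have : measurable_fun setT (fun x => (0 <= t) && (t < f x)).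
    by apply: measurable_and => //; exact: measurable_fun_ltr.
  by move=> /(_ measurableT [set true] ltac:(by [])); rewrite setTI.
have BE x : (x \in B) = (0 <= t < f x).
  by apply/idP/idP => [/set_mem//|]; exact: mem_set.
have := H B mB; rewrite /= => {}H.
under eq_integral do rewrite -BE.
by rewrite H; congr (_ * _)%E; apply: eq_integral => x _; rewrite BE.
Qed.

End LayerCake.

Section Independence.
Local Open Scope classical_set_scope.
Variables (R : realType) (d : measure_display) (T : measurableType d) (P : probability T R).
Variables (n : nat) (X : 'I_n -> {RV P >-> R}).
Hypothesis indep : mutually_independent X.

(* Replaces the indicator functions in the definition of independence by
   arbitrary functions one coordinate at a time. *)
Lemma integral_prod_independent (f : 'I_n -> R -> R) :
  (forall i, measurable_fun setT (f i)) -> (forall i x, 0 <= f i x) ->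
  (\int[P]_w (\prod_i f i (X i w))%:E = \prod_i \int[P]_w (f i (X i w))%:E)%E.
Proof.
have main (k : nat) : forall f : 'I_n -> R -> R, (k <= n)%N ->
    (forall i, measurable_fun setT (f i)) -> (forall i x, 0 <= f i x) ->
    (forall i : 'I_n, (k <= i)%N -> exists2 B : set R, measurable B & f i = \1_B) ->
    (\int[P]_w (\prod_i f i (X i w))%:E = \prod_i \int[P]_w (f i (X i w))%:E)%E.
  elim: k => [|k IH] {}f kn mf f0 fB.
    have /boolp.choice[B BP] (i : 'I_n) : exists B : set R, measurable B /\ f i = \1_B.
      by have [B mB fE] := fB i (leq0n _); exists B.
    have mXB i : measurable (X i @^-1` B i) by apply: measurable_funPTI; exact: (BP i).1.
    transitivity (P [set w | forall i, B i (X i w)]).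
      have mA : measurable [set w | forall i, B i (X i w)].
        rewrite [X in measurable X](_ : _ = \bigcap_(i in [set: 'I_n]) (X i @^-1` B i)).
          by apply: fin_bigcap_measurable.
        by apply/seteqP; split=> w wA i; [move=> _; exact: wA|exact: (wA i I)].
      rewrite -[X in _ = P X]setIT -[RHS]integral_indic//.
      apply: eq_integral => w _; congr EFin; rewrite indicE.
      case: (asboolP (forall i, B i (X i w))) => wB.
        rewrite mem_set// big1// => i _; rewrite (BP i).2 indicE mem_set//.
      rewrite memNset//; have /existsNP[i iB] := wB.
      by rewrite (bigD1 i)//= (BP i).2 indicE memNset// mul0r.
    rewrite indep; last by move=> i; exact: (BP i).1.
    apply: eq_bigr => i _.
    rewrite -[X in P X = _]setIT -[LHS]integral_indic//.
    by apply: eq_integral => w _; rewrite (BP i).2.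
  have ik : (k < n)%N by [].
  pose i0 := Ordinal ik.
  pose Z w := \prod_(i | i != i0) f i (X i w).
  have mfX i : measurable_fun setT (fun w => f i (X i w)).
    exact: measurableT_comp.
  have mZ : measurable_fun setT Z.
    rewrite (_ : Z = fun w => \prod_i (if i != i0 then f i (X i w) else 1)).
      by apply: measurable_prod => i _; case: (i != i0).
    by apply/funext => w; rewrite /Z big_mkcond.
  have Z0 w : 0 <= Z w by apply: prodr_ge0.
  set c := (\prod_(i | i != i0) \int[P]_w (f i (X i w))%:E)%E.
  have c0 : (0 <= c)%E.
    apply: (big_ind (fun x => 0 <= x)%E) => //; first by move=> x y; exact: mule_ge0.
    by move=> i _; apply: integral_ge0 => w _; rewrite lee_fin.
  rewrite [RHS](bigD1 i0)//= -/c muleC.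
  transitivity (\int[P]_w (Z w * f i0 (X i0 w))%:E)%E.
    by apply: eq_integral => w _; rewrite (bigD1 i0)//= mulrC.
  rewrite (@integral_comparison R _ _ _ _ P P Z (fun=> 1) (X i0) (X i0) c)//.
    by congr (_ * _)%E; apply: eq_integral => w _; rewrite mul1r.
  move=> B mB; pose f' i := if i == i0 then \1_B else f i.
  have := IH f' (ltnW ik); rewrite /f'.
  move=> IH'; transitivity (\int[P]_w (\prod_i f' i (X i w))%:E)%E.
    apply: eq_integral => w _; congr EFin; rewrite (bigD1 i0)//= /f' eqxx indicE.
    rewrite (eq_bigr (fun i => f i (X i w))) -/(Z w) => [|i /negbTE ->//].
    by case: ifP; rewrite ?mul1r ?mul0r.
  rewrite IH' => [|i|i x|i ki].
  - rewrite [LHS](bigD1 i0)//= eqxx muleC; congr (_ * _)%E.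
      by apply: eq_bigr => i /negbTE ->.
    by apply: eq_integral => w _; congr EFin; rewrite indicE; case: ifP.
  - by case: ifP.
  - by case: ifP => // _; rewrite indicE ler0n.
  - case: eqP => [_|ii0]; first by exists B.
    apply: fB; rewrite ltn_neqAle ki andbT; apply/eqP => kE; apply: ii0.
    exact/val_inj.
by move=> mf f0; apply: (main n) => // i; rewrite leqNgt ltn_ord.
Qed.

End Independence.

Section ChiMoments.
Local Open Scope classical_set_scope.
Variables (R : realType) (beta : R).
Hypothesis beta0 : 0 < beta.
Notation mu := (@lebesgue_measure R).

Lemma chi_pdf_ge0 x : 0 < x -> 0 <= chi_pdf beta x.
Proof.
move=> x0; rewrite /chi_pdf !mulr_ge0 ?powR_ge0 ?expR_ge0// invr_ge0 ltW//.
by rewrite Gamma_gt0// divr_gt0.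
Qed.

Lemma measurable_chi_pdf : measurable_fun setT (chi_pdf beta).
Proof.
apply: measurable_funM.
  by apply: measurable_funM; [exact: measurable_cst|exact: measurable_powR].
apply: measurable_expR_comp; apply: measurable_funM => //.
by apply: measurable_funN; exact: measurable_funX.
Qed.

Variables (d : measure_display) (T : measurableType d) (P : probability T R).

Lemma integral_chi (X : {RV P >-> R}) (f : R -> R) : chi_distributed beta X ->
  measurable_fun setT f -> (forall x, 0 <= f x) ->
  (\int[P]_w (f (X w))%:E = \int[mu]_(x in `]0%R, +oo[) (chi_pdf beta x * f x)%:E)%E.
Proof.
move=> chiX mf f0; pose Z x := if 0 < x then chi_pdf beta x else 0.
have mZ : measurable_fun setT Z.
  by apply: measurable_fun_ifT => //; [exact: measurable_fun_ltr|exact: measurable_chi_pdf].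
have Z0 x : 0 <= Z x by rewrite /Z; case: ifP => // /chi_pdf_ge0.
transitivity (\int[P]_w (1 * f (X w))%:E)%E.
  by apply: eq_integral => w _; rewrite mul1r.
rewrite (@integral_comparison R _ _ _ _ P mu (fun=> 1) Z X id 1%E)//; last first.
  move=> B mB; rewrite mul1e.
  transitivity (P (X @^-1` B)).
    rewrite -[X in _ = P X]setIT -[RHS]integral_indic//; last exact: measurable_funPTI.
    apply: eq_integral => w _; congr EFin; rewrite indicE.
    by rewrite -[w \in _]/(X w \in B); case: ifP.
  rewrite -[LHS]/(distribution P X B) chiX//.
  rewrite (@integral_if R _ _ mu _ (fun x => (x \in B) && (0 < x))).
    by apply: eq_integral => x _; rewrite /Z; case: (x \in B).
  move=> x; split=> [[Bx]|/andP[/set_mem Bx x0]].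
    by rewrite /= in_itv /= andbT => ->; rewrite mem_set.
  by split => //; rewrite /= in_itv /= x0.
rewrite mul1e integral_oy_if; apply: eq_integral => x _.
by rewrite /Z; case: ifP => //; rewrite mul0r.
Qed.

Lemma chi_gt0_ae (X : {RV P >-> R}) : chi_distributed beta X -> P [set w | 0 < X w] = 1%E.
Proof.
move=> chiX; have mp : measurable [set w | 0 < X w].
  by apply: measurable_lt_set.
have -> : [set w | 0 < X w] = ~` (X @^-1` `]-oo, 0%R]).
  apply/seteqP; split=> w w0.
    move=> h; have : X w \in (`]-oo, 0%R]%R : interval R) := h.
    by rewrite in_itv /= => /(lt_le_trans w0); rewrite ltxx.
  rewrite /= ltNge; apply/negP => h; apply: w0; change (X w \in (`]-oo, 0%R]%R : interval R)).
  by rewrite in_itv.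
rewrite probability_setC; last exact: measurable_funPTI.
rewrite -[P (X @^-1` _)]/(distribution P X _) chiX//.
rewrite [X in integral _ X](_ : _ = set0) ?integral_set0 ?sube0//.
apply/seteqP; split=> x //= []; rewrite !in_itv /= andbT => x1 x2.
by have := le_lt_trans x1 x2; rewrite ltxx.
Qed.

(** At y = beta / 2 + m this is the expectation of X^(2 m) exp(- s X^2); the 1/2 added to s is the
    Gaussian factor of the density. *)
Definition chi_gauss s y : R := 2 `^ (1 - beta / 2) / Gamma (beta / 2) * (Gamma y / (2 * (s + 2^-1) `^ y)).

Lemma chi_gauss_step s y : 0 <= s -> 0 < y ->
  chi_gauss s (y + 1) = (s + 2^-1)^-1 * (y * chi_gauss s y).
Proof.
move=> s0 y0; have s1 : 0 < s + 2^-1 by rewrite ltr_wpDl.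
rewrite /chi_gauss GammaS//; have := powRB1 (y + 1) s1; rewrite addrK => ->.
have := powR_gt0 (y + 1) s1; have : 0 < Gamma (beta / 2) by rewrite Gamma_gt0// divr_gt0.
move: (s + 2^-1) s1 => z z0; move: (z `^ (y + 1)) => q.
move: (Gamma (beta / 2)) (Gamma y) (2 `^ _) => u v p u0 q0.
by field; rewrite !gt_eqF.
Qed.

Lemma chi_gauss_moment (X : {RV P >-> R}) s m : chi_distributed beta X -> 0 <= s ->
  (\int[P]_w ((X w ^+ 2) ^+ m * expR (- (s * X w ^+ 2)))%:E = (chi_gauss s (beta / 2 + m%:R))%:E)%E.
Proof.
move=> chiX s0; have s1 : 0 < s + 2^-1 by rewrite ltr_wpDl.
have bm0 : 0 < beta / 2 + m%:R by rewrite ltr_wpDr// divr_gt0.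
have k0 : 0 <= 2 `^ (1 - beta / 2) / Gamma (beta / 2).
  by rewrite mulr_ge0 ?powR_ge0// invr_ge0 ltW// Gamma_gt0// divr_gt0.
rewrite (integral_chi (f := fun x => (x ^+ 2) ^+ m * expR (- (s * x ^+ 2)))) //; last 2 first.
- apply: measurable_funM; first by do 2 apply: measurable_funX.
  by apply: measurable_expRN_comp; apply: measurable_funM => //; exact: measurable_funX.
- by move=> x; rewrite mulr_ge0 ?expR_ge0// exprn_ge0// sqr_ge0.
rewrite /chi_gauss EFinM [X in (_ * X)%E](_ : _ = (2 * (s + 2^-1) `^ (beta / 2 + m%:R))^-1%:E *
  egamma (beta / 2 + m%:R))%E; last first.
  by rewrite egammaE// -EFinM; congr EFin; exact: mulrC.
rewrite -gauss_moment// -ge0_integralZl//; last 2 first.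
- apply/measurable_EFinP; apply: measurable_funTS; apply: measurable_funM.
    exact: measurable_powR.
  by apply: measurable_expRN_comp; apply: measurable_funM => //; exact: measurable_funX.
- by move=> x _; rewrite lee_fin mulr_ge0 ?powR_ge0 ?expR_ge0.
apply: eq_integral => x; rewrite inE /= in_itv /= andbT => x0.
rewrite -EFinM; congr EFin; rewrite /chi_pdf.
have -> : expR (- ((s + 2^-1) * x ^+ 2)) = expR (- x ^+ 2 / 2) * expR (- (s * x ^+ 2)).
  by rewrite -expRD; congr expR; field.
have -> : x `^ (2 * (beta / 2 + m%:R) - 1) = x `^ (beta - 1) * (x ^+ 2) ^+ m.
  rewrite -exprM -(powR_mulrn (2 * m) (ltW x0)) -powRD ?(gt_eqF x0) ?implybT//.
  by congr powR; rewrite natrM; field.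
by rewrite -!mulrA; congr (_ * (_ * (_ * _))); rewrite mulrCA.
Qed.

End ChiMoments.

Section ChiFunctional.
Local Open Scope classical_set_scope.
Variables (R : realType) (beta : R).
Hypothesis beta0 : 0 < beta.
Notation mu := (@lebesgue_measure R).
Variables (d : measure_display) (T : measurableType d) (P : probability T R).
Variables (n : nat) (X : 'I_n -> {RV P >-> R}).
Hypothesis chiX : forall i, chi_distributed beta (X i).
Hypothesis indep : mutually_independent X.

Let S w := \sum_i X i w ^+ 2.
Let u w i := X i w ^+ 2 / S w.
(** For n > 0 the ratios sum to 1 on [D]; off it, a null set, the denominator [S] may vanish. *)
Let D : set T := [set w | forall i, 0 < X i w].

Lemma measurable_positive : measurable D.
Proof.
rewrite [X in measurable X](_ : _ = \bigcap_(i in [set: 'I_n]) [set w | 0 < X i w]).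
  by apply: fin_bigcap_measurable => // i _; apply: measurable_lt_set.
by apply/seteqP; split=> w wA i; [move=> _; exact: wA|exact: (wA i I)].
Qed.

Lemma probability_positive : P D = 1%E.
Proof.
have := indep (B := fun=> [set x | 0 < x]); rewrite /D => ->.
  by apply: big1 => i _; exact: (chi_gt0_ae (chiX i)).
by move=> i; apply: measurable_lt_set.
Qed.

Lemma probability_nonpositive : P (~` D) = 0%E.
Proof.
by rewrite probability_setC ?probability_positive ?subee//; exact: measurable_positive.
Qed.

Lemma measurable_sum_squares : measurable_fun setT S.
Proof. by apply: measurable_sum => i; apply: measurable_funX. Qed.

Lemma sum_squares_ge0 w : 0 <= S w.
Proof. by apply: sumr_ge0 => i _; exact: sqr_ge0. Qed.

Lemma sum_squares_gt0 w : (0 < n)%N -> D w -> 0 < S w.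
Proof.
move=> n0 Dw; rewrite /S (bigD1 (Ordinal n0))//=.
apply: ltr_wpDr; first by apply: sumr_ge0 => i _; exact: sqr_ge0.
by rewrite exprn_gt0//; exact: (Dw (Ordinal n0)).
Qed.

Lemma ratio_ge0 w i : 0 <= u w i.
Proof. by rewrite divr_ge0 ?sqr_ge0 ?sum_squares_ge0. Qed.

Lemma ratio_le1 w i : u w i <= 1.
Proof.
have := sum_squares_ge0 w; rewrite le_eqVlt => /predU1P[S0|S0].
  by rewrite /u -S0 invr0 mulr0 ler01.
rewrite ler_pdivrMr// mul1r /S (bigD1 i)//= lerDl.
by apply: sumr_ge0 => j _; exact: sqr_ge0.
Qed.

Lemma sum_ratio w : S w != 0 -> \sum_i u w i = 1.
Proof. by move=> S0; rewrite -mulr_suml divff. Qed.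

Lemma measurable_ratio i : measurable_fun setT (fun w => u w i).
Proof.
apply: measurable_funM; first exact: measurable_funX.
rewrite (_ : (fun w => _) = fun w => (S w) `^ (-1)); last first.
  by apply/funext => w; rewrite powR_inv1// sum_squares_ge0.
by apply: measurable_powR_comp; exact: measurable_sum_squares.
Qed.

Lemma monomial_integrable (m : multinom n) :
  P.-integrable setT (fun w => (1 * \prod_i u w i ^+ m i)%:E).
Proof.
have := @finite_measure_integrable_cst _ T R P setT 1 measurableT.
apply: le_integrable => //.
  apply/measurable_EFinP; apply: measurable_funM => //.
  by apply: measurable_prod => i _; apply: measurable_funX; exact: measurable_ratio.
move=> w _ /=; rewrite lee_fin mul1r normr1 ger0_norm.
  by apply: prodr_ile1 => i _; rewrite exprn_ge0 ?ratio_ge0// exprn_ile1 ?ratio_ge0 ?ratio_le1.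
by apply: prodr_ge0 => i _; rewrite exprn_ge0 ?ratio_ge0.
Qed.

Lemma inverse_power s k : 0 < s -> (0 < k)%N ->
  (\int[mu]_(x in `]0%R, +oo[) (x `^ (2 * k%:R - 1) * expR (- (s * x ^+ 2)))%:E =
   (Gamma k%:R / 2 * s ^- k)%:E)%E.
Proof.
move=> s0 k0; rewrite gauss_moment// egammaE ?ltr0n// -EFinM powR_mulrn ?ltW//.
by rewrite invfM mulrC mulrA.
Qed.

(** The common denominator S^k couples the coordinates. Writing S^(-k) as an integral of exp(- x^2
    S) over x makes the integrand a product over i, to which independence applies after Tonelli. The
    right-hand side is left as an integral, since its dependence on m through [chi_gauss] already
    gives the moment relation. *)
Lemma ratio_moment (m : multinom n) : (0 < n)%N -> (0 < \sum_i m i)%N ->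
  ((Gamma (\sum_i m i)%:R / 2)%:E * \int[P]_(w in D) (1 * \prod_i u w i ^+ m i)%:E =
   \int[mu]_(x in `]0%R, +oo[) (x `^ (2 * (\sum_i m i)%:R - 1) *
     \prod_i chi_gauss beta (x ^+ 2) (beta / 2 + (m i)%:R))%:E)%E.
Proof.
move=> n0; set k := (\sum_i m i)%N => k0; have mD := measurable_positive.
have Gk : 0 < Gamma (k%:R : R) / 2 by rewrite divr_gt0// Gamma_gt0// ltr0n.
pose h (w : T) (x : R) := if 0 < x then x `^ (2 * k%:R - 1) *
  \prod_i ((X i w ^+ 2) ^+ m i * expR (- (x ^+ 2 * X i w ^+ 2))) else 0.
have h0 w x : 0 <= h w x.
  rewrite /h; case: ifP => // _; rewrite mulr_ge0 ?powR_ge0//.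
  by apply: prodr_ge0 => i _; rewrite mulr_ge0 ?expR_ge0// exprn_ge0// sqr_ge0.
have mh : measurable_fun setT (fun z : T * R => (h z.1 z.2)%:E).
  apply/measurable_EFinP; apply: measurable_fun_ifT => //; first exact: measurable_fun_ltr.
  apply: measurable_funM; first exact: measurable_powR_comp.
  apply: measurable_prod => i _.
  have mX : measurable_fun setT (fun z : T * R => X i z.1) by exact: measurableT_comp.
  apply: measurable_funM; first by do 2 apply: measurable_funX.
  apply: measurable_expRN_comp; apply: measurable_funM; exact: measurable_funX.
have mF := measurable_fun_fubini_tonelli_F (m2 := mu) _ mh (fun z => h0 z.1 z.2).
have Tonelli := @fubini_tonelli _ _ _ _ _ P mu (fun z : T * R => (h z.1 z.2)%:E) mh
  (fun z => h0 z.1 z.2).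
transitivity (\int[P]_w \int[mu]_x (h w x)%:E)%E; last first.
  rewrite [LHS]Tonelli integral_oy_ife; apply: eq_integral => x _ /=.
  rewrite /h; case: ifPn => x0; last by rewrite integral0.
  transitivity ((x `^ (2 * k%:R - 1))%:E *
    \int[P]_w (\prod_i ((X i w ^+ 2) ^+ m i * expR (- (x ^+ 2 * X i w ^+ 2))))%:E)%E.
    rewrite -ge0_integralZl//.
    - apply/measurable_EFinP; apply: measurable_prod => i _; apply: measurable_funM.
        by do 2 apply: measurable_funX.
      by apply: measurable_expRN_comp; apply: measurable_funM => //; exact: measurable_funX.
    - by move=> w _; rewrite lee_fin; apply: prodr_ge0 => i _;
        rewrite mulr_ge0 ?expR_ge0// exprn_ge0// sqr_ge0.
    - by rewrite lee_fin powR_ge0.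
  rewrite (integral_prod_independent indep
    (f := fun i y => (y ^+ 2) ^+ m i * expR (- (x ^+ 2 * y ^+ 2)))).
  - rewrite EFinM; congr (_ * _)%E; rewrite -prodEFin; apply: eq_bigr => i _.
    by rewrite (chi_gauss_moment beta0 _ (chiX i))// sqr_ge0.
  - move=> i; apply: measurable_funM; first by do 2 apply: measurable_funX.
    by apply: measurable_expRN_comp; apply: measurable_funM => //; exact: measurable_funX.
  - by move=> i y; rewrite mulr_ge0 ?expR_ge0// exprn_ge0// sqr_ge0.
(* Off [D] the sum of squares may be 0, where the Gaussian formula for its inverse power fails. *)
rewrite [RHS](@ge0_negligible_integral _ _ _ _ _ (~` D))//; last 3 first.
- by apply: measurableC; exact: measurable_positive.
- by move=> w _; apply: integral_ge0 => x _; rewrite lee_fin.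
- exact: probability_nonpositive.
rewrite setDE setCK setTI -ge0_integralZl//; last 3 first.
- have := integrableP _ _ _ (monomial_integrable m).
  by move=> [+ _]; apply: measurable_funTS.
- by move=> w _; rewrite lee_fin mul1r; apply: prodr_ge0 => i _; rewrite exprn_ge0 ?ratio_ge0.
- by rewrite lee_fin ltW.
apply: eq_integral => w /set_mem Dw.
have S0 := sum_squares_gt0 n0 Dw.
transitivity ((\prod_i (X i w ^+ 2) ^+ m i)%:E *
  \int[mu]_(x in `]0%R, +oo[) (x `^ (2 * k%:R - 1) * expR (- (S w * x ^+ 2)))%:E)%E.
  rewrite inverse_power// -!EFinM; congr EFin; rewrite mul1r.
  rewrite [X in _ * X = _](_ : _ = \prod_i (X i w ^+ 2) ^+ m i * S w ^- k).
    by rewrite mulrCA.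
  rewrite /u (eq_bigr (fun i => (X i w ^+ 2) ^+ m i * (S w)^-1 ^+ m i)) => [|i _]; last by rewrite exprMn.
  by rewrite big_split/= -exprVn; congr (_ * _); rewrite /k expr_sum.
rewrite -ge0_integralZl//; last 3 first.
- apply/measurable_EFinP; apply: measurable_funTS; apply: measurable_funM.
    exact: measurable_powR.
  by apply: measurable_expRN_comp; apply: measurable_funM => //; exact: measurable_funX.
- by move=> x _; rewrite lee_fin mulr_ge0 ?powR_ge0 ?expR_ge0.
- by rewrite lee_fin; apply: prodr_ge0 => i _; rewrite exprn_ge0// sqr_ge0.
under eq_integral do rewrite -EFinM.
rewrite integral_oy_if; apply: eq_integral => x _; rewrite /h; case: ifP => // x0; congr EFin.
rewrite mulrCA; congr (_ * _); rewrite big_split/=; congr (_ * _).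
by rewrite -expR_sum; congr expR; rewrite sumrN -mulr_sumr mulrC.
Qed.

Lemma chi_functional : (0 < n)%N ->
  exists L : mpoly n R -> R, [/\ dirichlet_functional (beta / 2) L, L 1 = 1,
    forall f, P.-integrable setT (fun w => (meval (u w) f)%:E) &
    forall f, (\int[P]_w (meval (u w) f)%:E = (L f)%:E)%E].
Proof.
move=> n0; have mD := measurable_positive.
have intD (m : multinom n) : P.-integrable D (fun w => (1 * \prod_i u w i ^+ m i)%:E).
  by apply: integrableS (monomial_integrable m).
pose L := weighted_integral P D (fun=> 1) u.
have LE f : (\int[P]_(w in D) (1 * meval (u w) f)%:E = (L f)%:E)%E.
  exact: weighted_integralE.
have intT f : P.-integrable setT (fun w => (meval (u w) f)%:E).
  have := integrable_weighted measurableT monomial_integrable f.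
  by apply: eq_integrable => // w _; rewrite mul1r.
exists L; split=> //.
- apply: weighted_integral_dirichlet => //.
    by move=> w Dw; apply: sum_ratio; rewrite gt_eqF// sum_squares_gt0.
  move=> m i j; rewrite -/L.
  have mom k : ((Gamma (\sum_i m i).+1%:R / 2)%:E * (L (mpolyX R (mnm_add m (mnm1 k))))%:E =
    \int[mu]_(x in `]0%R, +oo[) (x `^ (2 * (\sum_i m i).+1%:R - 1) * ((x ^+ 2 + 2^-1)^-1 *
      ((beta / 2 + (m k)%:R) * \prod_i chi_gauss beta (x ^+ 2) (beta / 2 + (m i)%:R))))%:E)%E.
    rewrite -(mdegDU m k) -LE.
    transitivity ((Gamma (\sum_i (mnm_add m (mnm1 k)) i)%:R / 2)%:E *
      \int[P]_(w in D) (1 * \prod_i u w i ^+ (mnm_add m (mnm1 k)) i)%:E)%E.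
      by congr (_ * _)%E; apply: eq_integral => w _; rewrite mevalX.
    rewrite ratio_moment ?mdegDU//; apply: eq_integral => x _; congr (_ * _)%:E.
    apply: prod_recurrence; first by rewrite divr_gt0.
    by move=> y y0; apply: chi_gauss_step => //; exact: sqr_ge0.
  have Gk : (Gamma (\sum_i m i).+1%:R / 2 : R) != 0.
    by rewrite gt_eqF// divr_gt0// Gamma_gt0// ltr0n.
  apply: (mulfI Gk); apply: EFin_inj; rewrite !(mulrCA (Gamma _ / 2)) !EFinM !mom.
  (* Raising the exponent of index k multiplies this common factor by beta / 2 + m_k; the two sides
     of the moment relation then agree in the extended reals. *)
  pose I0 : \bar R := (\int[mu]_(x in `]0%R, +oo[) (x `^ (2 * (\sum_i m i).+1%:R - 1) *
    ((x ^+ 2 + 2^-1)^-1 * \prod_i chi_gauss beta (x ^+ 2) (beta / 2 + (m i)%:R)))%:E)%E.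
  have pos (k : 'I_n) (x : R) : 0 <= chi_gauss beta (x ^+ 2) (beta / 2 + (m k)%:R).
    rewrite mulr_ge0//; first by rewrite mulr_ge0 ?powR_ge0// invr_ge0 ltW// Gamma_gt0// divr_gt0.
    by rewrite mulr_ge0 ?invr_ge0 ?mulr_ge0 ?powR_ge0// ltW// Gamma_gt0// ltr_wpDr// divr_gt0.
  have mX2 : measurable_fun setT (fun x : R => x ^+ 2 + 2^-1).
    by apply: measurable_funD => //; exact: measurable_funX.
  have mgauss y : measurable_fun setT (fun x : R => chi_gauss beta (x ^+ 2) y).
    apply: measurable_funM => //; apply: measurable_funM => //.
    rewrite (_ : (fun x => _) = fun x => 2^-1 * (x ^+ 2 + 2^-1) `^ (- y)); last first.
      by apply/funext => x; rewrite powRN invfM.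
    by apply: measurable_funM => //; exact: measurable_powR_comp.
  have momE (k : 'I_n) : (\int[mu]_(x in `]0%R, +oo[) (x `^ (2 * (\sum_i m i).+1%:R - 1) * ((x ^+ 2 + 2^-1)^-1 *
      ((beta / 2 + (m k)%:R) * \prod_i chi_gauss beta (x ^+ 2) (beta / 2 + (m i)%:R))))%:E =
      (beta / 2 + (m k)%:R)%:E * I0)%E.
    have x2 (x : R) : 0 <= x ^+ 2 + 2^-1 by rewrite addr_ge0 ?sqr_ge0// invr_ge0.
    rewrite /I0 -ge0_integralZl//.
    - apply: eq_integral => x _; rewrite -EFinM; congr EFin.
      by rewrite [RHS]mulrCA; congr (_ * _); exact: mulrCA.
    - apply/measurable_EFinP; apply: measurable_funTS; apply: measurable_funM.
        exact: measurable_powR.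
      apply: measurable_funM; last by apply: measurable_prod => i' _; exact: mgauss.
      rewrite (_ : (fun x => _) = fun x => (x ^+ 2 + 2^-1) `^ (-1)).
        exact: measurable_powR_comp.
      by apply/funext => x; rewrite powR_inv1.
    - move=> x _; rewrite lee_fin mulr_ge0 ?powR_ge0// mulr_ge0 ?invr_ge0//.
      by apply: prodr_ge0 => i' _; exact: pos.
    - by rewrite lee_fin addr_ge0// divr_ge0// ltW.
  by rewrite !momE muleCA.
- have := LE 1; rewrite (eq_integral (cst 1%E)); last by move=> w _; rewrite meval1 mulr1.
  rewrite integral_cst// mul1e => H; apply: EFin_inj; rewrite -H; exact: probability_positive.
- move=> f; rewrite -LE (@negligible_integral _ _ _ _ _ (~` D))//.
  + rewrite setDE setCK setTI; apply: eq_integral => w _; by rewrite mul1r.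
  + exact: measurableC.
  + exact: probability_nonpositive.
Qed.

End ChiFunctional.

(** * Eigenvalues of the projected matrix *)


Section Eigenvalues.

(** The matrix determinant lemma, from two block-triangular factorizations of the bordered matrix
    [M]. *)
Lemma det_rank_one_update (K : fieldType) n (B B' : 'M[K]_n) (u : 'cV[K]_n) (v : 'rV[K]_n) :
  B *m B' = 1%:M -> \det (B + u *m v) = \det B * (1 + (v *m B' *m u) 0 0).
Proof.
move=> BB'; pose M := block_mx (1%:M : 'M[K]_1) (- v) u B.
have M1 : M = block_mx 1%:M 0 u 1%:M *m block_mx 1%:M (- v) 0 (B + u *m v).
  rewrite mulmx_block !mul1mx !mul0mx !mulmx1 !addr0 mulmxN; congr block_mx.
  by rewrite addrC addrK.
have M2 : M = block_mx (1%:M + v *m B' *m u) (- v) 0 B *m block_mx 1%:M 0 (B' *m u) 1%:M.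
  rewrite mulmx_block !mulmx1 !mulmx0 !add0r mulNmx !mulmxA BB' mul1mx; congr block_mx.
  by rewrite addrK.
have := congr1 determinant M1; rewrite det_mulmx det_lblock det_ublock !det1 !mul1r => <-.
rewrite M2 det_mulmx det_lblock det_ublock !det1 !mulr1 mulrC; congr (_ * _).
by rewrite det_mx11 !mxE eqxx.
Qed.

Lemma horner_char_poly (K : comNzRingType) n (A : 'M[K]_n) y :
  (char_poly A).[y] = \det (y%:M - A).
Proof.
rewrite /char_poly -horner_evalE -det_map_mx; congr determinant.
by apply/matrixP => i j; rewrite !mxE /= horner_evalE hornerD hornerN hornerC hornerMn hornerX.
Qed.

Variable R : realType.

Lemma char_poly_eigenvalues n (A : 'M[R]_n) y :
  \prod_(i < n) (real_complex R y - (mx_eigenvalues A)`_i) = real_complex R (char_poly A).[y].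
Proof.
rewrite /mx_eigenvalues; case: closed_field_poly_normal => r /= rE.
have lead1 : lead_coef (char_poly (map_mx (real_complex R) A)) = 1.
  exact/monicP/char_poly_monic.
rewrite lead1 scale1r in rE.
have szr : size r = n.
  have := size_char_poly (map_mx (real_complex R) A); rewrite rE size_prod_XsubC.
  by case.
rewrite -horner_map map_char_poly rE horner_prod (big_nth 0) big_mkord szr.
by apply: eq_bigr => i _; rewrite hornerXsubC.
Qed.

(** A symmetric polynomial of the eigenvalues is F of the signed coefficients of the characteristic
    polynomial, so the order of the eigenvalues and their possible nonreality disappear. Large
    integers t suffice to identify these coefficients. *)
Lemma meval_mx_comp n (F p : mpoly n R) (A : 'M[R]_n) (g : 'I_n -> R) N :
  comp_mpoly (esyms n R) F = p ->
  (forall t, (N <= t)%N -> (char_poly A).[t%:R] = t%:R ^+ n - genf g t%:R) ->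
  meval_mx p A = meval g F.
Proof.
move=> <- gE; rewrite /meval_mx; pose mu (i : 'I_n) := (mx_eigenvalues A)`_i.
have muE (k : 'I_n) : meval mu (mesym n R[i] k.+1) = real_complex R (g k).
  move: k; apply: (@genf_inj _ _ _ _ N) => t Nt.
  rewrite genf_esyms_roots -[t%:R](rmorph_nat (real_complex R)) char_poly_eigenvalues gE//.
  rewrite rmorphB rmorphXn subKr /genf rmorph_sum; apply: eq_bigr => k _.
  by rewrite !rmorphM !rmorphXn rmorphN1.
suff -> : meval mu (map_mpoly (real_complex R) (comp_mpoly (esyms n R) F)) =
  real_complex R (meval g F) by [].
by apply: meval_map_comp_mpoly => i; rewrite tnth_mktuple map_mpoly_mesym; exact: muE.
Qed.

Lemma meval_mx_diag n (F p : mpoly n R) (lam : 'rV[R]_n) :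
  comp_mpoly (esyms n R) F = p -> meval_mx p (diag_mx lam) = meval (lam 0) p.
Proof.
move=> FE; rewrite (@meval_mx_comp _ F p _ (fun k => meval (lam 0) (mesym n R k.+1)) 0)//.
  rewrite -FE comp_mpoly_meval; apply: meval_eq => k; by rewrite tnth_mktuple.
move=> t _; rewrite genf_esyms_roots subKr horner_char_poly.
have -> : t%:R%:M - diag_mx lam = diag_mx (\row_j (t%:R - lam 0 j)).
  by apply/matrixP => i j; rewrite !mxE mulrnBl.
by rewrite det_diag; apply: eq_bigr => i _; rewrite mxE.
Qed.

Lemma meval_mx_scalar n (F p : mpoly n R) :
  comp_mpoly (esyms n R) F = p -> meval_mx p 1%:M = meval (fun=> 1) p.
Proof.
move=> /meval_mx_diag E; rewrite -diag_const_mx E; apply: meval_eq => i.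
by rewrite mxE.
Qed.

(** t - (I - q q^t) Lambda is the rank-one update (t - Lambda) + q (q^t Lambda) of a diagonal
    matrix, invertible for large t. *)
Lemma meval_mx_projection n (F p : mpoly n R) (lam : 'rV[R]_n) (q : 'cV[R]_n) :
  comp_mpoly (esyms n R) F = p -> \sum_i q i ord0 ^+ 2 = 1 ->
  meval_mx p ((1%:M - q *m q^T) *m diag_mx lam) =
  meval (fun i => q i ord0 ^+ 2) (comp_mpoly (weps (lam 0)) F).
Proof.
move=> FE q1; rewrite meval_comp_weps comp_mpoly_meval; set g := fun k => _.
have [N NP] := nat_avoid (lam 0); apply: (meval_mx_comp (N := N) FE) => t Nt.
have t0 i : t%:R - lam 0 i != 0 by exact: NP.
rewrite horner_char_poly (genf_eps (lam 0) (fun i => q i ord0 ^+ 2)).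
pose B := diag_mx (\row_j (t%:R - lam 0 j)).
pose B' := diag_mx (\row_j (t%:R - lam 0 j)^-1).
have BB' : B *m B' = 1%:M.
  by rewrite mulmx_diag -diag_const_mx; congr diag_mx; apply/rowP => j; rewrite !mxE divff.
have -> : t%:R%:M - (1%:M - q *m q^T) *m diag_mx lam = B + q *m (q^T *m diag_mx lam).
  rewrite mulmxBl mul1mx opprB addrA addrAC mulmxA; congr (_ + _).
  by apply/matrixP => i j; rewrite !mxE mulrnBl.
rewrite (det_rank_one_update _ _ BB') det_diag.
have -> : (q^T *m diag_mx lam *m B' *m q) 0 0 = \sum_j q j ord0 ^+ 2 * (lam 0 j / (t%:R - lam 0 j)).
  rewrite mxE; apply: eq_bigr => j _; rewrite !mul_mx_diag !mxE.
  by rewrite !ord1 expr2; ring.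
under [X in _ - X]eq_bigr do rewrite mulrBr.
(* The constant 1 is written as the sum of the q_j^2; then 1 + lam_j / (t - lam_j) = t / (t - lam_j)
   produces the factor t of the zero eigenvalue. *)
rewrite sumrB -mulr_suml q1 mul1r subKr -[X in _ * (X + _)]q1 -big_split /= mulr_sumr.
apply: eq_bigr => j _; rewrite (bigD1 j)//= mxE.
rewrite (eq_bigr (fun i => t%:R - lam 0 i)); last by move=> i _; rewrite mxE.
by move: (\prod_(i | i != j) _) => p'; field; exact: t0.
Qed.

End Eigenvalues.

(** * Averages of Jack polynomials over the sphere and over chi vectors *)

Section Averages.
Local Open Scope classical_set_scope.
Variables (R : realType) (beta : R) (C : forall m : nat, seq nat -> mpoly m R).
Hypotheses (beta0 : 0 < beta) (jackC : jack_family beta C).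
Variables (n : nat) (kappa : seq nat).
Hypotheses (pk : is_partition kappa) (kn : (size kappa <= n)%N).

Let a0 : 0 < beta / 2. Proof. by rewrite divr_gt0. Qed.

Lemma divide_out (x y A B D : R) : y != 0 -> B != 0 -> x * A = y * B * D ->
  D = A / B * y^-1 * x.
Proof.
move=> y0 B0 E; apply: (mulfI (mulf_neq0 y0 B0)); rewrite -E.
by field; rewrite y0 B0.
Qed.

Lemma sphere_mass_gt0 k : 0 < Gamma (beta / 2) ^+ k.+1 / (2 ^+ k * Gamma (k.+1%:R * (beta / 2))).
Proof. by rewrite divr_gt0 ?mulr_gt0 ?exprn_gt0 ?Gamma_gt0 ?mulr_gt0 ?ltr0n. Qed.

Lemma jack_ones_neq0 m mu : is_partition mu -> (size mu <= m)%N ->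
  meval (fun=> 1) (C m mu) != 0.
Proof.
apply: (jack1_neq0 beta0 jackC) => k.
have [L [dL L1 _ _]] := sphere_functional_exists k a0; exists L => //.
by rewrite L1 gt_eqF// sphere_mass_gt0.
Qed.

Lemma jack_as_esyms m mu : is_partition mu -> (size mu <= m)%N ->
  exists2 F, comp_mpoly (esyms m R) F = C m mu & dom_weight (psum mu) F.
Proof. by move=> pm mm; exact: sym_dom_supp (jack_sym jackC pm mm) (jack_dom jackC pm mm). Qed.

Lemma meval_mx_jack_diag m mu (lam : 'rV[R]_m) : is_partition mu -> (size mu <= m)%N ->
  meval_mx (C m mu) (diag_mx lam) = meval (lam 0) (C m mu).
Proof. by move=> pm mm; have [F FE _] := jack_as_esyms pm mm; exact: meval_mx_diag FE. Qed.

Lemma meval_mx_jack1 m mu : is_partition mu -> (size mu <= m)%N ->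
  meval_mx (C m mu) 1%:M = meval (fun=> 1) (C m mu).
Proof. by move=> pm mm; have [F FE _] := jack_as_esyms pm mm; exact: meval_mx_scalar FE. Qed.

(** One polynomial p in the squares q_i^2 serves every Dirichlet functional; sphere and chi vectors
    then differ only in the value of [L 1]. *)
Lemma projected_average (lam : 'rV[R]_n.+1) : exists p : mpoly n.+1 R,
  (forall q : 'cV[R]_n.+1, \sum_i q i ord0 ^+ 2 = 1 ->
    meval_mx (C n.+1 kappa) ((1%:M - q *m q^T) *m diag_mx lam) =
    meval (fun i => q i ord0 ^+ 2) p) /\
  (forall L, dirichlet_functional (beta / 2) L ->
    L p * meval_mx (C n.+1 kappa) 1%:M =
    L 1 * meval_mx (C n kappa) 1%:M * meval_mx (C n.+1 kappa) (diag_mx lam)).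
Proof.
have kn1 := leq_trans kn (leqnSn n); have [F FE KF] := jack_as_esyms pk kn1.
exists (comp_mpoly (weps (lam 0)) F); split=> [q|L dL].
  exact: meval_mx_projection.
have [c cE c1] := jack_average beta0 jackC pk kn FE KF dL.
by rewrite meval_mx_jack_diag// !meval_mx_jack1// cE -c1 mulrAC.
Qed.

Lemma sphere_average (lam : 'rV[R]_n.+1) :
  let f (q : 'cV[R]_n.+1) : R := (\prod_(i < n.+1) q i ord0 `^ (beta - 1)) *
    meval_mx (C n.+1 kappa) ((1%:M - q *m q^T) *m diag_mx lam) in
  sphere_integrable f /\
  ((meval_mx (C n.+1 kappa) (diag_mx lam))%:E =
   (meval_mx (C n.+1 kappa) 1%:M / meval_mx (C n kappa) 1%:M *
    (2 ^+ n * Gamma (n.+1%:R * beta / 2) / Gamma (beta / 2) ^+ n.+1))%:E * sphere_integral f)%E.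
Proof.
move=> f; have [p [pE pL]] := projected_average lam.
have [L [dL L1 intL LE]] := sphere_functional_exists n a0.
have fE y : orthant_ball y -> f (@sphere_point R n.+1 y) =
    \prod_i (@sphere_point R n.+1 y) i ord0 `^ (2 * (beta / 2) - 1) *
    meval (fun i => (@sphere_point R n.+1 y) i ord0 ^+ 2) p.
  move=> yb; rewrite /f pE ?sphere_point_sum//; congr (_ * _).
  by apply: eq_bigr => i _; congr powR; field.
split.
  by apply: eq_integrable (intL p) => [|y /set_mem yb]; [exact: measurable_orthant_ball|rewrite fE].
have -> : sphere_integral f = (L p)%:E.
  by rewrite -LE; apply: eq_integral => y /set_mem yb; rewrite fE.
have C0 : meval_mx (C n kappa) 1%:M != 0 by rewrite meval_mx_jack1// jack_ones_neq0.
have := pL L dL; have := sphere_mass_gt0 n; rewrite -L1 => L0 LpE.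
have -> : 2 ^+ n * Gamma (n.+1%:R * beta / 2) / Gamma (beta / 2) ^+ n.+1 = (L 1)^-1.
  by rewrite L1 invf_div mulrA.
by rewrite -EFinM; congr EFin; exact: divide_out (lt0r_neq0 L0) C0 LpE.
Qed.

Lemma chi_average (d : measure_display) (T : measurableType d) (P : probability T R)
    (X : 'I_n.+1 -> {RV P >-> R}) (lam : 'rV[R]_n.+1) :
  (forall i, chi_distributed beta (X i)) -> mutually_independent X ->
  let q (w : T) : 'cV[R]_n.+1 := normalize (\col_(i < n.+1) X i w) in
  let Y (w : T) : R := meval_mx (C n.+1 kappa) ((1%:M - q w *m (q w)^T) *m diag_mx lam) in
  P.-integrable [set: T] (EFin \o Y) /\
  ((meval_mx (C n.+1 kappa) (diag_mx lam))%:E =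
   (meval_mx (C n.+1 kappa) 1%:M / meval_mx (C n kappa) 1%:M)%:E * 'E_P[Y])%E.
Proof.
move=> chiX indep q Y; have [p [pE pL]] := projected_average lam.
have [L [dL L1 intL LE]] := chi_functional beta0 chiX indep (ltn0Sn n).
pose S w := \sum_i X i w ^+ 2; pose N := [set w | S w = 0].
have S0 w : 0 <= S w by apply: sumr_ge0 => i _; exact: sqr_ge0.
have qE w i : q w i ord0 ^+ 2 = X i w ^+ 2 / S w.
  rewrite !mxE /= exprMn exprVn mulrC; congr (_ / _).
  rewrite sqr_sqrtr; first by apply: eq_bigr => j _; rewrite mxE.
  by apply: sumr_ge0 => j _; exact: sqr_ge0.
(* Where all X_i vanish, [normalize] returns 0, so Y is C_kappa(Lambda) there while p is evaluated
   at 0. The gap k on this null set corrects the formula for Y to an equality at every point, from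
   which measurability follows. *)
pose k := meval_mx (C n.+1 kappa) (diag_mx lam) - meval (fun=> 0) p.
have mN : measurable N.
  rewrite -[N]setTI; exact: (measurable_sum_squares X measurableT (measurable_set1 0)).
have PN : P N = 0%E.
  apply: (subset_measure0 (B := ~` [set w | forall i, 0 < X i w])) => //.
  - by apply: measurableC; exact: measurable_positive.
  - by move=> w Nw /(sum_squares_gt0 (ltn0Sn n)); rewrite -/(S w) Nw ltxx.
  - exact: probability_nonpositive chiX indep.
have YE w : Y w = meval (fun i => X i w ^+ 2 / S w) p + k * \1_N w.
  rewrite indicE; have [Sw|Sw] := eqVneq (S w) 0.
    rewrite mem_set// mulr1 /Y /k.
    have -> : q w = 0.
      apply/colP => i; apply/eqP; rewrite [X in _ == X]mxE -sqrf_eq0.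
      by rewrite qE Sw invr0 mulr0.
    rewrite mul0mx subr0 mul1mx (meval_eq (v2 := fun=> 0)) ?subrKC//.
    by move=> i; rewrite Sw invr0 mulr0.
  rewrite memNset; last exact/eqP.
  rewrite mulr0 addr0 /Y pE; first by apply: meval_eq => i; rewrite qE.
  by rewrite (eq_bigr _ (fun i _ => qE w i)) -mulr_suml divff.
have intN : P.-integrable setT (fun w => (k * \1_N w)%:E).
  apply: le_integrable (finite_measure_integrable_cst P k measurableT) => //.
    by apply/measurable_EFinP; apply: measurable_funM => //; exact: measurable_indic.
  move=> w _; rewrite lee_fin /= normrM indicE ler_piMr//.
  by case: (w \in N); rewrite ?normr1 ?normr0.
split.
  apply: eq_integrable (integrableD measurableT (intL p) intN) => // w _.
  by rewrite /= -EFinD YE.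
have -> : ('E_P[Y] = (L p)%:E)%E.
  rewrite unlock -LE; under eq_integral do rewrite YE EFinD.
  rewrite integralD// [X in (_ + X)%E](_ : _ = 0%E) ?adde0//.
  under eq_integral do rewrite EFinM.
  rewrite integralZl//; last exact: integrable_indic.
  transitivity (k%:E * P N)%E; first by rewrite integral_indic// setIT.
  by rewrite PN mule0.
have C0 : meval_mx (C n kappa) 1%:M != 0 by rewrite meval_mx_jack1// jack_ones_neq0.
have L0 : L 1 != 0 by rewrite L1 oner_neq0.
rewrite -EFinM; congr EFin; have := divide_out L0 C0 (pL L dL).
by rewrite L1 invr1 mulr1.
Qed.

End Averages.

Local Open Scope classical_set_scope.
Local Open Scope ring_scope.
Local Open Scope ereal_scope.

Theorem corollary1 (R : realType) (beta : R)
    (C : forall m : nat, seq nat -> mpoly m R)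
    (n : nat) (kappa : seq nat) :
  (0 < beta)%R ->
  jack_family beta C ->
  (2 <= n)%N ->
  is_partition kappa ->
  (size kappa < n)%N ->
  (forall lambda : 'rV[R]_n,
    let f (q : 'cV[R]_n) : R :=
      ((\prod_(i < n) q i ord0 `^ (beta - 1)) *
       meval_mx (C n kappa) ((1%:M - q *m q^T) *m diag_mx lambda))%R in
    sphere_integrable f /\
    (meval_mx (C n kappa) (diag_mx lambda))%:E =
      (meval_mx (C n kappa) 1%:M / meval_mx (C n.-1 kappa) 1%:M *
       (2 ^+ n.-1 * Gamma (n%:R * beta / 2) / Gamma (beta / 2) ^+ n))%:E *
      sphere_integral f) /\
  (exists c : R,
    forall (d : measure_display) (T : measurableType d) (P : probability T R)
           (X : 'I_n -> {RV P >-> R}),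
      (forall i, chi_distributed beta (X i)) ->
      mutually_independent X ->
      forall lambda : 'rV[R]_n,
        let q (w : T) : 'cV[R]_n := normalize (\col_(i < n) X i w)%R in
        let Y (w : T) : R :=
          meval_mx (C n kappa) ((1%:M - q w *m (q w)^T) *m diag_mx lambda) in
        P.-integrable [set: T] (EFin \o Y) /\
        (meval_mx (C n kappa) (diag_mx lambda))%:E = c%:E * 'E_P[Y]).
Proof.
move=> beta0 jackC n2 pk kn; case: n n2 kn => [//|n] _ kn.
split=> [lambda|]; first exact: (sphere_average beta0 jackC pk kn).
(* For a probability measure [L 1] is 1, so only the quotient of Jack values remains. *)
exists (meval_mx (C n.+1 kappa) 1%:M / meval_mx (C n kappa) 1%:M)%R => d T P X chiX indep lambda.
exact: (chi_average beta0 jackC pk kn lambda chiX indep).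
Qed.
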